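(* Let $d,n\ge 1$, $1<r<\infty$ and $1\le p_1,p_2<\infty$, and let $\Lambda\colon L^r(\mathbb{R}^d)\times L^{r'}(\mathbb{R}^d)\to\mathbb{C}$ be a bounded sesquilinear form satisfying the conditions (S), (T), (L1) and (L2) listed in the context (with parameters $r,p_1,p_2$ and constants $C_T(r)$, $C_L$). Then there exists a positive absolute constant $\Theta$ such that the following holds: for all compactly supported $\vec f\in L^{p_1}(\mathbb{R}^d,\mathbb{C}^n)$ and $\vec g\in L^{p_2}(\mathbb{R}^d,\mathbb{C}^n)$ there exists a sparse collection $\mathcal{S}$ of cubes in $\mathbb{R}^d$ such that $$\sup_{\mu<\nu}|\Lambda_\mu^\nu(\vec f,\vec g)|\le \mathcal{C}_{\Theta,d,n}\sum_{Q\in\mathcal{S}}|Q|\,\langle\!\langle\vec f\rangle\!\rangle_{p_1,Q}\cdot\langle\!\langle\vec g\rangle\!\rangle_{p_2,Q},\qquad \mathcal{C}_{\Theta,d,n}:=2^{\Theta d}\,[C_T(r)+C_L]\,n^{\frac32+\frac1{p_1}+\frac1{p_2}},$$ where the supremum is over integers $\mu<\nu$.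
   Context: **General notation.** $p'=p/(p-1)$ is the Hölder conjugate. Sesquilinear means linear in the first and conjugate-linear in the second variable. $\|h\|_{p,Q}:=(\frac1{|Q|}\int_Q|h|^p)^{1/p}$ (with the usual change for $p=\infty$). $M_ph(x):=\sup_{Q\ni x}\|h\|_{p,Q}$, supremum over cubes $Q$ containing $x$. ''Absolute constant'' means independent of all parameters. **Convex bodies.** For $\vec f=(f_1,\dots,f_n)$ with $f_i\in L^p(Q)$, $\langle\!\langle\vec f\rangle\!\rangle_{p,Q}:=\{(\frac1{|Q|}\int_Q f_i\bar\varphi)_{i=1}^n:\ \|\varphi\|_{p',Q}\le1\}\subset\mathbb{C}^n$. The product $\langle\!\langle\vec f\rangle\!\rangle_{p_1,Q}\cdot\langle\!\langle\vec g\rangle\!\rangle_{p_2,Q}:=\{a\cdot b: a\in\langle\!\langle\vec f\rangle\!\rangle_{p_1,Q},\,b\in\langle\!\langle\vec g\rangle\!\rangle_{p_2,Q}\}$ (with $a\cdot b=\sum_i a_i\bar b_i$) is a closed disc in $\mathbb{C}$ centred at $0$, and it is identified with its radius in $[0,\infty)$. **Vector extension.** A sesquilinear form $t$ is extended to $\mathbb{C}^n$-valued functions by $t(\vec f,\vec g):=\sum_{i=1}^n t(\vec f\cdot\vec e_i,\vec g\cdot\vec e_i)$ for any orthonormal basis $(\vec e_i)$ of $\mathbb{C}^n$ (independent of the basis). **Sparse.** A collection $\mathcal{S}$ of cubes is sparse if there are pairwise disjoint measurable sets $E(Q)\subset Q$, $Q\in\mathcal{S}$, with $|E(Q)|\ge\eta|Q|$,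 where $\eta\in(0,1)$ depends only on the dimensional parameters $d,n$. **The form.** The kernel $K=K(x,y)$ of $\Lambda$ coincides with a function away from the diagonal: whenever $f\in L^r$, $g\in L^{r'}$ are compactly and disjointly supported, $\Lambda(f,g)=\int\int K(x,y)f(y)\,dy\,\bar g(x)\,dx$ with absolute convergence. Moreover $K=\sum_{s\in\mathbb{Z}}K_s$ with (S) $\operatorname{supp}K_s\subset\{(x,y): 2^{s-2}<|x-y|<2^s\}$. For integers $\mu<\nu$ put $\Lambda_\mu^\nu(h_1,h_2):=\int_{\mathbb{R}^d\times\mathbb{R}^d}\sum_{\mu<s\le\nu}K_s(x,y)h_1(y)\bar h_2(x)\,dy\,dx$ (implicitly, these expressions are well defined for the functions to which they are applied). Assume (T) $C_T(r):=\sup_{\mu<\nu}\|\Lambda_\mu^\nu\|_{L^r\times L^{r'}\to\mathbb{C}}<\infty$. **Stopping collections.** Let $\mathscr{D}$ be a dyadic lattice in $\mathbb{R}^d$, $Q\in\mathscr{D}$, $s_Q:=\log_2\ell(Q)$ ($\ell$ is the side length). A collection $\mathcal{Q}\subset\mathscr{D}$ is a stopping collection with top $Q$ if its elements are pairwise disjoint, contained in $3Q$, satisfy $7L\cap7L'=\emptyset$ whenever $L,L'\in\mathcal{Q}$ and $|s_L-s_{L'}|\ge8$, and satisfy $\bigcup_{L\in\mathcal{Q},\,3L\cap2Q\ne\emptyset}9L\subset\mathbf{sh}\mathcal{Q}:=\bigcup_{L\in\mathcal{Q}}L$. ($cL$ is the concentric dilate.) **Local forms.** $\Lambda_{Q,\mu,\nu}(h_1,h_2):=\Lambda_\mu^{\min\{s_Q,\nu\}}(h_1\mathbf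 1_Q,h_2)$ (zero if $\min\{s_Q,\nu\}\le\mu$), and $\Lambda_{\mathcal{Q},\mu,\nu}(h_1,h_2):=\Lambda_{Q,\mu,\nu}(h_1,h_2)-\sum_{L\in\mathcal{Q},L\subset Q}\Lambda_{L,\mu,\nu}(h_1,h_2)$. **Local spaces.** For $1\le p\le\infty$, $\mathcal{Y}_p(\mathcal{Q})$ is the space of $h\in L^p(\mathbb{R}^d)$ supported in $3Q$ with finite $\|h\|_{\mathcal{Y}_p(\mathcal{Q})}:=\max\{\|h\mathbf 1_{\mathbb{R}^d\setminus\mathbf{sh}\mathcal{Q}}\|_\infty,\ \sup_{L\in\mathcal{Q}}\inf_{x\in\widehat L}M_ph(x)\}$ for $p<\infty$ and $\|h\|_{\mathcal{Y}_\infty(\mathcal{Q})}:=\|h\|_\infty$, where $\widehat L$ is the $2^5$-fold dilate of $L$. $\mathcal{X}_p(\mathcal{Q})$ is the subspace of $b\in\mathcal{Y}_p(\mathcal{Q})$ with $b=\sum_{L\in\mathcal{Q}}b_L$, $\operatorname{supp}b_L\subset L$; $\dot{\mathcal{X}}_p(\mathcal{Q})$ is the subspace of $b\in\mathcal{X}_p(\mathcal{Q})$ with $\int_Lb_L=0$ for all $L\in\mathcal{Q}$. Both carry the $\mathcal{Y}_p(\mathcal{Q})$ norm. **Local bounds.** There is a constant $C_L$ such that, uniformly over all $\mu,\nu\in\mathbb{Z}$, all dyadic lattices $\mathscr{D}$, all $Q\in\mathscr{D}$ and all stopping collections $\mathcal{Q}\subset\mathscr{D}$ with top $Q$, (L1)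 $|\Lambda_{\mathcal{Q},\mu,\nu}(b,h)|\le C_L|Q|\,\|b\|_{\dot{\mathcal{X}}_{p_1}(\mathcal{Q})}\|h\|_{\mathcal{Y}_{p_2}(\mathcal{Q})}$, (L2) $|\Lambda_{\mathcal{Q},\mu,\nu}(h,b)|\le C_L|Q|\,\|h\|_{\mathcal{Y}_\infty(\mathcal{Q})}\|b\|_{\dot{\mathcal{X}}_{p_2}(\mathcal{Q})}$. *)

(* Defs.v *)
From HB Require Import structures.
From mathcomp Require Import all_boot all_order all_algebra.
From mathcomp Require Import all_classical all_reals all_analysis.
From mathcomp Require Import complex.

Set Implicit Arguments.
Unset Strict Implicit.
Unset Printing Implicit Defensive.
Import Order.TTheory GRing.Theory Num.Theory numFieldNormedType.Exports.
Import ComplexField.Normc.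

Local Open Scope classical_set_scope.
Local Open Scope ring_scope.
Local Open Scope complex_scope.

(* R^d, with the product sigma-algebra that the library puts on tuples. *)
Notation RR R d := (d.-tuple (measurableTypeR R)).

Section lebesgue_step.
Context (R : realType) (d : nat)
  (m : {sigma_finite_measure set (RR R d) -> \bar R}).

Let consp (z : measurableTypeR R * RR R d) : RR R d.+1 :=
  [tuple of z.1 :: z.2].
Let unconsp (t : RR R d.+1) : measurableTypeR R * RR R d :=
  (thead t, [tuple of behead t]).

Let measurable_consp :
  measurable_fun [set: measurableTypeR R * RR R d] consp.
Proof. exact: measurable_cons. Qed.

Let measurable_unconsp : measurable_fun [set: RR R d.+1] unconsp.
Proof.
apply/measurable_fun_pairP; split.
  exact: (@measurable_tnth _ (measurableTypeR R) d.+1 ord0).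
exact: measurable_behead.
Qed.

Let conspK : cancel consp unconsp.
Proof.
by move=> [x t]; rewrite /unconsp /consp /=; congr pair; apply/val_inj.
Qed.

Definition lebesgue_step : set (RR R d.+1) -> \bar R :=
  pushforward (lebesgue_measure \x m)%E consp.

Let preimage_measurable A : measurable A -> measurable (consp @^-1` A).
Proof. by move=> mA; rewrite -[_ @^-1` _]setTI; exact: measurable_consp. Qed.

Let lebesgue_step0 : lebesgue_step set0 = 0%E.
Proof. by rewrite /lebesgue_step /pushforward preimage_set0 measure0. Qed.

Let lebesgue_step_ge0 A : (0 <= lebesgue_step A)%E.
Proof. exact: measure_ge0. Qed.

Let lebesgue_step_sigma_additive : semi_sigma_additive lebesgue_step.
Proof.
move=> F mF tF mUF; rewrite /lebesgue_step /pushforward preimage_bigcup.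
apply: (@measure_semi_sigma_additive _ _ _ (lebesgue_measure \x m)%E).
- by move=> n; exact: preimage_measurable.
- apply/trivIsetP => /= i j _ _ ij; rewrite -preimage_setI.
  by move/trivIsetP : tF => /(_ _ _ _ _ ij) ->//; rewrite preimage_set0.
- by rewrite -preimage_bigcup; exact: preimage_measurable.
Qed.

HB.instance Definition _ := isMeasure.Build _ _ _ lebesgue_step
  lebesgue_step0 lebesgue_step_ge0 lebesgue_step_sigma_additive.

Let lebesgue_step_sigma_finite : sigma_finite setT lebesgue_step.
Proof.
have /sigma_finiteP[F [TF ndF Foo]] := sigma_finiteT (@lebesgue_measure R).
have /sigma_finiteP[G [TG ndG Goo]] := sigma_finiteT m.
exists (fun k => unconsp @^-1` (F k `*` G k)).
  rewrite -preimage_bigcup (_ : \bigcup_i _ = setT) ?preimage_setT//.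
  rewrite -setXTT TF TG predeqE => -[x y]; split.
    by move=> [n _ []/= ? ?]; split; exists n.
  move=> [/= [n _ Fnx] [k _ Gky]]; exists (maxn n k) => //; split.
  - by move: x Fnx; exact/subsetPset/ndF/leq_maxl.
  - by move: y Gky; exact/subsetPset/ndG/leq_maxr.
move=> k; have [mF Fk] := Foo k; have [mG Gk] := Goo k; split.
  by rewrite -[_ @^-1` _]setTI; apply: measurable_unconsp => //;
    exact: measurableX.
rewrite /lebesgue_step /pushforward -comp_preimage.
rewrite (_ : unconsp \o consp = id); last exact/funext/conspK.
by rewrite preimage_id product_measure1E// lte_mul_pinfty// ge0_fin_numE.
Qed.

HB.instance Definition _ := Measure_isSigmaFinite.Build _ _ _ lebesgue_step
  lebesgue_step_sigma_finite.

End lebesgue_step.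

Fixpoint lebesgue (R : realType) (d : nat) :
    {sigma_finite_measure set (RR R d) -> \bar R} :=
  match d with
  | 0 => [the {sigma_finite_measure set (RR R 0) -> \bar R}
          of dirac [tuple]]
  | d'.+1 => [the {sigma_finite_measure set (RR R d'.+1) -> \bar R}
              of lebesgue_step (lebesgue R d')]
  end.

Lemma lebesgue_box (R : realType) (d : nat) (a b : RR R d) :
  (forall i, tnth a i <= tnth b i :> R) ->
  lebesgue R d [set x | forall i, tnth a i <= tnth x i < tnth b i] =
  (\prod_(i < d) (tnth b i - tnth a i : R))%:E.
Proof.
elim: d a b => [|d IH] a b ab.
  by rewrite big_ord0 /= diracE mem_set//= => -[].
pose a' := [tuple of behead a]; pose b' := [tuple of behead b].
have tl (t : RR R d.+1) i : tnth [tuple of behead t] i = tnth t (lift ord0 i).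
  by rewrite [in RHS](tuple_eta t) tnthS.
have tnthS' (x : R) (t : RR R d) i :
    tnth [tuple of behead [tuple of x :: t]] i = tnth t i.
  by congr tnth; apply/val_inj.
rewrite big_ord_recl EFinM.
under eq_bigr do rewrite -!tl.
rewrite -(IH a' b'); last by move=> i; rewrite !tl.
rewrite /= /lebesgue_step /pushforward.
rewrite (_ : _ @^-1` _ = `[tnth a ord0, tnth b ord0[%classic `*`
  [set x | forall i, tnth a' i <= tnth x i < tnth b' i]); last first.
  apply/seteqP; split=> [[x t] /= H|[x t] /= [H0 H] i].
    split; first by have := H ord0; rewrite in_itv/=.
    by move=> i; have := H (lift ord0 i); rewrite -!tl tnthS'.
  by case: (unliftP ord0 i) => [j ->|->];
    [rewrite -!tl tnthS'|rewrite in_itv in H0].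
rewrite product_measure1E//; last first.
  rewrite (_ : mkset _ = \bigcap_(i in setT)
      [set x | tnth a' i <= tnth x i < tnth b' i]).
    apply: fin_bigcap_measurable => // i _.
    rewrite (_ : mkset _ = (tnth (T:=measurableTypeR R))^~ i @^-1`
        `[tnth a' i, tnth b' i[%classic).
      rewrite -[_ @^-1` _]setTI; exact: (@measurable_tnth _ (measurableTypeR R)).
    by apply/seteqP; split => x /=; rewrite in_itv.
  by apply/seteqP; split => x /= H i; [move=> _|]; exact: H.
congr (_ * _)%E.
have := @lebesgue_measure_itv R `[(tnth a ord0 : R), tnth b ord0[.
rewrite /= lte_fin => ->.
by case: ltgtP (ab ord0) => // -> _; rewrite subrr.
Qed.

Section points.
Context (R : realType) (d : nat).
Implicit Types (x y : RR R d) (f g : RR R d -> R[i]).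

(* Tuples carry no topology in the library; it is borrowed from row vectors. *)
Definition rowv x : 'rV[R]_d := \row_i tnth x i.

Definition edist x y : R := Num.sqrt (\sum_(i < d) (tnth x i - tnth y i) ^+ 2).

Definition supp f : set 'rV[R]_d := closure (rowv @` [set x | f x != 0]).

Definition vanishes_off f (A : set (RR R d)) := forall x, ~ A x -> f x = 0.

End points.

Section complex_integration.
Context (disp : measure_display) (T : measurableType disp) (R : realType).
Implicit Types (D : set T) (f : T -> R[i]).

Definition cmeasurable D f :=
  measurable_fun D (fun x => complex.Re (f x)) /\
  measurable_fun D (fun x => complex.Im (f x)).

Definition cintegrable (mu : {measure set T -> \bar R}) D f :=
  mu.-integrable D (fun x => (complex.Re (f x))%:E) /\
  mu.-integrable D (fun x => (complex.Im (f x))%:E).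

Definition cintegral (mu : {measure set T -> \bar R}) D f : R[i] :=
  (\int[mu]_(x in D) complex.Re (f x))%R +i*
  (\int[mu]_(x in D) complex.Im (f x))%R.

Definition cnorm (mu : {measure set T -> \bar R}) (p : \bar R) f : \bar R :=
  Lnorm mu p (fun x => (normc (f x))%:E).

(* Functions stand for their almost-everywhere classes. *)
Definition inLp (mu : {measure set T -> \bar R}) (p : \bar R) f :=
  cmeasurable setT f /\ (cnorm mu p f < +oo)%E.

End complex_integration.

Section cubes.
Context (R : realType) (d : nat).

Record cube := Cube { corner : RR R d; side : R; side_gt0 : 0 < side }.

HB.instance Definition _ := gen_eqMixin cube.
HB.instance Definition _ := gen_choiceMixin cube.

Implicit Types (Q L : cube) (D : set cube).

(* Half-open, so that the cubes of a given generation tile R^d. *)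
Definition cset Q : set (RR R d) :=
  [set x | forall i,
    tnth (corner Q) i <= tnth x i < tnth (corner Q) i + side Q].

Definition dilate (c : R) Q : set (RR R d) :=
  [set x | forall i,
    let m := tnth (corner Q) i + side Q / 2 in
    m - c * side Q / 2 <= tnth x i < m + c * side Q / 2].

Definition vol Q : R := fine (lebesgue R d (cset Q)).

Definition dyadic_descendant (k : nat) Q L :=
  side L = side Q / 2 ^+ k /\
  exists m : 'I_d -> 'I_(2 ^ k),
    forall i, tnth (corner L) i = tnth (corner Q) i + (m i)%:R * side L.

(* Dyadic lattices in the sense of Lerner and Nazarov, normalized so that side
   lengths are integral powers of 2. *)
Definition dyadic_lattice D :=
  [/\ forall Q, D Q -> exists k : int, side Q = 2 ^ k,
      forall Q L, D Q -> dyadic_descendant 1 Q L -> D L,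
      forall L L', D L -> D L' -> exists Q k k',
        [/\ D Q, dyadic_descendant k Q L & dyadic_descendant k' Q L']
    & forall K : set 'rV[R]_d, compact K ->
        exists2 Q, D Q & @rowv R d @^-1` K `<=` cset Q].

(* On a dyadic lattice the logarithm is an integer and the floor is exact. *)
Definition scale Q : int := Num.floor (ln (side Q) / ln 2).

Definition shadow D : set (RR R d) := \bigcup_(L in D) cset L.

Definition stopping_collection (lattice : set cube) Q (Qs : set cube) :=
  [/\ Qs `<=` lattice /\ trivIset Qs cset,
      forall L, Qs L -> cset L `<=` dilate 3 Q,
      forall L L', Qs L -> Qs L' -> 8 <= `|scale L - scale L'| ->
        dilate 7 L `&` dilate 7 L' = set0
    & \bigcup_(L in [set L | Qs L /\ dilate 3 L `&` dilate 2 Q !=set0])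
        dilate 9 L `<=` shadow Qs].

Definition sparse (eta : R) (S : set cube) :=
  exists2 E : cube -> set (RR R d), trivIset S E &
    forall Q, S Q -> [/\ measurable (E Q), E Q `<=` cset Q &
      (eta%:E * lebesgue R d (cset Q) <= lebesgue R d (E Q))%E].

End cubes.
Arguments cube : clear implicits.

Section averages.
Context (R : realType) (d : nat).
Implicit Types (Q : cube R d) (h : RR R d -> R[i]) (p : \bar R).
Local Open Scope ereal_scope.

Definition avg_norm p Q h : \bar R :=
  match p with
  | q%:E => ((vol Q)^-1%:E *
      \int[lebesgue R d]_(x in cset Q) (normc (h x) `^ q)%:E) `^ q^-1
  | _ => cnorm (lebesgue R d) +oo (fun x => h x * \1_(cset Q) x)%R
  end.

Definition maximal p h (x : RR R d) : \bar R :=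
  ereal_sup [set avg_norm p Q h | Q in [set Q | cset Q x]].

End averages.

Section convex_bodies.
Context (R : realType) (d n : nat).
Implicit Types (a b : 'I_n -> R[i]) (f g : 'I_n -> RR R d -> R[i]).

Definition cdot a b : R[i] := \sum_(i < n) a i * (b i)^*.

Definition convex_body (p : \bar R) (Q : cube R d) f : set ('I_n -> R[i]) :=
  [set (fun i => (vol Q)^-1%:C *
          cintegral (lebesgue R d) (cset Q) (fun x => f i x * (phi x)^*))
  | phi in [set phi | cmeasurable (cset Q) phi /\
                      (avg_norm (hoelder_conjugate p) Q phi <= 1)%E]].

Definition body_prod (A B : set ('I_n -> R[i])) : set R[i] :=
  [set cdot a b | a in A & b in B].

(* The radius of a disc centred at 0. *)
Definition radius (A : set R[i]) : \bar R :=
  ereal_sup [set (normc z)%:E | z in A].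

Definition sparse_form (p1 p2 : \bar R) (S : set (cube R d)) f g : \bar R :=
  (\esum_(Q in S) (lebesgue R d (cset Q) *
     radius (body_prod (convex_body p1 Q f) (convex_body p2 Q g))))%E.

End convex_bodies.

Section forms.
Context (R : realType) (d : nat).
Implicit Types (h f g : RR R d -> R[i]) (K : RR R d -> RR R d -> R[i]).
Implicit Types (Ks : int -> RR R d -> RR R d -> R[i]) (mu nu : int).
Implicit Types (Q L : cube R d) (Qs : set (cube R d)) (p q r : \bar R).

Local Notation leb := (lebesgue R d).
Local Notation leb2 := (leb \x leb)%E.

Definition bounded_sesquilinear r (Lam : (RR R d -> R[i]) ->
    (RR R d -> R[i]) -> R[i]) :=
  let r' := hoelder_conjugate r in
  [/\ forall (c : R[i]) f1 f2 g, inLp leb r f1 -> inLp leb r f2 ->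
        inLp leb r' g ->
        Lam (fun x => c * f1 x + f2 x) g = c * Lam f1 g + Lam f2 g,
      forall (c : R[i]) f g1 g2, inLp leb r f -> inLp leb r' g1 ->
        inLp leb r' g2 ->
        Lam f (fun x => c * g1 x + g2 x) = c^* * Lam f g1 + Lam f g2
    & exists C : R, forall f g, inLp leb r f -> inLp leb r' g ->
        ((normc (Lam f g))%:E <= C%:E * cnorm leb r f * cnorm leb r' g)%E].

Definition kernel_off_diagonal r (Lam : (RR R d -> R[i]) ->
    (RR R d -> R[i]) -> R[i]) K :=
  forall f g, inLp leb r f -> inLp leb (hoelder_conjugate r) g ->
    compact (supp f) -> compact (supp g) -> supp f `&` supp g = set0 ->
    let F := fun z : RR R d * RR R d => K z.1 z.2 * f z.2 * (g z.1)^* in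
    cintegrable leb2 setT F /\ Lam f g = cintegral leb2 setT F.

(* At each off-diagonal point the sum over s has at most two nonzero terms,
   by [kernel_support]. *)
Definition kernel_decomposition K Ks :=
  forall x y, x != y -> K x y = \sum_(s \in [set: int]) Ks s x y.

Definition kernel_support Ks := forall s x y,
  Ks s x y != 0 -> 2 ^ (s - 2) < edist x y < 2 ^ s.

Definition trunc_integrand Ks mu nu h1 h2 (z : RR R d * RR R d) : R[i] :=
  (\sum_(s \in [set s : int | mu < s <= nu]) Ks s z.1 z.2) *
    h1 z.2 * (h2 z.1)^*.

Definition trunc Ks mu nu h1 h2 : R[i] :=
  cintegral leb2 setT (trunc_integrand Ks mu nu h1 h2).

(* [cintegral] is total: these are the pairs to which the truncated forms are
   applied, where the integrals are to converge absolutely. *)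
Definition trunc_defined r p1 p2 Ks :=
  forall mu nu h1 h2, mu < nu ->
    (inLp leb r h1 /\ inLp leb (hoelder_conjugate r) h2) \/
    [/\ inLp leb p1 h1, inLp leb p2 h2, compact (supp h1) & compact (supp h2)]
    -> cintegrable leb2 setT (trunc_integrand Ks mu nu h1 h2).

Definition trunc_norm r Ks mu nu : \bar R :=
  ereal_sup [set z | exists f g,
    [/\ inLp leb r f /\ (cnorm leb r f <= 1)%E,
        inLp leb (hoelder_conjugate r) g /\
          (cnorm leb (hoelder_conjugate r) g <= 1)%E
      & z = (normc (trunc Ks mu nu f g))%:E]].

Definition C_T r Ks : \bar R :=
  ereal_sup [set trunc_norm r Ks z.1 z.2
            | z in [set z : int * int | z.1 < z.2]].

Definition local_form Ks Q mu nu h1 h2 : R[i] :=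
  trunc Ks mu (Num.min (scale Q) nu) (fun y => h1 y * \1_(cset Q) y) h2.

(* For pairwise disjoint dyadic Qs the sum has finitely many nonzero terms:
   [local_form Ks L mu nu] is zero unless [mu < scale L]. *)
Definition stopping_form Ks Q Qs mu nu h1 h2 : R[i] :=
  local_form Ks Q mu nu h1 h2 -
  \sum_(L \in [set L | Qs L /\ cset L `<=` cset Q]) local_form Ks L mu nu h1 h2.

Definition Ynorm p Qs h : \bar R :=
  if p == +oo%E then cnorm leb p h else
  Order.max (cnorm leb +oo%E (fun x => h x * \1_(~` shadow Qs) x))
    (ereal_sup [set ereal_inf [set maximal p h x | x in dilate (2 ^+ 5) L]
               | L in Qs]).

Definition Yspace p Q Qs h :=
  [/\ inLp leb p h, vanishes_off h (dilate 3 Q) & (Ynorm p Qs h < +oo)%E].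

Definition X0space p Q Qs b := Yspace p Q Qs b /\
  exists bL : cube R d -> RR R d -> R[i],
    [/\ forall L, Qs L -> vanishes_off (bL L) (cset L),
        forall x, b x = \sum_(L \in Qs) bL L x
      & forall L, Qs L -> cintegral leb (cset L) (bL L) = 0].

Definition local_bound1 p1 p2 (C : R) Ks :=
  forall mu nu lattice Q Qs b h, dyadic_lattice lattice -> lattice Q ->
    stopping_collection lattice Q Qs -> X0space p1 Q Qs b ->
    Yspace p2 Q Qs h ->
    ((normc (stopping_form Ks Q Qs mu nu b h))%:E <=
      C%:E * leb (cset Q) * Ynorm p1 Qs b * Ynorm p2 Qs h)%E.

Definition local_bound2 p2 (C : R) Ks :=
  forall mu nu lattice Q Qs h b, dyadic_lattice lattice -> lattice Q ->
    stopping_collection lattice Q Qs -> Yspace +oo%E Q Qs h ->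
    X0space p2 Q Qs b ->
    ((normc (stopping_form Ks Q Qs mu nu h b))%:E <=
      C%:E * leb (cset Q) * Ynorm +oo%E Qs h * Ynorm p2 Qs b)%E.

(* The vector extension, computed in the standard basis of C^n. *)
Definition vector_trunc (n : nat) Ks mu nu (f g : 'I_n -> RR R d -> R[i]) :=
  \sum_(i < n) trunc Ks mu nu (f i) (g i).

End forms.

(* Main.v *)
Require Import Defs.
From HB Require Import structures.
From mathcomp Require Import all_boot all_order all_algebra.
From mathcomp Require Import all_classical all_reals all_analysis.
From mathcomp Require Import complex measurable_realfun ess_sup_inf.
From mathcomp Require Import ring lra zify finmap.
Import Order.TTheory GRing.Theory Num.Theory numFieldNormedType.Exports.
Import ComplexField.Normc.

(** The local form of a grid cube Q is compared with the local forms of smaller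
    cubes. Choose a set E of small measure off which f and g are bounded by
    multiples of their averages over 3Q, and let W be the Whitney cubes of E.
    Subtracting the local forms of the cubes of W inside Q from that of Q leaves the
    stopping form, and this is at most a multiple of |Q| times the averages ([stopping_estimate]): f and g
    are decomposed into a part with mean zero on every cube of W and a bounded part;
    the two local bounds control the terms with a mean-zero part, and the uniform
    bound on the truncations controls the product of the bounded parts. The cubes
    that were subtracted are treated in the same way. They fill at most half of Q, so
    the triples 3Q of all cubes that occur form a sparse family
    ([sparse_descendants]). A local form vanishes when its cube is smaller than the
    scale at which the kernel is cut off, so for each truncation the recursion ends
    after finitely many steps, although the tree of cubes does not depend on it
    ([sum_le_descendants]). It starts from a cube so large that its local form is the
    whole form ([trunc_top_cube]).

    Convex bodies enter through the choice of coordinates on each cube. The vector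
    form depends on f and g only through the sum over i of f_i(y) conj(g_i(x)), and
    this is unchanged when f and g are replaced by their coordinates with respect to
    a basis u_1, ..., u_n and its dual basis. Let the u_i be points of the convex body of
    f on 3Q that nearly maximize the determinant ([auerbach]). Then the coordinates of
    all points of the body are bounded by 2, which by duality means that each
    coordinate of f has norm at most 2 on 3Q. The norm of the i-th coordinate of g is
    the supremum of |u_i . b| over the body of g, hence at most the product of the two
    bodies ([normalized_coordinates]). If the body of f lies in a proper subspace, the
    coordinates in the missing directions vanish. Applying the scalar estimate to the
    n pairs of coordinates with one common set E costs a factor n for the sum, and
    n^(1/p1 + 1/p2) because each of the 2n exceptional sets may use only a fraction
    1/n of the measure of E ([vector_stopping_estimate]). This is within the power of
    n that is claimed.

    All cubes of the stopping collections are taken from one dyadic lattice, whose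
    generations are shifted by alternating thirds ([dyadic_lattice_grid]). Arbitrary
    cubes are compared with grid cubes through their neighbours ([large_average_bad]),
    and differentiation of integrals is replaced by a density theorem for grid cubes
    ([density]), which follows from the approximation of measurable sets by unions of
    grid cubes. *)

Set Implicit Arguments.
Unset Strict Implicit.
Unset Printing Implicit Defensive.

Local Open Scope classical_set_scope.
Local Open Scope ring_scope.
Local Open Scope complex_scope.

Local Notation Re := complex.Re.
Local Notation Im := complex.Im.
Local Notation edist := Defs.edist.

(** * Complex-valued functions and their integrals *)

Section complex_norm.
Context (R : realType).
Implicit Types (z w : R[i]).

Lemma normc_ge0 z : 0 <= normc z.
Proof. by case: z => a b; exact: sqrtr_ge0. Qed.

Lemma normc_conj z : normc z^* = normc z.
Proof. by case: z => a b /=; rewrite sqrrN. Qed.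

Lemma normc_real (a : R) : normc a%:C = `|a|.
Proof. by rewrite /= expr0n /= addr0 sqrtr_sqr. Qed.

Lemma Re_le_normc z : `|Re z| <= normc z.
Proof.
by case: z => a b /=; rewrite -sqrtr_sqr ler_wsqrtr// lerDl sqr_ge0.
Qed.

Lemma Im_le_normc z : `|Im z| <= normc z.
Proof.
by case: z => a b /=; rewrite -sqrtr_sqr ler_wsqrtr// lerDr sqr_ge0.
Qed.

Lemma normc_le_ReIm z : normc z <= `|Re z| + `|Im z|.
Proof.
case: z => a b /=; rewrite -[leRHS]ger0_norm ?addr_ge0// -sqrtr_sqr ler_wsqrtr//.
rewrite sqrrD !real_normK ?num_real// -addrA lerD2l lerDr.
by rewrite mulrn_wge0// mulr_ge0.
Qed.

Lemma normc_sum (I : Type) (s : seq I) (F : I -> R[i]) :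
  normc (\sum_(i <- s) F i) <= \sum_(i <- s) normc (F i).
Proof.
elim: s => [|a s IH]; first by rewrite !big_nil normc0.
by rewrite !big_cons (le_trans (le_normcD _ _))// lerD2l.
Qed.

Lemma ReM z w : Re (z * w) = Re z * Re w - Im z * Im w.
Proof. by case: z => a b; case: w => c e. Qed.

Lemma ImM z w : Im (z * w) = Re z * Im w + Im z * Re w.
Proof. by case: z => a b; case: w => c e. Qed.

Lemma ReD z w : Re (z + w) = Re z + Re w.
Proof. by case: z => a b; case: w => c e. Qed.

Lemma ImD z w : Im (z + w) = Im z + Im w.
Proof. by case: z => a b; case: w => c e. Qed.

Lemma ReJ z : Re z^* = Re z.
Proof. by case: z. Qed.

Lemma ImJ z : Im z^* = - Im z.
Proof. by case: z. Qed.

Lemma Re_indic (T : Type) (A : set T) x : Re (\1_A x : R[i]) = \1_A x.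
Proof. by rewrite !indicE; case: (x \in A). Qed.

Lemma Im_indic (T : Type) (A : set T) x : Im (\1_A x : R[i]) = 0.
Proof. by rewrite !indicE; case: (x \in A). Qed.

Lemma normc_indic (T : Type) (A : set T) x : normc (\1_A x : R[i]) = \1_A x.
Proof. by rewrite !indicE; case: (x \in A); rewrite ?normc0 ?normc1. Qed.

End complex_norm.

Section complex_functions.
Context (disp : measure_display) (T : measurableType disp) (R : realType).
Context (mu : {measure set T -> \bar R}).
Implicit Types (D : set T) (f g : T -> R[i]).

Lemma cmeasurable_cst D (c : R[i]) : cmeasurable D (fun=> c).
Proof. by split; exact: measurable_cst. Qed.

Lemma cmeasurableD D f g : cmeasurable D f -> cmeasurable D g ->
  cmeasurable D (fun x => f x + g x).
Proof.
move=> [f1 f2] [g1 g2]; split.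
  by under eq_fun do rewrite ReD; exact: measurable_funD.
by under eq_fun do rewrite ImD; exact: measurable_funD.
Qed.

Lemma cmeasurableM D f g : cmeasurable D f -> cmeasurable D g ->
  cmeasurable D (fun x => f x * g x).
Proof.
move=> [f1 f2] [g1 g2]; split.
  by under eq_fun do rewrite ReM; apply: measurable_funB; exact: measurable_funM.
by under eq_fun do rewrite ImM; apply: measurable_funD; exact: measurable_funM.
Qed.

Lemma cmeasurableJ D f : cmeasurable D f -> cmeasurable D (fun x => (f x)^*).
Proof.
move=> [f1 f2]; split; first by under eq_fun do rewrite ReJ.
by under eq_fun do rewrite ImJ; exact: measurableT_comp.
Qed.

Lemma cmeasurable_indic D (A : set T) : measurable A ->
  cmeasurable D (fun x => \1_A x : R[i]).
Proof.
move=> mA; split; last by under eq_fun do rewrite Im_indic; exact: measurable_cst.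
by under eq_fun do rewrite Re_indic; exact: measurable_indic.
Qed.

Lemma cmeasurableS D E f : measurable E -> D `<=` E -> cmeasurable E f ->
  cmeasurable D f.
Proof. by move=> mE DE [f1 f2]; split; apply: measurable_funS f1 || apply: measurable_funS f2. Qed.

Lemma measurable_normc D f : cmeasurable D f ->
  measurable_fun D (fun x => normc (f x)).
Proof.
move=> [f1 f2].
have -> : (fun x => normc (f x)) = (fun x => (Re (f x) ^+ 2 + Im (f x) ^+ 2) `^ 2^-1).
  by apply/funext => x; rewrite powR12_sqrt ?addr_ge0 ?sqr_ge0//; case: (f x).
apply: (measurableT_comp (@measurable_powR R 2^-1)).
by apply: measurable_funD; exact: measurable_funX.
Qed.

Lemma measurable_pow_normc D f (p : R) : cmeasurable D f ->
  measurable_fun D (fun x => (normc (f x) `^ p)%:E).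
Proof.
move=> mf; apply/measurable_EFinP.
exact: (measurableT_comp (measurable_powR p) (measurable_normc mf)).
Qed.

Lemma cintegrableP D f : measurable D -> cmeasurable D f ->
  (\int[mu]_(x in D) (normc (f x))%:E < +oo)%E -> cintegrable mu D f.
Proof.
move=> mD mf fi; have ni : mu.-integrable D (fun x => (normc (f x))%:E).
  apply/integrableP; split; first by apply/measurable_EFinP; exact: measurable_normc.
  by under eq_integral do rewrite gee0_abs ?lee_fin ?normc_ge0//.
split; apply: (le_integrable mD _ _ ni).
- by apply/measurable_EFinP; case: mf.
- by move=> x _; rewrite /= !lee_fin (le_trans (Re_le_normc _))// ler_norm.
- by apply/measurable_EFinP; case: mf.
- by move=> x _; rewrite /= !lee_fin (le_trans (Im_le_normc _))// ler_norm.
Qed.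

Lemma cintegralD D f g : measurable D -> cintegrable mu D f -> cintegrable mu D g ->
  cintegral mu D (fun x => f x + g x) = cintegral mu D f + cintegral mu D g.
Proof.
move=> mD [f1 f2] [g1 g2]; rewrite /cintegral.
rewrite -[RHS]/(_ +i* _); congr (_ +i* _).
  by rewrite -RintegralD//; apply: eq_Rintegral => x _; rewrite ReD.
by rewrite -RintegralD//; apply: eq_Rintegral => x _; rewrite ImD.
Qed.

Lemma cintegrableD D f g : measurable D -> cintegrable mu D f -> cintegrable mu D g ->
  cintegrable mu D (fun x => f x + g x).
Proof.
move=> mD [f1 f2] [g1 g2]; split.
  by under eq_fun do rewrite ReD EFinD; exact: integrableD.
by under eq_fun do rewrite ImD EFinD; exact: integrableD.
Qed.

Lemma cintegrableZ D (c : R[i]) f : measurable D -> cintegrable mu D f ->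
  cintegrable mu D (fun x => c * f x).
Proof.
move=> mD [f1 f2]; split.
  by under eq_fun do rewrite ReM EFinB !EFinM; apply: integrableB => //; exact: integrableZl.
by under eq_fun do rewrite ImM EFinD !EFinM; apply: integrableD => //; exact: integrableZl.
Qed.

Lemma cintegralZ D (c : R[i]) f : measurable D -> cintegrable mu D f ->
  cintegral mu D (fun x => c * f x) = c * cintegral mu D f.
Proof.
move=> mD [f1 f2]; rewrite /cintegral; case: c => a b.
have iZ (k : R) h : mu.-integrable D (EFin \o h) ->
    mu.-integrable D (EFin \o (fun x => k * h x)).
  by move=> hi; exact: (@integrableZl _ _ _ mu D mD k _ hi).
rewrite -[RHS]/(_ +i* _); congr (_ +i* _).
  rewrite -RintegralZl// -RintegralZl// -RintegralB//; last 2 first.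
  - exact: iZ.
  - exact: iZ.
  by apply: eq_Rintegral => x _; rewrite ReM.
rewrite -RintegralZl// -RintegralZl// -RintegralD//; last 2 first.
- exact: iZ.
- exact: iZ.
by apply: eq_Rintegral => x _; rewrite ImM.
Qed.

Lemma cintegral0 D : cintegral mu D (fun=> 0) = 0.
Proof.
rewrite /cintegral /Rintegral /=.
by rewrite integral0.
Qed.

Lemma cintegrable0 D : measurable D -> cintegrable mu D (fun=> 0).
Proof. by move=> mD; split; exact: integrable0. Qed.

Lemma cintegrable_sum D (I : Type) (s : seq I) (F : I -> T -> R[i]) :
  measurable D -> (forall i, cintegrable mu D (F i)) ->
  cintegrable mu D (fun x => \sum_(i <- s) F i x).
Proof.
move=> mD mF; elim: s => [|a s IH].
  by under eq_fun do rewrite big_nil; exact: cintegrable0.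
by under eq_fun do rewrite big_cons; exact: cintegrableD.
Qed.

Lemma cintegral_sum D (I : Type) (s : seq I) (F : I -> T -> R[i]) :
  measurable D -> (forall i, cintegrable mu D (F i)) ->
  cintegral mu D (fun x => \sum_(i <- s) F i x) = \sum_(i <- s) cintegral mu D (F i).
Proof.
move=> mD mF; elim: s => [|a s IH].
  by under eq_fun do rewrite big_nil; rewrite big_nil cintegral0.
under eq_fun do rewrite big_cons.
by rewrite big_cons cintegralD// ?IH//; exact: cintegrable_sum.
Qed.

Lemma eq_cintegral D f g : {in D, f =1 g} -> cintegral mu D f = cintegral mu D g.
Proof.
by move=> fg; rewrite /cintegral; congr (_ +i* _); apply: eq_Rintegral => x xD; rewrite fg.
Qed.

(** The factor 2 pays for treating the real and the imaginary part separately. *)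
Lemma normc_cintegral_le D f (M : R) : measurable D -> cmeasurable D f ->
  (\int[mu]_(x in D) (normc (f x))%:E <= M%:E)%E ->
  normc (cintegral mu D f) <= 2 * M.
Proof.
move=> mD mf fM; have [fi1 fi2] : cintegrable mu D f.
  by apply: cintegrableP => //; rewrite (le_lt_trans fM)// ltry.
rewrite (le_trans (normc_le_ReIm _))// /cintegral /=.
rewrite mulr2n mulrDl !mul1r lerD//.
  rewrite -lee_fin (le_trans _ fM)// EFin_normr_Rintegral//.
  apply: (le_trans (le_abse_integral _ mD _)).
    by apply/measurable_EFinP; case: mf.
  apply: ge0_le_integral => //=.
  - by apply/measurable_EFinP; apply: measurableT_comp => //; case: mf.
  - by apply/measurable_EFinP; exact: measurable_normc.
  - by move=> x _; rewrite lee_fin Re_le_normc.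
rewrite -lee_fin (le_trans _ fM)// EFin_normr_Rintegral//.
apply: (le_trans (le_abse_integral _ mD _)).
  by apply/measurable_EFinP; case: mf.
apply: ge0_le_integral => //=.
- by apply/measurable_EFinP; apply: measurableT_comp => //; case: mf.
- by apply/measurable_EFinP; exact: measurable_normc.
- by move=> x _; rewrite lee_fin Im_le_normc.
Qed.

End complex_functions.

(** * Cubes and their dilates *)

Section cube_geometry.
Context (R : realType) (d : nat).
Implicit Types (Q L : cube R d) (x y : RR R d).
Local Notation mu := (lebesgue R d).

Lemma measurable_half_box (a b : 'I_d -> R) :
  measurable [set x : RR R d | forall i, a i <= tnth x i < b i].
Proof.
rewrite (_ : mkset _ = \bigcap_(i in setT) [set x : RR R d | a i <= tnth x i < b i]).
  apply: fin_bigcap_measurable => // i _.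
  rewrite (_ : mkset _ = (fun x : RR R d => tnth x i) @^-1` `[a i, b i[%classic).
    rewrite -[_ @^-1` _]setTI; exact: (@measurable_tnth _ (measurableTypeR R)).
  by apply/seteqP; split => x /=; rewrite in_itv.
by apply/seteqP; split => x /= H i; [move=> _|]; exact: H.
Qed.

Lemma measurable_open_box (a b : 'I_d -> R) :
  measurable [set x : RR R d | forall i, a i < tnth x i < b i].
Proof.
rewrite (_ : mkset _ = \bigcap_(i in setT) [set x : RR R d | a i < tnth x i < b i]).
  apply: fin_bigcap_measurable => // i _.
  rewrite (_ : mkset _ = (fun x : RR R d => tnth x i) @^-1` `]a i, b i[%classic).
    rewrite -[_ @^-1` _]setTI; exact: (@measurable_tnth _ (measurableTypeR R)).
  by apply/seteqP; split => x /=; rewrite in_itv.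
by apply/seteqP; split => x /= H i; [move=> _|]; exact: H.
Qed.

Lemma measurable_cset Q : measurable (cset Q).
Proof. exact: measurable_half_box. Qed.

Lemma lebesgue_cset Q : mu (cset Q) = (side Q ^+ d)%:E.
Proof.
pose b : RR R d := [tuple tnth (corner Q) i + side Q | i < d].
have tb i : tnth b i = tnth (corner Q) i + side Q by rewrite tnth_mktuple.
rewrite (_ : cset Q = [set x | forall i, tnth (corner Q) i <= tnth x i < tnth b i]).
  rewrite lebesgue_box; last by move=> i; rewrite tb lerDl ltW ?side_gt0.
  congr (_ %:E); under eq_bigr do rewrite tb addrAC subrr add0r.
  by rewrite prodr_const card_ord.
by apply/seteqP; split => x H i; [rewrite tb|rewrite -tb]; exact: H.
Qed.

Lemma volE Q : vol Q = side Q ^+ d.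
Proof. by rewrite /vol lebesgue_cset. Qed.

Lemma vol_gt0 Q : 0 < vol Q.
Proof. by rewrite volE exprn_gt0 ?side_gt0. Qed.

Lemma lebesgue_vol Q : mu (cset Q) = (vol Q)%:E.
Proof. by rewrite volE lebesgue_cset. Qed.

Definition dil (c : R) (c0 : 0 < c) Q : cube R d :=
  @Cube R d [tuple tnth (corner Q) i + side Q / 2 - c * side Q / 2 | i < d]
    (c * side Q) (mulr_gt0 c0 (side_gt0 Q)).

Lemma cset_dil (c : R) (c0 : 0 < c) Q : cset (dil c0 Q) = dilate c Q.
Proof.
have e i : tnth (corner (dil c0 Q)) i = tnth (corner Q) i + side Q / 2 - c * side Q / 2.
  by rewrite tnth_mktuple.
apply/seteqP; split => x H i; have := H i; rewrite e /=.
  by move=> /andP[-> h2] /=; rewrite (lt_le_trans h2)//; lra.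
by move=> /andP[-> h2] /=; rewrite (lt_le_trans h2)//; lra.
Qed.

Lemma dilate1 Q : dilate 1 Q = cset Q.
Proof.
by apply/seteqP; split => x H i; have /andP[h1 h2] := H i; apply/andP; split; move: h1 h2; rewrite /=; lra.
Qed.

Lemma vol_dil (c : R) (c0 : 0 < c) Q : vol (dil c0 Q) = c ^+ d * vol Q.
Proof. by rewrite !volE exprMn. Qed.

Lemma measurable_dilate (c : R) Q : 0 < c -> measurable (dilate c Q).
Proof. by move=> c0; rewrite -(cset_dil c0); exact: measurable_cset. Qed.

Lemma lebesgue_dilate (c : R) Q : 0 < c -> mu (dilate c Q) = (c ^+ d * vol Q)%:E.
Proof. by move=> c0; rewrite -(cset_dil c0) lebesgue_vol vol_dil. Qed.

Lemma dilateS (b c : R) Q : 0 < b -> b <= c -> dilate b Q `<=` dilate c Q.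
Proof.
move=> b0 bc x H i; have s0 := side_gt0 Q.
have bs : b * side Q <= c * side Q by rewrite ler_pM2r.
by have /andP[h1 h2] := H i; apply/andP; split; move: h1 h2; rewrite /=; lra.
Qed.

Lemma corner_cset Q : cset Q (corner Q).
Proof. by move=> i; rewrite lexx ltrDl side_gt0. Qed.

Lemma lebesgueT_gt0 : (0 < mu [set: RR R d])%E.
Proof.
have Q : cube R d := @Cube R d [tuple 0 | i < d] 1 ltr01.
rewrite (@lt_le_trans _ _ (mu (cset Q)))//; first by rewrite lebesgue_vol lte_fin vol_gt0.
by apply: le_measure; rewrite ?in_setE//; exact: measurable_cset.
Qed.

(** Centre and half-width, the form in which linear arithmetic handles dilates. *)
Lemma dilateP (c : R) Q x : dilate c Q x <-> forall i,
  tnth (corner Q) i + side Q / 2 - c * side Q / 2 <= tnth x i /\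
  tnth x i < tnth (corner Q) i + side Q / 2 + c * side Q / 2.
Proof.
by split => H i; [have /andP[] := H i|apply/andP; exact: H].
Qed.

End cube_geometry.

(** * A dyadic lattice with alternating shifts *)

Section dyadic_grid.
Context (R : realType) (d : nat).
Implicit Types (Q L : cube R d) (x y : RR R d) (k : int).

Definition gsgn k : int := if odd `|k|%N then -1 else 1.

(** The hyperplanes of generation k are shifted by (-1)^k / 3 of the side length.
    Since 2 * (1/3) and -1/3 differ by an integer, the generations remain nested,
    and the origin stays away from the hyperplanes of every generation. *)
Definition gshift k : R := (gsgn k)%:~R / 3.

Lemma gsgnS k : gsgn (k + 1) = - gsgn k.
Proof.
rewrite /gsgn; have -> : odd (absz (k + 1)%R) = ~~ odd (absz k) by lia.
by case: (odd _); rewrite ?opprK.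
Qed.

Lemma gshiftS k : gshift (k + 1) = - gshift k.
Proof. by rewrite /gshift gsgnS rmorphN mulNr. Qed.

Lemma pow2_gt0 k : 0 < 2 ^ k :> R.
Proof. exact: exprz_gt0. Qed.

Lemma pow2S k : 2 ^ (k + 1) = 2 ^ k * 2 :> R.
Proof. by rewrite expfzDr// expr1z. Qed.

Lemma pow2_le (k l : int) : (k <= l)%R -> (2 ^ k : R) <= 2 ^ l.
Proof. by move=> kl; rewrite ler_weXz2l// ler1n. Qed.

Lemma pow2_nat (n : nat) : (2 : R) ^ (n%:Z) = 2 ^+ n.
Proof. by []. Qed.

Lemma le_pow2 (n : nat) : (n%:R : R) <= 2 ^+ n.
Proof. by rewrite -natrX ler_nat ltnW// ltn_expl. Qed.

Definition dcube k (m : {ffun 'I_d -> int}) : cube R d :=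
  @Cube R d [tuple 2 ^ k * ((m i)%:~R + gshift k) | i < d] (2 ^ k) (pow2_gt0 k).

Definition gindex k x : {ffun 'I_d -> int} :=
  [ffun i => Num.floor (tnth x i / 2 ^ k - gshift k)].

Definition dyad k x : cube R d := dcube k (gindex k x).

Definition grid : set (cube R d) := [set Q | exists k x, Q = dyad k x].

Lemma tnth_dcube k m i : tnth (corner (dcube k m)) i = 2 ^ k * ((m i)%:~R + gshift k).
Proof. by rewrite tnth_mktuple. Qed.

Lemma floor_eqP (u : R) (n : int) : Num.floor u = n <-> n%:~R <= u < n%:~R + 1.
Proof.
split=> [<-|H]; last by apply: floor_def; rewrite intrD1.
by have := floor_itv u; rewrite intrD1.
Qed.

Lemma gindexP k m x : gindex k x = m <-> cset (dcube k m) x.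
Proof.
have p0 := pow2_gt0 k.
have E i : (Num.floor (tnth x i / 2 ^ k - gshift k) = m i) <->
    (tnth (corner (dcube k m)) i <= tnth x i < tnth (corner (dcube k m)) i + 2 ^ k).
  rewrite floor_eqP tnth_dcube lerBrDr ler_pdivlMr// ltrBlDr ltr_pdivrMr//.
  rewrite ![2 ^ k * _]mulrC [X in _ < X](_ : _ = ((m i)%:~R + gshift k) * 2 ^ k + 2 ^ k)//.
  by ring.
split; first by move=> e i; apply: (E i).1; rewrite -e ffunE.
by move=> H; apply/ffunP => i; rewrite ffunE; apply: (E i).2; exact: H.
Qed.

Lemma mem_dyad k x : cset (dyad k x) x.
Proof. by apply/gindexP. Qed.

Lemma dyadP k x y : cset (dyad k x) y <-> gindex k y = gindex k x.
Proof. by rewrite /dyad -gindexP. Qed.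

Lemma dyad_eq k x y : cset (dyad k x) y -> dyad k y = dyad k x.
Proof. by move=> /dyadP; rewrite /dyad => ->. Qed.

(** Let u be a coordinate in units of generation k, counted from the shifted origin.
    For generation k + 1 it becomes (u + s) / 2 with the integer s = (-1)^k, and the floor
    of that number depends on the floor of u only. *)
Lemma gindexS k x y : gindex k x = gindex k y -> gindex (k + 1) x = gindex (k + 1) y.
Proof.
move=> /ffunP e; apply/ffunP => i; have := e i; rewrite !ffunE => {}e.
have h z : tnth z i / 2 ^ (k + 1) - gshift (k + 1) =
    ((tnth z i / 2 ^ k - gshift k) + (gsgn k)%:~R) / 2 :> R.
  by rewrite gshiftS pow2S /gshift invfM; field; rewrite gt_eqF ?pow2_gt0.
rewrite !{}h; move: e.
set u := tnth x i / _ - _; set v := tnth y i / _ - _; move: u v (gsgn k) => u v s e.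
apply/esym/floor_eqP; set q := Num.floor _.
have [q1 q2] : q%:~R <= (u + s%:~R) / 2 /\ (u + s%:~R) / 2 < q%:~R + 1.
  by have /floor_eqP/andP[] := erefl q.
pose n := Num.floor u.
have [n1 n2] : n%:~R <= u /\ u < n%:~R + 1 by have /floor_eqP/andP[] := erefl n.
have [m1 m2] : n%:~R <= v /\ v < n%:~R + 1.
  by have /floor_eqP/andP[] : Num.floor v = n by rewrite /n -e.
have a1 : (2 * q - s <= n)%R.
  rewrite -ltzD1 -(ltr_int R) !rmorphD rmorphN rmorphM /=; lra.
have a2 : (n + 1 <= 2 * q + 2 - s)%R.
  rewrite lezD1 -(ltr_int R) !rmorphD rmorphN rmorphM /=; lra.
have {}a1 : 2 * q%:~R - s%:~R <= n%:~R :> R by rewrite -[2]/(2%:~R) -rmorphM -rmorphB ler_int.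
have {}a2 : n%:~R + 1 <= 2 * q%:~R + 2 - s%:~R :> R.
  by rewrite -[2]/(2%:~R) -[1]/(1%:~R) -rmorphM -!rmorphD -rmorphB ler_int.
by apply/andP; split; lra.
Qed.

Lemma gindex_le k l x y : (k <= l)%R -> gindex k x = gindex k y ->
  gindex l x = gindex l y.
Proof.
move=> kl; have -> : l = k + `|l - k|%N%:Z by lia.
elim: `|_|%N => [|n IH]; first by rewrite addr0.
by move=> /IH; rewrite -[n.+1]addn1 PoszD addrA; exact: gindexS.
Qed.

Lemma dyadS k l x : (k <= l)%R -> cset (dyad k x) `<=` cset (dyad l x).
Proof. by move=> kl y /dyadP e; apply/dyadP; exact: gindex_le e. Qed.

(** In every generation the origin has distance at least a third of the side
    length from the grid hyperplanes, so that a bounded set lies in a single cube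
    of every sufficiently late generation. *)
Lemma gindex_center (M : R) k x y : 3 * M < 2 ^ k ->
  (forall i, `|tnth x i| <= M) -> (forall i, `|tnth y i| <= M) ->
  gindex k x = gindex k y.
Proof.
move=> Mk xM yM; have p0 := pow2_gt0 k.
suff h z : (forall i, `|tnth z i| <= M) -> gindex k z = [ffun i => if odd `|k|%N then 0 else -1].
  by rewrite !h.
move=> zM; apply/ffunP => i; rewrite !ffunE; apply/floor_eqP.
have := zM i; rewrite ler_norml => /andP[z1 z2].
have w1 : tnth z i / 2 ^ k < 1 / 3 by rewrite ltr_pdivrMr//; lra.
have w2 : - (1 / 3) < tnth z i / 2 ^ k by rewrite ltr_pdivlMr//; lra.
by rewrite /gshift /gsgn; case: odd => /=; lra.
Qed.

Lemma cube_eq Q L : (forall i, tnth (corner Q) i = tnth (corner L) i) ->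
  side Q = side L -> Q = L.
Proof.
case: Q => a s s0; case: L => b t t0 /= /eq_from_tnth ab st.
by case: _ / ab; case: _ / st t0 => t0; congr Cube; exact: Prop_irrelevance.
Qed.

Lemma dyad_corner k m : dyad k (corner (dcube k m)) = dcube k m.
Proof. by rewrite /dyad (_ : gindex k _ = m)//; apply/gindexP; exact: corner_cset. Qed.

Lemma grid_dcube k m : grid (dcube k m).
Proof. by exists k, (corner (dcube k m)); rewrite dyad_corner. Qed.

Lemma scale_dyad k x : scale (dyad k x) = k.
Proof.
rewrite /scale /dyad /=.
suff -> : ln (2 ^ k : R) / ln 2 = k%:~R by rewrite intrKfloor.
by rewrite -powR_intmul// ln_powR mulfK// gt_eqF// ln_gt0// ltr1n.
Qed.

(** By induction on j: doubling a third changes it, up to sign, by an integer. *)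
Lemma gshift_step k (j : nat) : exists c : int,
  2 ^+ j * gshift (k + j%:Z) = gshift k + c%:~R :> R.
Proof.
elim: j => [|j [c IH]]; first by exists 0; rewrite expr0 mul1r !addr0.
exists (- 2 * c - gsgn k); rewrite -[j.+1]addn1 PoszD addrA gshiftS exprD expr1.
rewrite mulrN mulrAC IH rmorphB rmorphM rmorphN /= /gshift.
by field.
Qed.

Lemma dyadic_descendant_dyad k (j : nat) x :
  dyadic_descendant j (dyad (k + j%:Z) x) (dyad k x).
Proof.
have p0 := pow2_gt0 k.
have pj : 2 ^ (k + j%:Z) = 2 ^ k * 2 ^+ j :> R by rewrite expfzDr.
split; first by rewrite /= pj mulfK// expf_neq0.
have [c hc] := gshift_step k j.
pose g := gindex k x; pose G := gindex (k + j%:Z) x.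
pose m i := g i - 2 ^+ j * G i - c.
have mE i : tnth (corner (dyad k x)) i = tnth (corner (dyad (k + j%:Z) x)) i + (m i)%:~R * 2 ^ k.
  rewrite !tnth_dcube -/g -/G pj -[_ * _ * (_ + _)]mulrA [2 ^+ j * (_ + _)]mulrDr hc /m.
  by rewrite !rmorphB rmorphM rmorphXn /=; ring.
have mb i : (0 <= m i)%R && (m i < 2 ^+ j)%R.
  have cs : cset (dyad (k + j%:Z) x) (corner (dyad k x)).
    by apply: (@dyadS k _ x); [rewrite lerDl|exact: corner_cset].
  have /andP[] := cs i; rewrite mE lerDl => h1.
  rewrite ltrD2l /= pj [_ * 2 ^+ j]mulrC ltr_pM2r// => h2.
  move: h1; rewrite pmulr_lge0// ler0z => -> /=.
  by rewrite -(ltr_int R) rmorphXn.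
have mn i : (absz (m i) < 2 ^ j)%N.
  have /andP[h1 h2] := mb i; rewrite -ltz_nat gez0_abs//.
  by rewrite -[(2 ^ j)%N%:Z]/((2 ^ j)%:Z) -natz natrX.
exists (fun i => Ordinal (mn i)) => i /=; rewrite mE; congr (_ + _ * _).
by have /andP[h1 h2] := mb i; rewrite -{1}[m i]gez0_abs.
Qed.

Lemma compact_coord_bound (K : set 'rV[R]_d) : compact K ->
  exists2 M : R, 0 <= M & forall v i, K v -> `|v ord0 i| <= M.
Proof.
move=> cK.
have h i : exists M : R, 0 <= M /\ forall v, K v -> `|v ord0 i| <= M.
  have c1 : compact ((fun v : 'rV[R]_d => v ord0 i) @` K).
    by apply: continuous_compact => //; apply: continuous_subspaceT; exact: coord_continuous.
  have [M M0 HM] := pinfty_ex_gt0 (compact_bounded c1).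
  by exists M; split; [exact: ltW|move=> v Kv; apply: HM; exists v].
have [M HM] := choice h; exists (\sum_i M i).
  by apply: sumr_ge0 => i _; have [] := HM i.
move=> v i Kv; rewrite (le_trans ((HM i).2 v Kv))// (bigD1 i)//= lerDl.
by apply: sumr_ge0 => j _; have [] := HM j.
Qed.

Lemma exists_pow2_gt (M : R) (l : int) : exists2 k : int, (l <= k)%R & M < 2 ^ k.
Proof.
exists (Posz (Num.bound `|M| + `|l|)); first by lia.
rewrite pow2_nat (@lt_le_trans _ _ (Num.bound `|M|)%:R)//.
  by rewrite (le_lt_trans (ler_norm M))// archi_boundP.
by rewrite (le_trans _ (le_pow2 _))// ler_nat leq_addr.
Qed.

(** Common ancestors of two cubes, and cubes that contain a given compact set,
    both come from [gindex_center]. *)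
Lemma dyadic_lattice_grid : dyadic_lattice grid.
Proof.
split.
- by move=> _ [k [x ->]]; exists k.
- move=> _ L [k [x ->]] [sL [m mE]].
  have kE : 2 ^ k = 2 ^ (k - 1) * 2 :> R by rewrite -pow2S subrK.
  have sL' : side L = 2 ^ (k - 1) by rewrite sL /= kE expr1 mulfK.
  pose M := [ffun i => 2 * gindex k x i + gsgn k + (m i)%:Z].
  suff -> : L = dcube (k - 1) M by exact: grid_dcube.
  apply: cube_eq => // i; rewrite mE tnth_dcube sL' ffunE tnth_dcube kE.
  have -> : gshift (k - 1) = - gshift k by rewrite -[k in RHS](subrK 1) gshiftS opprK.
  by rewrite !rmorphD rmorphM /= /gshift; field.
- move=> _ _ [k [x ->]] [k' [x' ->]].
  pose M : R := \sum_i (`|tnth x i| + `|tnth x' i|).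
  have [l hl Ml] := exists_pow2_gt (3 * M) (`|k| + `|k'|).
  have xM i : `|tnth x i| <= M.
    by rewrite /M (bigD1 i)//= -addrA lerDl addr_ge0// sumr_ge0// => j _; rewrite addr_ge0.
  have xM' i : `|tnth x' i| <= M.
    by rewrite /M (bigD1 i)//= addrAC lerDr addr_ge0// sumr_ge0// => j _; rewrite addr_ge0.
  exists (dyad l x), (absz (l - k)), (absz (l - k')); split; first by exists l, x.
    have := @dyadic_descendant_dyad k (absz (l - k)) x.
    by rewrite (_ : k + _ = l)//; lia.
  have := @dyadic_descendant_dyad k' (absz (l - k')) x'.
  rewrite (_ : k' + _ = l); last by lia.
  by rewrite /dyad (gindex_center Ml xM xM').
- move=> K cK; have [M M0 HM] := compact_coord_bound cK.
  have [l _ Ml] := exists_pow2_gt (3 * M) 0.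
  exists (dyad l [tuple 0 | i < d]); first by exists l, [tuple 0 | i < d].
  move=> x Kx; apply/dyadP; apply: (gindex_center Ml) => i.
    by have := HM _ i Kx; rewrite mxE.
  by rewrite tnth_mktuple normr0.
Qed.

Lemma gindex_lt k x y i : gindex k x i < gindex k y i ->
  tnth x i < 2 ^ k * ((gindex k y i)%:~R + gshift k).
Proof.
move=> h; have := mem_dyad k x i; rewrite tnth_dcube /= => /andP[_ h2].
rewrite (lt_le_trans h2)// -[leLHS]/(_ + _) -{2}[2 ^ k]mulr1 -mulrDr ler_pM2l ?pow2_gt0//.
by rewrite addrAC lerD2r -[1]/(1%:~R) -rmorphD ler_int lezD1.
Qed.

Lemma triple_dyadP k x y : dilate 3 (dyad k x) y <->
  forall i, (`|gindex k y i - gindex k x i| <= 1)%R.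
Proof.
have p0 := pow2_gt0 k.
have H i : tnth (corner (dyad k x)) i + side (dyad k x) / 2 - 3 * side (dyad k x) / 2 <= tnth y i /\
    tnth y i < tnth (corner (dyad k x)) i + side (dyad k x) / 2 + 3 * side (dyad k x) / 2 <->
    (`|gindex k y i - gindex k x i| <= 1)%R.
  have := mem_dyad k y i; rewrite !tnth_dcube /= => /andP[].
  move: (tnth y i) (gindex k y i) (gindex k x i) (gshift k) (2 ^ k : R) p0 => t a b g p p0 h1 h2.
  split=> [[h3 h4]|h].
    have a1 : p * a%:~R < p * (b%:~R + 2) by lra.
    have a2 : p * (b%:~R - 2) < p * a%:~R by lra.
    move: a1 a2; rewrite !ltr_pM2l// => a1 a2.
    have : (a < b + 2)%R by rewrite -(ltr_int R) rmorphD.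
    have : (b - 2 < a)%R by rewrite -(ltr_int R) rmorphB.
    by lia.
  have /(ler_wpM2l (ltW p0)) b1 : a%:~R <= b%:~R + 1 :> R.
    by rewrite -[1]/(1%:~R) -rmorphD ler_int; lia.
  have /(ler_wpM2l (ltW p0)) b2 : b%:~R - 1 <= a%:~R :> R.
    by rewrite -[1]/(1%:~R) -rmorphB ler_int; lia.
  by lra.
by rewrite dilateP; split => h i; apply/H.
Qed.

Lemma dyad_sub_triple k l x y : (l <= k)%R -> dilate 3 (dyad k x) y ->
  cset (dyad l y) `<=` dilate 3 (dyad k x).
Proof.
move=> lk /triple_dyadP h z /dyadP e; apply/triple_dyadP => i.
by rewrite (gindex_le lk e).
Qed.

End dyadic_grid.

(** * Distances and disjoint families of cubes *)

Section euclid.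
Context (R : realType) (d : nat).
Implicit Types (Q L : cube R d) (x y : RR R d).
Local Notation mu := (lebesgue R d).

Lemma edist_coord x y i : `|tnth x i - tnth y i| <= edist x y.
Proof.
rewrite /edist -sqrtr_sqr ler_wsqrtr// (bigD1 i)//= lerDl sumr_ge0// => j _.
exact: sqr_ge0.
Qed.

Lemma edist_le_sum x y : edist x y <= \sum_(i < d) `|tnth x i - tnth y i|.
Proof.
rewrite /edist -[leRHS]ger0_norm ?sumr_ge0// -sqrtr_sqr ler_wsqrtr//.
elim: (index_enum _) => [|i s IH]; first by rewrite !big_nil expr0n.
rewrite 2!big_cons [leRHS]sqrrD real_normK ?num_real// -addrA lerD2l (le_trans IH)// lerDr.
by rewrite mulrn_wge0// mulr_ge0// sumr_ge0.
Qed.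

(** The support condition on the kernel enters through this: in the local form
    of Q, the second function matters only on 3Q. *)
Lemma edist_triple Q x y : cset Q x -> edist x y < side Q -> dilate 3 Q y.
Proof.
move=> Qx xy; apply/dilateP => i; have /andP[h1 h2] := Qx i.
have := le_lt_trans (edist_coord x y i) xy; rewrite ltr_norml => /andP[h3 h4].
by split; lra.
Qed.

Lemma sum_vol_le (X : set (cube R d)) Q : finite_set X -> trivIset X (@cset R d) ->
  (forall L, X L -> cset L `<=` cset Q) -> \sum_(L \in X) vol L <= vol Q.
Proof.
move=> fX tX XQ.
have := @measure_fin_bigcup _ _ _ mu _ X (@cset R d) fX tX (fun L _ => measurable_cset L).
rewrite (eq_fsbigr (fun L => (vol L)%:E)); last by move=> L _; exact: lebesgue_vol.
rewrite fsbig_finite// sumEFin -fsbig_finite// => e.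
rewrite -lee_fin -e -lebesgue_vol; apply: le_measure; rewrite ?in_setE.
- by apply: fin_bigcup_measurable => // L _; exact: measurable_cset.
- exact: measurable_cset.
- by move=> x [L XL Lx]; exact: XQ Lx.
Qed.

(** By volume: at most |Q| / c disjoint cubes of volume c fit into Q. *)
Lemma finite_large_cubes (X : set (cube R d)) Q (c : R) : 0 < c ->
  trivIset X (@cset R d) -> (forall L, X L -> cset L `<=` cset Q) ->
  (forall L, X L -> c <= vol L) -> finite_set X.
Proof.
move=> c0 tX XQ Xc; apply: contrapT => /infinite_set_fset iX.
have [B BX sB] := iX (Num.bound (vol Q / c)).
have fB : finite_set [set` B] by exact: finite_fset.
have h1 : \sum_(L \in [set` B]) vol L <= vol Q.
  by apply: sum_vol_le => // [|L /BX]; [exact: sub_trivIset tX|exact: XQ].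
have h2 : (size (finmap.enum_fset B))%:R * c <= \sum_(L \in [set` B]) vol L.
  rewrite fsbig_finite//= set_fsetK mulr_natl -iter_addr_0 -(count_predT B) -big_const_seq.
  rewrite !big_seq; apply: ler_sum => L LB; exact/Xc/BX.
have := archi_boundP (divr_ge0 (ltW (vol_gt0 Q)) (ltW c0)).
rewrite ltr_pdivrMr// => h3.
have : vol Q < vol Q.
  by rewrite (lt_le_trans h3)// (le_trans _ h1)// (le_trans _ h2)// ler_pM2r// ler_nat.
by rewrite ltxx.
Qed.

End euclid.

(** * Countable unions over the grid *)

Section countable_families.
Context (R : realType) (d : nat).
Implicit Types (Q L P : cube R d) (D : set (cube R d)) (x y : RR R d) (k : int).
Local Notation mu := (lebesgue R d).
Local Notation grid := (@grid R d).

Lemma dcube_inj k k' (m m' : {ffun 'I_d -> int}) :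
  dcube R k m = dcube R k' m' -> (k, m) = (k', m').
Proof.
move=> e; have ek : k = k'.
  by rewrite -(@scale_dyad R d k (corner (dcube R k m))) dyad_corner e -dyad_corner scale_dyad.
rewrite -{}ek in e *; congr pair.
have /gindexP <- := corner_cset (@dcube R d k m).
by rewrite e; apply/gindexP; exact: corner_cset.
Qed.

(** The cubes of all generations, enumerated by their integer data, so that
    countable additivity applies to families of grid cubes. *)
Definition grid_at (n : nat) : option (cube R d) :=
  omap (fun c => @dcube R d c.1 c.2) (@pickle_inv (int * {ffun 'I_d -> int})%type n).

Lemma grid_atP Q : grid Q -> exists n, grid_at n = Some Q.
Proof.
by move=> [k [x ->]]; exists (choice.pickle (k, gindex k x)); rewrite /grid_at pickleK_inv.
Qed.

Lemma grid_at_inj n n' Q : grid_at n = Some Q -> grid_at n' = Some Q -> n = n'.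
Proof.
rewrite /grid_at.
case e : (pickle_inv n) => [[k m]|]//= -[] eQ; case e' : (pickle_inv n') => [[k' m']|]//= -[].
rewrite -eQ => /dcube_inj h; have := @pickle_invK (int * {ffun 'I_d -> int})%type n'.
have := @pickle_invK (int * {ffun 'I_d -> int})%type n.
by rewrite e e' /= h => <- <-.
Qed.

Definition grid_family D (X : cube R d -> set (RR R d)) (n : nat) : set (RR R d) :=
  if grid_at n is Some Q then (if `[< D Q >] then X Q else set0) else set0.

Lemma bigcup_grid_family D X : D `<=` grid ->
  \bigcup_n grid_family D X n = \bigcup_(Q in D) X Q.
Proof.
move=> Dg; apply/seteqP; split => x.
  move=> [n _]; rewrite /grid_family; case: grid_at => // Q.
  by case: asboolP => // DQ XQ; exists Q.
move=> [Q DQ Xx]; have [n e] := grid_atP (Dg _ DQ); exists n => //.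
by rewrite /grid_family e asboolT.
Qed.

Lemma trivIset_grid_family D X : trivIset D X -> trivIset setT (grid_family D X).
Proof.
move=> tD n n' _ _ [x []]; rewrite /grid_family.
case e : (grid_at n) => [Q|]//; case e' : (grid_at n') => [Q'|]//.
case: asboolP => // DQ Xx; case: asboolP => // DQ' Xx'.
apply: (grid_at_inj e); rewrite e'; congr Some.
by apply: (tD Q' Q DQ' DQ); exists x.
Qed.

Lemma measurable_grid_family D X : (forall Q, D Q -> measurable (X Q)) ->
  forall n, measurable (grid_family D X n).
Proof.
move=> mX n; rewrite /grid_family; case: grid_at => // Q; case: asboolP => // DQ.
exact: mX.
Qed.

Lemma measurable_bigcup_grid D (X : cube R d -> set (RR R d)) : D `<=` grid -> (forall Q, D Q -> measurable (X Q)) ->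
  measurable (\bigcup_(Q in D) X Q).
Proof.
move=> Dg mX; rewrite -bigcup_grid_family//; apply: bigcupT_measurable.
exact: measurable_grid_family.
Qed.

(** The form in which disjoint cubes are used for covering arguments: X Q is a
    dilate or a part of Q, and F its price per volume. *)
Lemma measure_bigcup_grid_le D X (F : RR R d -> \bar R) : D `<=` grid ->
  trivIset D (@cset R d) -> measurable_fun setT F -> (forall x, 0 <= F x)%E ->
  (forall Q, D Q -> measurable (X Q)) ->
  (forall Q, D Q -> mu (X Q) <= \int[mu]_(x in cset Q) F x)%E ->
  (mu (\bigcup_(Q in D) X Q) <= \int[mu]_(x in \bigcup_(Q in D) cset Q) F x)%E.
Proof.
move=> Dg tD mF F0 mX XF.
have mD n : measurable (grid_family D (@cset R d) n).
  by apply: measurable_grid_family => Q _; exact: measurable_cset.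
rewrite -[X in (_ <= \int[mu]_(x in X) _)%E]bigcup_grid_family// ge0_integral_bigcup//; last 2 first.
- by apply: measurable_funS mF.
- exact: trivIset_grid_family.
rewrite -bigcup_grid_family//.
apply: (@le_trans _ _ (\sum_(0 <= n <oo) mu (grid_family D X n))%E).
  apply: measure_sigma_subadditive => //; first exact: measurable_grid_family.
  by apply: bigcupT_measurable; exact: measurable_grid_family.
apply: lee_nneseries => n // _; rewrite /grid_family.
case: grid_at => [Q|]; last by rewrite measure0 integral_set0.
case: asboolP => DQ; first exact: XF.
by rewrite measure0 integral_set0.
Qed.

End countable_families.

(** * A density theorem for the grid *)

Section density.
Context (R : realType) (d : nat).
Implicit Types (Q L P : cube R d) (D : set (cube R d)) (x y : RR R d) (k : int).
Implicit Types (A B U : set (RR R d)).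
Local Notation mu := (lebesgue R d).
Local Notation grid := (@grid R d).

Lemma decreasing_measure_small (F : (set (RR R d))^nat) (e : R) : 0 < e ->
  (mu (F 0%N) < +oo)%E -> (forall n, measurable (F n)) ->
  (forall n m, (n <= m)%N -> F m `<=` F n) -> \bigcap_n F n = set0 ->
  exists N, (mu (F N) < e%:E)%E.
Proof.
move=> e0 F0 mF dF iF; apply: contrapT => /forallNP h.
have /cvg_lim : mu \o F @ \oo --> mu (\bigcap_n F n).
  apply: nonincreasing_cvg_mu => //; first by rewrite iF.
  by move=> n m nm; apply/subsetPset; exact: dF.
rewrite iF measure0 => /(_ (@ereal_hausdorff R)) l0.
have : (e%:E <= limn (mu \o F))%E.
  apply: lime_ge; last by apply: nearW => n; rewrite leNgt; apply/negP; exact: h.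
  apply: ereal_nonincreasing_is_cvgn => n m nm; apply: le_measure; rewrite ?in_setE//.
  exact: dF.
by rewrite l0 lee_fin leNgt e0.
Qed.

(** Unions of grid cubes of generation k. *)
Definition saturated k U := forall x y, gindex k x = gindex k y -> U x -> U y.

Lemma saturated_shadow k U : saturated k U ->
  U = \bigcup_(Q in [set dyad k x | x in U]) cset Q.
Proof.
move=> sU; apply/seteqP; split => [x Ux|y [_ [x Ux <-]] /dyadP e].
  by exists (dyad k x); [exists x|exact: mem_dyad].
exact: (sU x).
Qed.

Lemma dyads_grid k U : [set dyad k x | x in U] `<=` grid.
Proof. by move=> _ [x _ <-]; exists k, x. Qed.

Lemma trivIset_dyads k U : trivIset [set dyad k x | x in U] (@cset R d).
Proof.
by move=> _ _ [x _ <-] [y _ <-] [z [/dyad_eq <- /dyad_eq <-]].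
Qed.

Lemma measurable_saturated k U : saturated k U -> measurable U.
Proof.
move=> /saturated_shadow ->; apply: measurable_bigcup_grid; first exact: dyads_grid.
by move=> Q _; exact: measurable_cset.
Qed.

Definition symdiff A B := (A `\` B) `|` (B `\` A).

Lemma measurable_symdiff A B : measurable A -> measurable B -> measurable (symdiff A B).
Proof. by move=> mA mB; apply: measurableU; exact: measurableD. Qed.

(** Sets that agree inside Q, up to small measure, with a union of grid cubes of
    one small generation. They form a sigma-algebra. *)
Definition approximable K Q A := measurable A /\ forall e : R, 0 < e ->
  exists k U, [/\ (k <= K)%R, saturated k U & (mu (cset Q `&` symdiff A U) < e%:E)%E].

Lemma approximableC K Q A : approximable K Q A -> approximable K Q (~` A).
Proof.
move=> [mA h]; split; first exact: measurableC.
move=> e e0; have [k [U [kK sU hU]]] := h e e0; exists k, (~` U); split => //.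
  by move=> x y xy Ux Uy; apply: Ux; exact: (sU y).
rewrite (_ : symdiff _ _ = symdiff A U)//.
apply/seteqP; split => x; rewrite /symdiff /=; case: (pselect (A x)); case: (pselect (U x)); tauto.
Qed.

Lemma approximableU K Q A B : approximable K Q A -> approximable K Q B ->
  approximable K Q (A `|` B).
Proof.
move=> [mA hA] [mB hB]; split; first exact: measurableU.
move=> e e0; have e20 : 0 < e / 2 by rewrite divr_gt0.
have [k [U [kK sU hU]]] := hA _ e20; have [l [V [lK sV hV]]] := hB _ e20.
exists (Num.min k l), (U `|` V); split.
- by rewrite ge_min kK.
- move=> x y xy [Ux|Vx]; [left; apply: (sU x)|right; apply: (sV x)] => //.
    by apply: gindex_le xy; rewrite ge_min lexx.
  by apply: gindex_le xy; rewrite ge_min lexx orbT.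
have mU := measurable_saturated sU; have mV := measurable_saturated sV.
have mQ := measurable_cset Q.
rewrite [e]splitr EFinD (le_lt_trans _ (lteD hU hV))//.
apply: le_trans (measureU2 _ _ _); last 2 first.
- by apply: measurableI => //; exact: measurable_symdiff.
- by apply: measurableI => //; exact: measurable_symdiff.
apply: le_measure; rewrite ?in_setE.
- by apply: measurableI => //; apply: measurable_symdiff; exact: measurableU.
- by apply: measurableU; apply: measurableI => //; exact: measurable_symdiff.
by move=> x; rewrite /symdiff /=; tauto.
Qed.

Lemma approximable0 K Q : approximable K Q set0.
Proof.
split=> // e e0; exists K, set0; split => //.
rewrite (_ : symdiff _ _ = set0) ?setI0 ?measure0//.
by apply/seteqP; split => x; rewrite /symdiff /=; tauto.
Qed.

(** A finite union exhausts the countable one up to small measure inside Q, and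
    finite unions are approximable. *)
Lemma approximable_bigcup K Q (A : (set (RR R d))^nat) :
  (forall n, approximable K Q (A n)) -> approximable K Q (\bigcup_n A n).
Proof.
move=> hA; have mA : measurable (\bigcup_n A n) by apply: bigcupT_measurable => n; have [] := hA n.
split=> // e e0; have e20 : 0 < e / 2 by rewrite divr_gt0.
have mQ := measurable_cset Q.
pose C n := \big[setU/set0]_(i < n) A i.
have aC n : approximable K Q (C n).
  rewrite /C; elim: n => [|n IH]; first by rewrite big_ord0; exact: approximable0.
  by rewrite big_ord_recr /=; exact: approximableU.
have CE n x : C n x <-> exists2 i, (i < n)%N & A i x.
  by rewrite /C -bigcup_mkord; split => -[i ni Ax]; exists i.
have [N hN] : exists N, (mu (cset Q `&` (\bigcup_n A n `\` C N)) < (e / 2)%:E)%E.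
  apply: (@decreasing_measure_small (fun n => cset Q `&` (\bigcup_n A n `\` C n))) => //.
  - rewrite (@le_lt_trans _ _ (mu (cset Q)))// ?lebesgue_vol ?ltry//.
    rewrite -lebesgue_vol measureIl//; apply: measurableD => //; exact: (aC 0%N).1.
  - by move=> n; apply: measurableI => //; apply: measurableD => //; exact: (aC n).1.
  - move=> n m nm x [Qx [Ax Cx]]; split => //; split => //.
    by move=> /CE[i ni Aix]; apply: Cx; apply/CE; exists i => //; exact: leq_trans nm.
  - apply/seteqP; split => // x h; have [_ [[i _ Ax] _]] := h 0%N I.
    by have [_ [_ []]] := h i.+1 I; apply/CE; exists i.
have [k [U [kK sU hU]]] := (aC N).2 _ e20; exists k, U; split => //.
have mU := measurable_saturated sU; have mC := (aC N).1.
rewrite [e]splitr EFinD (le_lt_trans _ (lteD hN hU))//.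
apply: le_trans (measureU2 _ _ _); last 2 first.
- by apply: measurableI => //; exact: measurableD.
- by apply: measurableI => //; exact: measurable_symdiff.
apply: le_measure; rewrite ?in_setE.
- by apply: measurableI => //; apply: measurable_symdiff.
- by apply: measurableU; apply: measurableI => //; [exact: measurableD|exact: measurable_symdiff].
have CA x : C N x -> (\bigcup_n A n) x by move=> /CE[i _ Ax]; exists i.
move=> x [Qx]; rewrite /symdiff /= => h; have := CA x.
by case: (pselect (C N x)); tauto.
Qed.

(** The cubes of generation k that meet the half-space exceed it only by a strip of
    width at most 2^k. *)
Lemma approximable_ray K Q (i : 'I_d) (a : R) :
  approximable K Q [set x | a <= tnth x i].
Proof.
have mA (b : R) : measurable [set x : RR R d | b <= tnth x i].
  rewrite (_ : mkset _ = (fun x : RR R d => tnth x i) @^-1` `[b, +oo[%classic).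
    rewrite -[_ @^-1` _]setTI; exact: (@measurable_tnth _ (measurableTypeR R)).
  by apply/seteqP; split => x /=; rewrite in_itv /= andbT.
split=> // e e0; have mQ := measurable_cset Q.
pose F (n : nat) := [set x : RR R d | a - 2 ^ (K - n%:Z) <= tnth x i] `\` [set x | a <= tnth x i].
have mF n : measurable (F n) by apply: measurableD.
have [N hN] : exists N, (mu (cset Q `&` F N) < e%:E)%E.
  apply: (@decreasing_measure_small (fun n => cset Q `&` F n)) => //.
  - by rewrite (@le_lt_trans _ _ (mu (cset Q)))// ?lebesgue_vol ?ltry// -lebesgue_vol measureIl.
  - by move=> n; exact: measurableI.
  - move=> n m nm x [Qx [/= h1 h2]]; split => //; split => //=.
    rewrite (le_trans _ h1)// lerD2l lerN2 pow2_le//; lia.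
  - apply/seteqP; split => // x h; have [_ [_ /= /negP]] := h 0%N I.
    rewrite -ltNge => xa; have [k _ hk] := @exists_pow2_gt R (2 ^ K / (a - tnth x i)) 0.
    have [_ [/= h1 _]] := h (absz k) I.
    move: hk; rewrite ltr_pdivrMr ?subr_gt0// => hk.
    have : 2 ^ K < 2 ^ (absz k)%:Z * 2 ^ (K - (absz k)%:Z) :> R.
      rewrite (lt_le_trans hk)// ler_pM ?(ltW (pow2_gt0 _ _)) ?subr_ge0 ?(ltW xa)//.
        by rewrite pow2_le; lia.
      by move: h1; lra.
    by rewrite -expfzDr// addrC subrK ltxx.
pose k := K - N%:Z; pose pa : RR R d := [tuple a | j < d].
exists k, [set x | (gindex k pa i <= gindex k x i)%R]; split.
- by rewrite /k; lia.
- by move=> x y /= ->.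
apply: le_lt_trans hN; apply: le_measure; rewrite ?in_setE.
- apply: measurableI => //; apply: measurable_symdiff => //.
  by apply: (@measurable_saturated k) => x y /= ->.
- exact: measurableI.
have pak : 2 ^ k * ((gindex k pa i)%:~R + gshift R k) <= a.
  by have /andP[] := mem_dyad k pa i; rewrite tnth_dcube tnth_mktuple.
move=> x [Qx]; rewrite /symdiff /= => -[[ax /negP]|[h /negP ax]].
  by rewrite -ltNge => /gindex_lt h; have := lt_le_trans h (le_trans pak ax); rewrite ltxx.
split => //; split => //=; last exact/negP.
move: h; have := mem_dyad k pa i; have := mem_dyad k x i.
rewrite !tnth_dcube tnth_mktuple /= -(ler_int R) -/k => /andP[h1 _] /andP[_ h2] h.
have : 2 ^ k * (gindex k pa i)%:~R <= 2 ^ k * (gindex k x i)%:~R :> R by rewrite ler_pM2l ?pow2_gt0.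
by move: h1 h2; lra.
Qed.

End density.

Section density_point.
Context (R : realType) (d : nat).
Implicit Types (Q L P : cube R d) (D : set (cube R d)) (x y : RR R d) (k : int).
Implicit Types (A B U : set (RR R d)).
Local Notation mu := (lebesgue R d).
Local Notation grid := (@grid R d).

(** Half-spaces are approximable, and they generate the measurable sets. *)
Lemma measurable_approximable K Q A : measurable A -> approximable K Q A.
Proof.
have SA : sigma_algebra setT (approximable K Q).
  split; first exact: approximable0.
    by move=> B aB; rewrite setTD; exact: approximableC.
  by move=> B aB; exact: approximable_bigcup.
move=> mA; suff : (@measurable _ (RR R d) `<=` approximable K Q) by apply.
apply: smallest_sub => //.
apply: (@big_ind _ (fun G : set (set (RR R d)) => G `<=` approximable K Q)) => //.
  by move=> G H hG hH B [/hG|/hH].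
move=> i _ B [C mC <-]; rewrite setTI.
pose H := [set C : set R | approximable K Q ((fun x : RR R d => tnth x i) @^-1` C)].
suff : (@measurable _ (measurableTypeR R)) `<=` H by apply.
have -> : @measurable _ (measurableTypeR R) = (@RGenCInfty.G R).-sigma.-measurable.
  exact: RGenCInfty.measurableE.
apply: smallest_sub.
  split; rewrite /H /=; first by rewrite preimage_set0; exact: approximable0.
    by move=> E aE; rewrite setTD preimage_setC; exact: approximableC.
  by move=> E aE; rewrite preimage_bigcup; exact: approximable_bigcup.
move=> E [a ->]; rewrite /H /=.
rewrite (_ : _ @^-1` _ = [set x : RR R d | a <= tnth x i]); first exact: approximable_ray.
by apply/seteqP; split => x /=; rewrite in_itv /= andbT.
Qed.

(** If the density of A were at most t in every grid cube, it would be at most t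
    in any disjoint union V of them. A union V that is e-close to A then gives
    mu A - e <= t * (mu A + e), which fails for small e. *)
Lemma density A K x0 (t : R) : measurable A -> A `<=` cset (dyad K x0) ->
  (0 < mu A)%E -> 0 <= t < 1 ->
  exists k x, (t%:E * mu (cset (dyad k x)) < mu (cset (dyad k x) `&` A))%E.
Proof.
move=> mA AQ A0 /andP[t0 t1]; apply: contrapT => h.
have {}h k x : (mu (cset (dyad k x) `&` A) <= t%:E * mu (cset (dyad k x)))%E.
  by rewrite leNgt; apply/negP => h1; apply: h; exists k, x.
set Q := dyad K x0 in AQ *; have mQ := measurable_cset Q.
have muA : (mu A < +oo)%E.
  rewrite (@le_lt_trans _ _ (mu (cset Q)))// ?lebesgue_vol ?ltry// -lebesgue_vol.
  by apply: le_measure; rewrite ?in_setE.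
have aE : mu A = (fine (mu A))%:E by rewrite fineK// ge0_fin_numE.
set a := fine (mu A) in aE.
have a0 : 0 < a by rewrite -lte_fin -aE.
(* With a the measure of A, this e makes t * (a + e) + e smaller than a. *)
pose e := (1 - t) * a / 2.
have e0 : 0 < e by rewrite divr_gt0// mulr_gt0// subr_gt0.
have [k [U [kK sU hU]]] := (measurable_approximable K Q mA).2 e e0.
have mU := measurable_saturated sU.
pose V := U `&` cset Q.
have sV : saturated k V.
  move=> x y xy [Ux Qx]; split; first exact: (sU x).
  by apply/dyadP; move/dyadP : Qx => <-; apply/esym; exact: gindex_le xy.
have mV := measurable_saturated sV.
have mD : measurable (cset Q `&` symdiff A U).
  by apply: measurableI => //; exact: measurable_symdiff.
have VA : (mu (V `&` A) <= t%:E * mu V)%E.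
  have := @measure_bigcup_grid_le R d [set dyad k x | x in V] (fun P => cset P `&` A) (cst t%:E)
    (@dyads_grid _ _ _ _) (@trivIset_dyads _ _ _ _).
  rewrite -setI_bigcupl -saturated_shadow// integral_cst//; apply => //.
  - by move=> P _; apply: measurableI => //; exact: measurable_cset.
  - by move=> _ [x _ <-]; rewrite integral_cst ?h//; exact: measurable_cset.
have Ve : (mu V <= (a + e)%:E)%E.
  rewrite EFinD -aE (le_trans _ (leeD (lexx _) (ltW hU)))// (le_trans _ (measureU2 _ _ _))//.
  apply: le_measure; rewrite ?in_setE//; first exact: measurableU.
  move=> x [Ux Qx]; case: (pselect (A x)); rewrite /symdiff /=; tauto.
have Ae : (a%:E <= mu (V `&` A) + e%:E)%E.
  rewrite -aE (le_trans _ (leeD (lexx _) (ltW hU)))// (le_trans _ (measureU2 _ _ _))//.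
    apply: le_measure; rewrite ?in_setE//; first by apply: measurableU => //; exact: measurableI.
    by move=> x Ax; have := AQ x Ax; case: (pselect (U x)); rewrite /V /symdiff /=; tauto.
  exact: measurableI.
have : (a%:E <= (t * (a + e) + e)%:E)%E.
  rewrite (le_trans Ae)// EFinD leeD// (le_trans VA)// EFinM lee_wpmul2l//.
rewrite lee_fin => h1; have : (1 - t) * ((1 - t) * a) <= 0 by move: h1; rewrite /e; lra.
by rewrite leNgt !mulr_gt0 ?subr_gt0.
Qed.

End density_point.

(** * The weak-type inequality for grid cubes *)

Section bad_cubes.
Context (R : realType) (d : nat).
Implicit Types (Q L P : cube R d) (D : set (cube R d)) (x y z : RR R d) (k : int).
Local Notation mu := (lebesgue R d).
Local Notation grid := (@grid R d).

Definition bad (F : RR R d -> \bar R) (t : R) : set (cube R d) :=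
  [set P | grid P /\ ((t * vol P)%:E < \int[mu]_(x in cset P) F x)%E].

(** An open fivefold dilate. Open, so that the exceptional sets have Whitney
    cubes; fivefold, so that it contains every cube, not necessarily of the grid,
    that meets P or a neighbour of P and is not larger than P. *)
Definition halo P : set (RR R d) := [set x | forall i,
  tnth (corner P) i - 2 * side P < tnth x i < tnth (corner P) i + 3 * side P].

Definition bad_set F t : set (RR R d) := \bigcup_(P in bad F t) halo P.

Lemma bad_grid F t : bad F t `<=` grid.
Proof. by move=> P []. Qed.

Lemma measurable_bad_set F t : measurable (bad_set F t).
Proof.
apply: measurable_bigcup_grid; first exact: bad_grid.
by move=> Q _; exact: measurable_open_box.
Qed.

Lemma cset_halo P : cset P `<=` halo P.
Proof.
by move=> x Px i; have := Px i; have := side_gt0 P => s0 /andP[h1 h2]; apply/andP; split; lra.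
Qed.

Lemma halo_dilate P : halo P `<=` dilate 5 P.
Proof. by move=> x Px; apply/dilateP => i; have /andP[h1 h2] := Px i; split; lra. Qed.

Lemma dyad_nested k l x i : (k <= l)%R ->
  tnth (corner (dyad l x)) i <= tnth (corner (dyad k x)) i /\
  tnth (corner (dyad k x)) i + 2 ^ k <= tnth (corner (dyad l x)) i + 2 ^ l.
Proof.
move=> kl; split.
  have cs : cset (dyad l x) (corner (dyad k x)) by apply: (dyadS kl); exact: corner_cset.
  by have /andP[] := cs i.
have [j ->] : exists j : nat, l = k + j%:Z by exists (absz (l - k)); lia.
have [_ [n hn]] := @dyadic_descendant_dyad R d k j x.
rewrite hn /= -addrA lerD2l -[X in _ + X]mul1r -mulrDl.
rewrite (_ : 2 ^ (k + j%:Z) = 2 ^+ j * 2 ^ k :> R); last by rewrite expfzDr// mulrC.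
by rewrite ler_pM2r ?pow2_gt0// natr1 -natrX ler_nat ltn_ord.
Qed.

Lemma halo_mono k l x : (k <= l)%R -> halo (dyad k x) `<=` halo (dyad l x).
Proof.
move=> kl y h i; have /andP[] := h i; have s2 := pow2_le R kl.
have [] := dyad_nested x i kl => /= h1 h2 h3 h4; apply/andP; split; lra.
Qed.

Lemma halo_open P x : halo P x -> exists k, dilate 9 (dyad k x) `<=` halo P.
Proof.
move=> Px.
have h i : exists n : nat, forall m : nat, (n <= m)%N ->
   tnth (corner P) i - 2 * side P < tnth x i - 5 * 2 ^ (- m%:Z) /\
   tnth x i + 5 * 2 ^ (- m%:Z) < tnth (corner P) i + 3 * side P.
  have /andP[h1 h2] := Px i.
  pose g := Num.min (tnth x i - (tnth (corner P) i - 2 * side P)) (tnth (corner P) i + 3 * side P - tnth x i).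
  have g0 : 0 < g by rewrite /g lt_min !subr_gt0 h1.
  have [k k0 hk] := @exists_pow2_gt R (5 / g) 0.
  exists (absz k) => m nm.
  have : 5 * 2 ^ (- m%:Z) < g.
    rewrite (@le_lt_trans _ _ (5 * 2 ^ (- k)))//.
      by rewrite ler_pM2l// pow2_le//; lia.
    rewrite -mulrC -invr_expz -ltr_pdivlMl ?invr_gt0 ?pow2_gt0// invrK.
    by move: hk; rewrite ltr_pdivrMr.
  by rewrite /g lt_min => /andP[h3 h4]; split; lra.
have {h}[n hn] := choice h.
pose N := (\sum_i n i)%N; exists (- N%:Z) => y /dilateP hy i.
have nN : (n i <= N)%N by rewrite /N (bigD1 i)//= leq_addr.
have [h1 h2] := hn i N nN.
have [h3 h4] := hy i; have /andP[] := mem_dyad (- N%:Z) x i.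
by move: h3 h4 => /= h3 h4 h5 h6; apply/andP; split; lra.
Qed.

Lemma vol_dyad k x : vol (dyad k x) = (2 ^ k) ^+ d :> R.
Proof. by rewrite volE. Qed.

(** The average of an integrable function over a large cube is small. *)
Lemma bad_bounded F t : (0 < d)%N -> 0 < t -> (forall x, 0 <= F x)%E ->
  measurable_fun setT F -> (\int[mu]_x F x < +oo)%E ->
  exists N, forall k x, bad F t (dyad k x) -> (k <= N)%R.
Proof.
move=> d0 t0 F0 mF Foo.
have iE : (\int[mu]_x F x = (fine (\int[mu]_x F x))%:E)%E.
  by rewrite fineK// ge0_fin_numE// integral_ge0.
set I := fine _ in iE.
have [N N0 hN] := @exists_pow2_gt R (I / t) 0.
exists N => k x [_]; rewrite leNgt => h; apply/negP => Nk.
have : (\int[mu]_(x in cset (dyad k x)) F x <= I%:E)%E.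
  by rewrite -iE; apply: ge0_subset_integral => //; exact: measurable_cset.
rewrite leNgt (le_lt_trans _ h)// lee_fin vol_dyad.
rewrite mulrC -ler_pdivrMr// (le_trans (ltW hN))//.
have kN := pow2_le R (ltW Nk).
rewrite (le_trans kN)// -[leLHS]expr1 ler_weXn2l//.
by rewrite -(expr0z (2 : R)) pow2_le; lia.
Qed.

Lemma bad_maximal F t N k x : (forall l, bad F t (dyad l x) -> (l <= N)%R) ->
  bad F t (dyad k x) -> exists l, [/\ (k <= l)%R, bad F t (dyad l x) &
    forall j, (l < j)%R -> ~ bad F t (dyad j x)].
Proof.
move=> hN bk.
pose p n := `[< bad F t (dyad (k + n%:Z) x) >].
have ex : exists n, p n by exists 0%N; apply/asboolP; rewrite addr0.
have ub n : p n -> (n <= absz (N - k))%N by move=> /asboolP/hN; lia.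
case: (ex_maxnP ex ub) => n /asboolP bn mx; exists (k + n%:Z); split=> [|//|j nj bj].
  by lia.
have /mx : p (absz (j - k)).
  by apply/asboolP; rewrite (_ : k + _ = j)//; lia.
by lia.
Qed.

(** The maximal bad cubes are disjoint, their fivefold dilates contain the bad
    set, and the integral of F over each of them exceeds t times its volume. *)
Lemma weak_type F t : (0 < d)%N -> 0 < t -> (forall x, 0 <= F x)%E ->
  measurable_fun setT F -> (\int[mu]_x F x < +oo)%E ->
  (mu (bad_set F t) <= (5 ^+ d / t)%:E * \int[mu]_x F x)%E.
Proof.
move=> d0 t0 F0 mF Foo; have [N hN] := bad_bounded d0 t0 F0 mF Foo.
pose D := [set P | exists k x, [/\ P = dyad k x, bad F t P &
  forall j, (k < j)%R -> ~ bad F t (dyad j x)]].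
have Dg : D `<=` grid by move=> _ [k [x [-> _ _]]]; exists k, x.
have tD : trivIset D (@cset R d).
  move=> P P' [k [x [eP bP mP]]] [k' [x' [eP' bP' mP']]] [z []].
  rewrite eP eP' => zP zP'; have := dyad_eq zP; have := dyad_eq zP' => e' e.
  have [kk'|kk'|kk'] := ltrgtP k k'; last by move: e; rewrite kk' e' => <-.
    exfalso; apply: (mP k') => //; rewrite (_ : dyad k' x = dyad k' x') -?eP'//.
    have := dyadS (ltW kk') zP => /dyad_eq <-; rewrite eP'; exact: e'.
  exfalso; apply: (mP' k) => //; rewrite (_ : dyad k x' = dyad k x) -?eP//.
  have := dyadS (ltW kk') zP' => /dyad_eq <-; rewrite eP; exact: e.
have cover : bad_set F t `<=` \bigcup_(P in D) dilate 5 P.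
  move=> y [P [gP bP] Py]; have [k [x eP]] := gP.
  have [l [kl bl ml]] := @bad_maximal F t N k x (fun l => hN l x) (ltac:(rewrite -eP; split => //)).
  exists (dyad l x); first by exists l, x.
  apply: halo_dilate; apply: (halo_mono kl); by rewrite -eP.
rewrite (@le_trans _ _ (mu (\bigcup_(P in D) dilate 5 P)))//.
  apply: le_measure; rewrite ?in_setE//; first exact: measurable_bad_set.
  by apply: measurable_bigcup_grid => // Q _; exact: measurable_dilate.
have c0 : 0 < 5 ^+ d / t by rewrite divr_gt0// exprn_gt0.
have := @measure_bigcup_grid_le R d D (fun P => dilate 5 P) (fun x => (5 ^+ d / t)%:E * F x)%E Dg tD.
move=> /(_ _ _ _ _)/le_trans; apply.
- by apply: emeasurable_funM.
- by move=> x; rewrite mule_ge0// lee_fin ltW.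
- by move=> P _; exact: measurable_dilate.
- move=> P [k [x [eP [_ bP] _]]]; rewrite lebesgue_dilate// ge0_integralZl//; last 3 first.
  + exact: measurable_cset.
  + by apply: measurable_funS mF.
  + by rewrite lee_fin ltW.
  rewrite (_ : 5 ^+ d * vol P = 5 ^+ d / t * (t * vol P)); last by field; rewrite gt_eqF.
  by rewrite EFinM lee_wpmul2l ?lee_fin ?(ltW c0)// ltW.
rewrite ge0_integralZl//; last 3 first.
- by apply: measurable_bigcup_grid => // Q _; exact: measurable_cset.
- by apply: measurable_funS mF.
- by rewrite lee_fin ltW.
rewrite lee_wpmul2l ?lee_fin ?(ltW c0)//; apply: ge0_subset_integral => //.
by apply: measurable_bigcup_grid => // Q _; exact: measurable_cset.
Qed.

Lemma dyadic_size Q : exists k, side Q <= 2 ^ k /\ 2 ^ k < 2 * side Q.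
Proof.
have s0 := side_gt0 Q.
have [M M0 hM] := @exists_pow2_gt R (side Q)^-1 0.
have [N N0 hN] := @exists_pow2_gt R (side Q) 0.
pose p (n : nat) := side Q <= 2 ^ (n%:Z - M).
have ex : exists n, p n.
  by exists (absz (N + M)); rewrite /p (_ : _ - _ = N); [exact: ltW|lia].
case: (ex_minnP ex) => [[|n]] hn mn.
  exfalso; move: hn; rewrite /p sub0r -invr_expz leNgt => /negP; apply.
  by rewrite invf_plt ?posrE ?pow2_gt0.
exists (n.+1%:Z - M); split => //.
have : ~~ p n by apply/negP => /mn; rewrite ltnn.
rewrite /p -ltNge (_ : n.+1%:Z - M = n%:Z - M + 1); last by lia.
by rewrite pow2S; lra.
Qed.

(** Q is covered by 2^d neighbouring grid cubes, of side between that of Q and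
    twice it. In one of them the average of F exceeds s / 4^d, and its halo contains
    all of Q. This is how grid cubes control the maximal function over all cubes. *)
Lemma large_average_bad F s Q z : (forall x, 0 <= F x)%E -> measurable_fun setT F ->
  0 <= s -> cset Q z -> ((s * vol Q)%:E < \int[mu]_(x in cset Q) F x)%E ->
  bad_set F (s / 4 ^+ d) z.
Proof.
move=> F0 mF s0 Qz; have [k [sk ks]] := dyadic_size Q.
(* The covering cubes are those containing the corner of Q and their upper
   neighbours; e selects the directions in which to move up. *)
pose J := {ffun 'I_d -> bool}.
pose P (e : J) := dcube R k [ffun i => gindex k (corner Q) i + (e i)%:R].
have QP : cset Q `<=` \big[setU/set0]_(e : J) cset (P e).
  move=> x Qx; rewrite -bigcup_seq.
  exists [ffun i => (gindex k (corner Q) i < gindex k x i)%R]; first exact: mem_index_enum.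
  apply/gindexP/ffunP => i; rewrite !ffunE.
  have h1 : (gindex k (corner Q) i <= gindex k x i)%R.
    rewrite leNgt; apply/negP => /gindex_lt; apply/negP; rewrite -leNgt.
    have /andP[h _] := mem_dyad k (corner Q) i; rewrite tnth_dcube in h.
    by rewrite (le_trans h)//; have /andP[] := Qx i.
  have h2 : (gindex k x i < gindex k (corner Q) i + 2)%R.
    have /andP[h3 _] := mem_dyad k x i; have /andP[_ h4] := mem_dyad k (corner Q) i.
    have /andP[_ h5] := Qx i; rewrite !tnth_dcube /= in h3 h4.
    rewrite -(ltr_int R) rmorphD /= -(ltr_pM2l (pow2_gt0 R k)).
    by move: sk h3 h4 h5; lra.
  move: h1 h2; rewrite /gindex !ffunE; move: (Num.floor _) (Num.floor _) => a b h1 h2.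
  by case: ltP => h3; rewrite ?mulr1n ?mulr0n; lia.
rewrite ltNge => /negP h; apply: contrapT => nE; apply: h.
have zP e : halo (P e) z.
  move=> i; have /andP[h1 h2] := mem_dyad k (corner Q) i; have /andP[h3 h4] := Qz i.
  rewrite tnth_dcube in h1; rewrite tnth_dcube /= in h2.
  rewrite tnth_dcube ffunE rmorphD /=.
  by case: (e i) => /=; move: sk h1 h2 h3 h4 (pow2_gt0 R k); lra.
have nb e : (\int[mu]_(x in cset (P e)) F x <= (s / 4 ^+ d * vol (P e))%:E)%E.
  rewrite leNgt; apply/negP => b; apply: nE; exists (P e); last exact: zP.
  by split => //; exact: grid_dcube.
have mP e : measurable (cset (P e)) by exact: measurable_cset.
have tP : trivIset [set` index_enum J] (fun e => cset (P e)).
  move=> e e' _ _ [y [/gindexP h1 /gindexP]]; rewrite h1 => /ffunP h2.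
  apply/ffunP => i; have := h2 i; rewrite !ffunE => /addrI.
  by case: (e i); case: (e' i).
apply: (@le_trans _ _ (\int[mu]_(x in \big[setU/set0]_(e : J) cset (P e)) F x)%E).
  apply: ge0_subset_integral => //; first exact: measurable_cset.
    exact: bigsetU_measurable.
  exact: measurable_funS mF.
rewrite ge0_integral_bigsetU//; last 2 first.
- exact: index_enum_uniq.
- exact: measurable_funS mF.
apply: (@le_trans _ _ (\sum_(e : J) (s / 4 ^+ d * (2 ^ k) ^+ d)%:E)%E).
  by apply: lee_sum => e _; rewrite (le_trans (nb e))// volE.
have cJ : #|{: J}| = (2 ^ d)%N by rewrite card_ffun card_bool card_ord.
rewrite sumEFin lee_fin volE.
have -> : \sum_(e : J) (s / 4 ^+ d * (2 ^ k) ^+ d) = 2 ^+ d * (s / 4 ^+ d * (2 ^ k) ^+ d).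
  move: (s / 4 ^+ d * (2 ^ k) ^+ d) => c; by rewrite sumr_const cJ -[in LHS]mulr_natl natrX.
rewrite (_ : 2 ^+ d * _ = s * ((2 ^ k) / 2) ^+ d).
  rewrite ler_wpM2l// lerXn2r ?nnegrE ?divr_ge0 ?(ltW (pow2_gt0 _ _)) ?(ltW (side_gt0 _))//.
  by rewrite ler_pdivrMr//; move: ks; lra.
rewrite -[4 : R]/((2 * 2)%:R) natrM exprMn expr_div_n; field.
by rewrite expf_neq0.
Qed.

Lemma space_exhausted x : exists n : nat, cset (dyad n%:Z [tuple 0 : R | i < d]) x.
Proof.
pose M : R := \sum_i `|tnth x i|.
have [l l0 hl] := @exists_pow2_gt R (3 * M) 0.
exists (absz l); rewrite gez0_abs//; apply/dyadP; apply: (gindex_center hl) => i.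
  by rewrite /M (bigD1 i)//= lerDl sumr_ge0.
by rewrite tnth_mktuple normr0 sumr_ge0.
Qed.

(** This replaces Lebesgue's differentiation theorem. If G exceeded t on a set of
    positive measure off the bad set, a grid cube in which that set has density close
    to 1 would be bad, hence contained in the bad set. *)
Lemma ae_le_off_bad_set (G : RR R d -> R) t : (forall x, 0 <= G x) ->
  measurable_fun setT G -> 0 <= t ->
  {ae mu, forall x, ~ bad_set (EFin \o G) t x -> G x <= t}.
Proof.
move=> G0 mG t0; set E := bad_set _ _.
pose A (n : nat) := cset (dyad n%:Z [tuple 0 : R | i < d]) `&` (~` E `&` [set x | t + n.+1%:R^-1 <= G x]).
have mA n : measurable (A n).
  apply: measurableI; first exact: measurable_cset.
  apply: measurableI; first by apply: measurableC; exact: measurable_bad_set.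
  rewrite (_ : mkset _ = G @^-1` `[t + n.+1%:R^-1, +oo[%classic).
    by rewrite -[_ @^-1` _]setTI; exact: mG.
  by apply/seteqP; split => x /=; rewrite in_itv /= andbT.
have A0 n : mu (A n) = 0%E.
  apply: contrapT => /eqP; rewrite neq_lt ltNge measure_ge0 /= => An0.
  have d0 : 0 < n.+1%:R^-1 :> R by rewrite invr_gt0.
  have td0 : 0 < t + n.+1%:R^-1 by rewrite ltr_wpDl.
  have [||k [x hx]] := @density R d (A n) n%:Z [tuple 0 : R | i < d] (t / (t + n.+1%:R^-1)) (mA n) _ An0.
    by move=> x [].
    by rewrite divr_ge0 ?(ltW td0)//= ltr_pdivrMr// mul1r ltrDl.
  have mPA : measurable (cset (dyad k x) `&` A n) by apply: measurableI => //; exact: measurable_cset.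
  have bP : bad (EFin \o G) t (dyad k x).
    split; first by exists k, x.
    apply: (@lt_le_trans _ _ ((t + n.+1%:R^-1)%:E * mu (cset (dyad k x) `&` A n))%E).
      move: hx; rewrite lebesgue_vol -EFinM => hx.
      have : mu (cset (dyad k x) `&` A n) \is a fin_num.
        rewrite ge0_fin_numE//; apply: (@le_lt_trans _ _ (mu (cset (dyad k x)))).
          by rewrite measureIl//; exact: measurable_cset.
        by rewrite lebesgue_vol ltry.
      move=> /fineK; move: hx; set m := mu _; move=> hx em; move: hx; rewrite -em -EFinM !lte_fin.
      by rewrite mulrAC ltr_pdivrMr// [X in _ < X -> _]mulrC.
    rewrite -integral_cst//; apply: (@le_trans _ _ (\int[mu]_(x in cset (dyad k x) `&` A n) (EFin \o G) x)%E).
      apply: ge0_le_integral => //.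
      - by move=> y _; rewrite lee_fin ltW.
      - by apply/measurable_EFinP; exact: measurable_funTS.
      - by move=> y [_ [_ [_ /=]]]; rewrite lee_fin.
    apply: ge0_subset_integral => //; first exact: measurable_cset.
    - by apply/measurable_EFinP; exact: measurable_funTS.
    - by move=> y _; rewrite lee_fin.
  have : (0 < mu (cset (dyad k x) `&` A n))%E.
    by apply: le_lt_trans hx; rewrite mule_ge0// lee_fin divr_ge0// ltW.
  rewrite (_ : _ `&` _ = set0) ?measure0 ?ltxx//.
  apply/seteqP; split => // y [yP [_ [nE _]]]; apply: nE.
  by exists (dyad k x) => //; exact: cset_halo.
have nA : mu.-negligible (\bigcup_n A n).
  by apply: negligible_bigcup => n; apply/negligibleP; [exact: mA|exact: A0].
apply: negligibleS nA => x /= /not_implyP[nE /negP]; rewrite -ltNge => tG.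
have [n hn] := space_exhausted x.
have g0 : 0 <= (G x - t)^-1 by rewrite invr_ge0 subr_ge0 ltW.
pose m := Num.bound (G x - t)^-1.
exists (n + m)%N => //; split; last split => //=.
  by apply/dyadP; move/dyadP : hn; apply: gindex_le; lia.
have hm := archi_boundP g0; rewrite -lerBrDl -[leRHS]invrK lef_pV2 ?posrE ?invr_gt0 ?subr_gt0//.
by rewrite (le_trans (ltW hm))// ler_nat -addnS (leq_trans _ (leq_addl _ _)).
Qed.

End bad_cubes.

(** * Whitney cubes as a stopping collection *)

Section whitney.
Context (R : realType) (d : nat).
Implicit Types (Q L P : cube R d) (x y z : RR R d) (k : int) (E : set (RR R d)).
Local Notation mu := (lebesgue R d).
Local Notation grid := (@grid R d).

(** The consequence of openness that produces Whitney cubes, stated for ninefold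
    dilates because the last condition on stopping collections asks for them. *)
Definition dyadically_open E := forall x, E x -> exists k, dilate 9 (dyad k x) `<=` E.

Lemma dyadically_open_bad_set F t : dyadically_open (@bad_set R d F t).
Proof.
move=> x [P bP Px]; have [k hk] := halo_open Px; exists k => y /hk Py.
by exists P.
Qed.

Lemma dyadically_openU E E' : dyadically_open E -> dyadically_open E' ->
  dyadically_open (E `|` E').
Proof.
move=> oE oE' x [Ex|Ex].
  by have [k h] := oE x Ex; exists k => y /h; left.
by have [k h] := oE' x Ex; exists k => y /h; right.
Qed.

(** The maximal grid cubes L with 9L contained in E, among those that meet 3Q. *)
Definition whitney Q E : set (cube R d) := [set L | exists k x,
  [/\ L = dyad k x, dilate 3 Q x, dilate 9 (dyad k x) `<=` E &
      ~ (dilate 9 (dyad (k + 1) x) `<=` E)]].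

Lemma dilate_dyad_mono k l x : (k <= l)%R -> dilate 9 (dyad k x) `<=` dilate 9 (dyad l x).
Proof.
move=> kl y /dilateP h; apply/dilateP => i; have [] := h i; have s2 := pow2_le R kl.
by have [] := dyad_nested x i kl => /= h1 h2 h3 h4; split; lra.
Qed.

Lemma whitney_grid Q E : whitney Q E `<=` grid.
Proof. by move=> _ [k [x [-> _ _ _]]]; exists k, x. Qed.

Lemma whitney_trivIset Q E : trivIset (whitney Q E) (@cset R d).
Proof.
move=> P P' [k [x [-> _ hk nk]]] [k' [x' [-> _ hk' nk']]] [z [zP zP']].
have e := dyad_eq zP; have e' := dyad_eq zP'.
have up j y l : cset (dyad j y) z -> (j <= l)%R -> dyad l y = dyad l z.
  by move=> zy jl; apply/esym/dyad_eq; exact: dyadS zy.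
have [kk'|kk'|kk'] := ltrgtP k k'; last by move: e; rewrite kk' e' => <-.
  exfalso; apply: nk => y; rewrite (up k x (k + 1))//; last by lia.
  move=> h; apply: hk'; rewrite -e'; apply: dilate_dyad_mono h; lia.
exfalso; apply: nk' => y; rewrite (up k' x' (k' + 1))//; last by lia.
move=> h; apply: hk; rewrite -e; apply: dilate_dyad_mono h; lia.
Qed.

Lemma whitney_sub Q E : shadow (whitney Q E) `<=` E.
Proof.
move=> y [_ [k [x [-> _ hk _]]] Ly]; apply: hk.
by rewrite -(dilate1 (dyad k x)) in Ly; apply: dilateS Ly; rewrite ?ler1n.
Qed.

Lemma measurable_shadow (D : set (cube R d)) : D `<=` grid -> measurable (shadow D).
Proof.
by move=> Dg; apply: measurable_bigcup_grid => // L _; exact: measurable_cset.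
Qed.

(** The ninefold dilate of the parent of L leaves E and is contained in 32L. *)
Lemma whitney_exit Q E L : whitney Q E L -> exists2 z, dilate (2 ^+ 5) L z & ~ E z.
Proof.
move=> [k [x [-> _ _ /existsNP[z /not_implyP[hz nz]]]]]; exists z => //.
apply/dilateP => i; move/dilateP : hz => /(_ i); have p0 := pow2_gt0 R k.
have kk : (k <= k + 1)%R by rewrite lerDl.
have [] := dyad_nested x i kk; rewrite /= pow2S => h1 h2 [h3 h4]; split; lra.
Qed.

Context (d0 : (0 < d)%N) (K : int) (x0 : RR R d) (E : set (RR R d)).
Let Q := dyad K x0.
Context (oE : dyadically_open E) (mE : measurable E)
  (sE : (mu E <= (2^-1 ^+ d * vol Q)%:E)%E).

(** 9L has measure at most that of E, so that 18 times the side of L is at most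
    the side of Q. *)
Lemma whitney_size k x : dilate 9 (dyad k x) `<=` E -> (k + 5 <= K)%R.
Proof.
move=> hE; have : (mu (dilate 9 (dyad k x)) <= (2^-1 ^+ d * vol Q)%:E)%E.
  by apply: le_trans sE; apply: le_measure; rewrite ?in_setE//; exact: measurable_dilate.
rewrite lebesgue_dilate// lee_fin !volE /= -!exprMn ler_pXn2r// ?nnegrE; last 2 first.
- by rewrite mulr_ge0// ltW ?pow2_gt0.
- by rewrite mulr_ge0// ltW ?pow2_gt0.
move=> h; rewrite leNgt; apply/negP => kK.
have : 2 ^ K <= 2 ^ (k + 4%:Z) :> R by rewrite pow2_le; lia.
rewrite expfzDr// pow2_nat => h2; have := pow2_gt0 R k; move: h h2; rewrite !exprS expr0; lra.
Qed.

Lemma whitney_scale L : whitney Q E L -> (scale L + 5 <= K)%R.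
Proof. by move=> [k [x [-> _ /whitney_size h _]]]; rewrite scale_dyad. Qed.

Lemma whitney_triple L : whitney Q E L -> cset L `<=` dilate 3 Q.
Proof.
move=> [k [x [-> Qx /whitney_size h _]]]; apply: dyad_sub_triple Qx; lia.
Qed.

(** The cubes around x whose ninefold dilate is in E have bounded size, hence a
    largest one. *)
Lemma whitney_cover x : E x -> dilate 3 Q x -> shadow (whitney Q E) x.
Proof.
move=> Ex Qx; have [k0 h0] := oE Ex.
pose p n := `[< dilate 9 (dyad (k0 + n%:Z) x) `<=` E >].
have ex : exists n, p n by exists 0%N; apply/asboolP; rewrite addr0.
have ub n : p n -> (n <= absz (K - k0))%N by move=> /asboolP/whitney_size; lia.
case: (ex_maxnP ex ub) => n /asboolP bn mx; exists (dyad (k0 + n%:Z) x); last exact: mem_dyad.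
exists (k0 + n%:Z), x; split => // h.
have /mx : p n.+1 by apply/asboolP; rewrite (_ : k0 + _ = k0 + n%:Z + 1)//; lia.
by rewrite ltnn.
Qed.

(** If L is at least 2^8 times as large as L' and 7L meets 7L', then the ninefold
    dilate of the parent of L' is inside 9L, hence inside E, and L' is not maximal. *)
Lemma whitney_far L L' : whitney Q E L -> whitney Q E L' -> (scale L' + 8 <= scale L)%R ->
  dilate 7 L `&` dilate 7 L' = set0.
Proof.
move=> [k [x [-> _ hk _]]] [l [x' [-> _ _ /existsNP[z /not_implyP[hz nz]]]]].
rewrite !scale_dyad => lk; apply/seteqP; split => // y [/dilateP h1 /dilateP h2].
apply: nz; apply: hk; apply/dilateP => i.
move/dilateP : hz => /(_ i); have := h1 i; have := h2 i.
have ll : (l <= l + 1)%R by rewrite lerDl.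
have [] := dyad_nested x' i ll; rewrite /= pow2S; have p0 := pow2_gt0 R l.
have : 2 ^ (l + 8%:Z) <= 2 ^ k :> R by rewrite pow2_le.
rewrite expfzDr// pow2_nat !exprS expr0 => a1 a2 a3 [a4 a5] [a6 a7] [a8 a9].
by split; lra.
Qed.

(** For the last condition: a Whitney cube L has at most 1/32 of the side of Q, so
    that 9L is in 3Q as soon as 3L meets 2Q, and all points of E in 3Q are covered. *)
Lemma stopping_whitney : stopping_collection grid Q (whitney Q E).
Proof.
split.
- by split; [exact: whitney_grid|exact: whitney_trivIset].
- by move=> L; exact: whitney_triple.
- move=> L L' WL WL' h; have [h1|h1] : (scale L' + 8 <= scale L)%R \/ (scale L + 8 <= scale L')%R.
    by lia.
  - exact: whitney_far.
  - by rewrite setIC; exact: whitney_far.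
move=> y [L [WL [z [zL zQ]]] yL].
have [k [x [eL Qx hk nk]]] := WL; apply: whitney_cover.
  by apply: hk; rewrite -eL.
have kK := whitney_size hk.
have : 2 ^ (k + 5%:Z) <= 2 ^ K :> R by rewrite pow2_le.
rewrite expfzDr// pow2_nat !exprS expr0 => kK2; have p0 := pow2_gt0 R k.
move: zL yL zQ; rewrite eL => /dilateP zL /dilateP yL /dilateP zQ.
apply/dilateP => i; have [] := zL i; have [] := yL i; have [] := zQ i; rewrite /= => *.
by split; lra.
Qed.

End whitney.

(** * Averages and Lebesgue norms *)

Section real_powers.
Context (R : realType).
Implicit Types (a b p t : R).

Lemma powR_inv_le p a t : 0 < p -> 0 <= a -> 0 <= t ->
  (a `^ p^-1 <= t) = (a <= t `^ p).
Proof.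
move=> p0 a0 t0; apply/idP/idP => h.
  have := ge0_ler_powR (ltW p0) (powR_ge0 a p^-1) t0 h.
  by rewrite -powRrM mulVf ?gt_eqF// powRr1.
have p0' : 0 <= p^-1 by rewrite invr_ge0 ltW.
have := ge0_ler_powR p0' a0 (powR_ge0 t p) h.
by rewrite -powRrM mulfV ?gt_eqF// powRr1.
Qed.

Lemma poweR_inv_le p (a : \bar R) t : 0 < p -> (0 <= a)%E -> 0 <= t ->
  (a `^ p^-1 <= t%:E)%E = (a <= (t `^ p)%:E)%E.
Proof.
move=> p0 a0 t0; case: a a0 => [a||]//; last first.
  by move=> _; rewrite poweRyr ?invr_neq0 ?gt_eqF// !leye_eq.
by rewrite lee_fin poweR_EFin !lee_fin => a0; exact: powR_inv_le.
Qed.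

Lemma powR_le p a b : 0 <= p -> 0 <= a -> a <= b -> a `^ p <= b `^ p.
Proof. by move=> p0 a0 ab; apply: ge0_ler_powR => //; rewrite nnegrE (le_trans a0). Qed.

Lemma powRD_le p a b : 0 < p -> 0 <= a -> 0 <= b ->
  (a + b) `^ p <= 2 `^ p * (a `^ p + b `^ p).
Proof.
move=> p0; wlog ab : a b / a <= b => [H|] a0 b0.
  by case: (leP a b) => [|/ltW] h; [exact: H|rewrite addrC [_ `^ p + _]addrC; exact: H].
apply: (@le_trans _ _ ((2 * b) `^ p)).
  by apply: powR_le; [exact: ltW|exact: addr_ge0|lra].
by rewrite powRM// ler_wpM2l ?powR_ge0// lerDr powR_ge0.
Qed.

(** Below the level t the first term wins, above it the second. *)
Lemma le_add_powR p a t : 1 <= p -> 0 <= a -> 0 < t -> a <= t + t `^ (1 - p) * a `^ p.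
Proof.
move=> p1 a0 t0; case: (leP a t) => [at_|ta].
  by rewrite (le_trans at_)// lerDl mulr_ge0 ?powR_ge0.
rewrite (@le_trans _ _ (t `^ (1 - p) * a `^ p))//; last by rewrite lerDr ltW.
have aE : a `^ p = a * a `^ (p - 1).
  rewrite -{2}(powRr1 a0) -powRD ?subrKC//.
  by apply/implyP => _; rewrite gt_eqF// (lt_trans t0).
rewrite aE mulrCA ler_peMr// -[1 - p]opprB powRN ler_pdivlMl ?powR_gt0// mulr1.
apply: powR_le; [lra|exact: ltW|exact: ltW].
Qed.

(** Without the sharp constants, whichever of a^(p-1) and b is larger decides. *)
Lemma young_le p q a b : 1 < p -> q = p / (p - 1) -> 0 <= a -> 0 <= b ->
  a * b <= a `^ p + b `^ q.
Proof.
move=> p1 -> a0 b0; have p10 : 0 < p - 1 by rewrite subr_gt0.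
have [->|an0] := eqVneq a 0; first by rewrite mul0r addr_ge0 ?powR_ge0.
have [->|bn0] := eqVneq b 0; first by rewrite mulr0 addr_ge0 ?powR_ge0.
case: (leP b (a `^ (p - 1))) => h.
  rewrite (@le_trans _ _ (a `^ p))// ?lerDl ?powR_ge0//.
  rewrite -[in leRHS](subrKC 1 p) powRD; last by rewrite an0 implybT.
  by rewrite powRr1// ler_wpM2l.
rewrite (@le_trans _ _ (b `^ (p / (p - 1))))// ?lerDr ?powR_ge0//.
have -> : p / (p - 1) = (p - 1)^-1 + 1 by field; rewrite gt_eqF.
rewrite powRD; last by rewrite bn0 implybT.
rewrite powRr1// ler_wpM2r// leNgt; apply/negP => h2.
by move: (ltW h2); rewrite (powR_inv_le p10 b0 a0) leNgt h.
Qed.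

End real_powers.

Section Lp_norms.
Context (R : realType) (d : nat).
Implicit Types (Q L : cube R d) (h : RR R d -> R[i]) (p t : R).
Local Notation mu := (lebesgue R d).

Definition powint p h (D : set (RR R d)) : \bar R := (\int[mu]_(x in D) (normc (h x) `^ p)%:E)%E.

Lemma powint_ge0 p h D : (0 <= powint p h D)%E.
Proof. by apply: integral_ge0 => x _; rewrite lee_fin powR_ge0. Qed.

Lemma powintS p h (A B : set (RR R d)) : measurable A -> measurable B -> A `<=` B -> cmeasurable B h ->
  (powint p h A <= powint p h B)%E.
Proof.
move=> mA mB AB mh; apply: ge0_subset_integral => //; first exact: measurable_pow_normc.
by move=> x _; rewrite lee_fin powR_ge0.
Qed.

Lemma avg_normP p Q h t : 0 < p -> 0 <= t ->
  (avg_norm p%:E Q h <= t%:E)%E = (powint p h (cset Q) <= (t `^ p * vol Q)%:E)%E.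
Proof.
move=> p0 t0; rewrite /avg_norm poweR_inv_le//; last first.
  by rewrite mule_ge0// ?powint_ge0// lee_fin invr_ge0 ltW ?vol_gt0.
by rewrite lee_pdivrMl ?vol_gt0// -EFinM mulrC.
Qed.

Lemma cnormP p h t : 0 < p -> 0 <= t ->
  (cnorm mu p%:E h <= t%:E)%E = (powint p h setT <= (t `^ p)%:E)%E.
Proof.
move=> p0 t0.
have -> : cnorm mu p%:E h = (powint p h setT `^ p^-1)%E.
  rewrite /cnorm Lnorm.unlock; congr (_ `^ _)%E; apply: eq_integral => x _.
  by rewrite abse_EFin poweR_EFin ger0_norm// normc_ge0.
by rewrite poweR_inv_le// powint_ge0.
Qed.

Lemma cnormyP h t : 0 <= t ->
  (cnorm mu +oo%E h <= t%:E)%E <-> {ae mu, forall x, normc (h x) <= t}.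
Proof.
move=> t0; rewrite /cnorm Lnorm.unlock lebesgueT_gt0; split.
  move=> /ess_supP; apply: filterS => x /=.
  by rewrite lee_fin ger0_norm// normc_ge0.
move=> H; apply/ess_supP; apply: filterS H => x /=.
by rewrite lee_fin ger0_norm// normc_ge0.
Qed.

Lemma inLpP p h : 0 < p ->
  inLp mu p%:E h <-> cmeasurable setT h /\ (powint p h setT < +oo)%E.
Proof.
move=> p0; rewrite /inLp; split => -[mh h1]; split => //.
  have c0 : (0 <= cnorm mu p%:E h)%E by rewrite /cnorm Lnorm_ge0.
  move: (h1); rewrite -ge0_fin_numE// => /fineK e.
  have : (cnorm mu p%:E h <= (fine (cnorm mu p%:E h))%:E)%E by rewrite e.
  by rewrite cnormP ?fine_ge0// => /le_lt_trans; apply; rewrite ltry.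
move: h1; rewrite -ge0_fin_numE ?powint_ge0// => /fineK e.
have f0 : 0 <= fine (powint p h setT) by rewrite fine_ge0 ?powint_ge0.
apply: (@le_lt_trans _ _ ((fine (powint p h setT)) `^ p^-1)%:E); last exact: ltry.
by rewrite cnormP ?powR_ge0// -powRrM mulVf ?gt_eqF// powRr1// e.
Qed.

Lemma integral_cst_cset Q (c : R) : (\int[mu]_(x in cset Q) c%:E = (c * vol Q)%:E)%E.
Proof.
rewrite integral_cst; last exact: measurable_cset.
by rewrite EFinM; congr (_ * _)%E; exact: lebesgue_vol.
Qed.

(** Up to the harmless factor 2 this avoids Hoelder's inequality: integrate
    [le_add_powR] at the level of the average. *)
Lemma integral_normc_le p Q h t : 1 <= p -> 0 <= t -> cmeasurable (cset Q) h ->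
  (powint p h (cset Q) <= (t `^ p * vol Q)%:E)%E ->
  (\int[mu]_(x in cset Q) (normc (h x))%:E <= (2 * t * vol Q)%:E)%E.
Proof.
move=> p1 t0 mh hp; have p0 : 0 < p by rewrite (lt_le_trans ltr01).
have mQ := measurable_cset Q; have v0 := vol_gt0 Q.
apply/lee_addgt0Pr => e e0; pose T := t + e / (2 * vol Q).
have T0 : 0 < T by rewrite ltr_wpDl// divr_gt0// mulr_gt0.
have -> : ((2 * t * vol Q)%:E + e%:E = (2 * T * vol Q)%:E)%E.
  by rewrite -EFinD /T; congr EFin; field; rewrite gt_eqF.
have mp : measurable_fun (cset Q) (fun x => (normc (h x) `^ p)%:E) by exact: measurable_pow_normc.
apply: (@le_trans _ _ (\int[mu]_(x in cset Q) (T%:E + (T `^ (1 - p))%:E * (normc (h x) `^ p)%:E))%E).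
  apply: ge0_le_integral => //.
  - by move=> x _; rewrite lee_fin normc_ge0.
  - by apply/measurable_EFinP; exact: measurable_normc.
  - by apply: emeasurable_funD => //; exact: emeasurable_funM.
  - by move=> x _; rewrite -EFinM -EFinD lee_fin le_add_powR// normc_ge0.
rewrite ge0_integralD//; last 3 first.
- by move=> x _; rewrite lee_fin ltW.
- by move=> x _; rewrite -EFinM lee_fin mulr_ge0 ?powR_ge0.
- exact: emeasurable_funM.
rewrite integral_cst_cset ge0_integralZl//; last 2 first.
- by move=> x _; rewrite lee_fin powR_ge0.
- by rewrite lee_fin powR_ge0.
rewrite (_ : 2 * T * vol Q = T * vol Q + T * vol Q); last by ring.
rewrite EFinD leeD//.
apply: (@le_trans _ _ ((T `^ (1 - p))%:E * (T `^ p * vol Q)%:E)%E).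
  rewrite lee_wpmul2l ?lee_fin ?powR_ge0// (le_trans hp)// lee_fin ler_wpM2r ?(ltW v0)//.
  by apply: powR_le; [exact: ltW|by []|rewrite lerDl ltW// divr_gt0// mulr_gt0].
rewrite -EFinM lee_fin mulrA -powRD ?subrK ?powRr1 ?(ltW T0)//.
by apply/implyP => _; rewrite gt_eqF.
Qed.

Lemma powint_root p Q h : 0 < p -> (powint p h (cset Q) < +oo)%E ->
  exists2 a : R, 0 <= a & powint p h (cset Q) = (a `^ p * vol Q)%:E.
Proof.
move=> p0 hoo; have v0 := vol_gt0 Q.
have hf : powint p h (cset Q) \is a fin_num by rewrite ge0_fin_numE// powint_ge0.
exists ((fine (powint p h (cset Q)) / vol Q) `^ p^-1); first exact: powR_ge0.
rewrite -powRrM mulVf ?gt_eqF// powRr1; last first.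
  by rewrite divr_ge0 ?(ltW v0)// fine_ge0// powint_ge0.
by rewrite divfK ?gt_eqF// fineK.
Qed.

Lemma powint_bound p Q h : 0 < p -> (powint p h (cset Q) < +oo)%E ->
  exists2 t, 0 <= t & (powint p h (cset Q) <= (t `^ p * vol Q)%:E)%E.
Proof. by move=> p0 /(powint_root p0)[t t0 ->]; exists t. Qed.

Lemma cintegrable_Lp p Q h : 1 <= p -> cmeasurable (cset Q) h ->
  (powint p h (cset Q) < +oo)%E -> cintegrable mu (cset Q) h.
Proof.
move=> p1 mh hp; have p0 : 0 < p by rewrite (lt_le_trans ltr01).
have [t t0 ht] := powint_bound p0 hp.
apply: cintegrableP => //; first exact: measurable_cset.
by rewrite (le_lt_trans (integral_normc_le p1 t0 mh ht))// ltry.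
Qed.

Lemma powint_bounded p h Q G : 0 < p -> 0 <= G -> cmeasurable setT h ->
  {ae mu, forall x, normc (h x) <= G} -> vanishes_off h (cset Q) ->
  (powint p h setT <= (G `^ p * vol Q)%:E)%E.
Proof.
move=> p0 G0 mh hG hQ; have mQ := measurable_cset Q.
rewrite EFinM -lebesgue_vol -[X in mu X]setIT -integral_indic// -ge0_integralZl//; last 2 first.
- by apply/measurable_EFinP; exact: measurable_indic.
- by rewrite lee_fin powR_ge0.
apply: ae_ge0_le_integral => //.
- by move=> x _; rewrite lee_fin powR_ge0.
- exact: measurable_pow_normc.
- by move=> x _; rewrite -EFinM lee_fin mulr_ge0 ?powR_ge0.
- by apply: emeasurable_funM => //; apply/measurable_EFinP; exact: measurable_indic.
apply: filterS hG => x hx _; rewrite -EFinM lee_fin indicE.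
case: (boolP (x \in cset Q)) => [_|/negP nQ]; first by rewrite mulr1; apply: powR_le; [exact: ltW|exact: normc_ge0|].
rewrite mulr0 hQ ?normc0 ?powR0 ?gt_eqF//.
by move=> Qx; apply: nQ; rewrite in_setE.
Qed.

Lemma powintD p (f g : RR R d -> R[i]) D : 0 < p -> measurable D -> cmeasurable D f -> cmeasurable D g ->
  (powint p (fun x => (f x + g x)%R) D <= (2 `^ p)%:E * (powint p f D + powint p g D))%E.
Proof.
move=> p0 mD mf mg; have mfp := @measurable_pow_normc _ _ _ _ _ p mf.
have mgp := @measurable_pow_normc _ _ _ _ _ p mg.
rewrite -ge0_integralD//; last 2 first.
- by move=> x _; rewrite lee_fin powR_ge0.
- by move=> x _; rewrite lee_fin powR_ge0.
rewrite -ge0_integralZl//; last 2 first.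
- exact: emeasurable_funD.
- by move=> x _; rewrite -EFinD lee_fin addr_ge0 ?powR_ge0.
apply: ge0_le_integral => //.
- by move=> x _; rewrite lee_fin powR_ge0.
- by apply: measurable_pow_normc; exact: cmeasurableD.
- by apply: emeasurable_funM => //; exact: emeasurable_funD.
- move=> x _; rewrite -EFinD -EFinM lee_fin (le_trans _ (powRD_le _ _ _)) ?normc_ge0//.
  by apply: powR_le; [exact: ltW|exact: normc_ge0|exact: le_normcD].
Qed.

End Lp_norms.

(** * The Calderon-Zygmund decomposition *)

Section calderon_zygmund.
Context (R : realType) (d : nat).
Implicit Types (Q L : cube R d) (h : RR R d -> R[i]) (p t : R) (Qs : set (cube R d)).
Local Notation mu := (lebesgue R d).
Local Notation grid := (@grid R d).

Lemma powint_support p h Q : 0 < p -> vanishes_off h (cset Q) ->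
  powint p h setT = powint p h (cset Q).
Proof.
move=> p0 hQ; rewrite /powint [RHS]integral_mkcond; apply: eq_integral => x _.
rewrite patchE; case: ifPn => // /negP nQ; rewrite hQ ?normc0 ?powR0 ?gt_eqF//.
by move=> Qx; apply: nQ; rewrite in_setE.
Qed.

Lemma cmeasurable_pieces Qs h : Qs `<=` grid ->
  (forall L, Qs L -> cmeasurable (cset L) h) -> cmeasurable (~` shadow Qs) h ->
  cmeasurable setT h.
Proof.
move=> Qg hL hC.
pose E n := if n is m.+1 then grid_family Qs (@cset R d) m else ~` shadow Qs.
have mE n : measurable (E n).
  case: n => [|n] /=; first by apply: measurableC; exact: measurable_shadow.
  by apply: measurable_grid_family => L _; exact: measurable_cset.
have ET : setT = \bigcup_n E n.
  apply/seteqP; split => // x _; case: (pselect (shadow Qs x)) => [|nx]; last by exists 0%N.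
  by rewrite /shadow -bigcup_grid_family// => -[n _ ?]; exists n.+1.
have hE n : cmeasurable (E n) h.
  case: n => [//|n] /=; rewrite /grid_family; case: grid_at => [L|].
    case: asboolP => [/hL//|_]; split; exact: measurable_fun_set0.
  split; exact: measurable_fun_set0.
rewrite ET; split; apply/measurable_fun_bigcup => // n; by have [] := hE n.
Qed.

Definition cavg h L : R[i] := (vol L)^-1%:C * cintegral mu (cset L) h.

(** For disjoint cubes the sum has at most one nonzero term at every point. *)
Definition czbad Qs h x : R[i] :=
  \sum_(L \in Qs) (h x - cavg h L) * \1_(cset L) x.

Lemma czbadE Qs h L x : trivIset Qs (@cset R d) -> Qs L -> cset L x ->
  czbad Qs h x = h x - cavg h L.
Proof.
move=> tQ QL Lx; rewrite /czbad -(@fsbig_widen _ _ _ _ [set L])//=.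
- by rewrite fsbig_set1 indicE mem_set// mulr1.
- by move=> _ ->.
- move=> L' [QL' /= L'L]; rewrite indicE memNset ?mulr0// => L'x; apply: L'L.
  by apply: (tQ _ _ QL' QL); exists x.
Qed.

Lemma czbad_off Qs h x : ~ shadow Qs x -> czbad Qs h x = 0.
Proof.
move=> nx; rewrite /czbad fsbig1// => L QL; rewrite indicE memNset ?mulr0// => Lx.
by apply: nx; exists L.
Qed.

Lemma normc_cavg_le p h L t : 1 <= p -> 0 <= t -> cmeasurable (cset L) h ->
  (powint p h (cset L) <= (t `^ p * vol L)%:E)%E -> normc (cavg h L) <= 4 * t.
Proof.
move=> p1 t0 mh ht; rewrite /cavg normcM normc_real gtr0_norm ?invr_gt0 ?vol_gt0//.
rewrite ler_pdivrMl ?vol_gt0//.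
have := normc_cintegral_le (measurable_cset L) mh (integral_normc_le p1 t0 mh ht).
by move=> /le_trans; apply; rewrite le_eqVlt; apply/orP; left; apply/eqP; ring.
Qed.

Lemma maximal_ge p Q h x : cset Q x -> (avg_norm p%:E Q h <= maximal p%:E h x)%E.
Proof. by move=> Qx; apply: ereal_sup_ubound; exists Q. Qed.

Lemma Ynorm_le p Qs h lam : 0 <= lam -> (Ynorm p%:E Qs h <= lam%:E)%E <->
  {ae mu, forall x, normc (h x * \1_(~` shadow Qs) x) <= lam} /\
  forall L, Qs L -> (ereal_inf [set maximal p%:E h x | x in dilate (2 ^+ 5) L] <= lam%:E)%E.
Proof.
move=> l0; rewrite /Ynorm /= ge_max; split.
  move=> /andP[/(cnormyP _ l0) h1 h2]; split => // L QL; apply: le_trans h2.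
  by apply: ereal_sup_ubound; exists L.
move=> [/(cnormyP _ l0) -> h2] /=; apply: ge_ereal_sup => _ [L QL <-]; exact: h2.
Qed.

Lemma Ynorm_ge0 (p : \bar R) Qs h : (0 <= Ynorm p Qs h)%E.
Proof.
rewrite /Ynorm; case: ifP => _; first exact: Lnorm_ge0.
by rewrite le_max /cnorm Lnorm_ge0.
Qed.

Lemma dil5_gt0 : 0 < 2 ^+ 5 :> R.
Proof. by rewrite exprn_gt0. Qed.

(** Some point of 32L has maximal function at most about lam, and 32L is one of
    the cubes over which that supremum is taken. *)
Lemma Ynorm_powint p Qs h lam L : 1 <= p -> 0 <= lam -> cmeasurable setT h ->
  (Ynorm p%:E Qs h <= lam%:E)%E -> Qs L ->
  (powint p h (cset L) <= ((32 ^+ d * lam) `^ p * vol L)%:E)%E.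
Proof.
move=> p1 l0 mh /(Ynorm_le _ _ _ l0)[_ hY] QL.
have p0 : 0 < p by rewrite (lt_le_trans ltr01).
have : (avg_norm p%:E (dil dil5_gt0 L) h <= lam%:E)%E.
  apply: le_trans (hY L QL); apply: le_ereal_inf_tmp => _ [x Lx <-].
  by apply: maximal_ge; rewrite cset_dil.
rewrite avg_normP// vol_dil => h1.
apply: (@le_trans _ _ (powint p h (cset (dil dil5_gt0 L)))).
  apply: powintS; [exact: measurable_cset|exact: measurable_cset| |].
    by rewrite cset_dil -[X in X `<=` _]dilate1; apply: dilateS; rewrite // -natrX ler1n.
  by apply: cmeasurableS mh.
apply: le_trans h1 _; rewrite lee_fin mulrA ler_wpM2r ?(ltW (vol_gt0 _))//.
rewrite powRM ?exprn_ge0// mulrC ler_wpM2r ?powR_ge0//.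
rewrite (_ : (2 ^+ 5) = 32); last by rewrite -natrX.
by rewrite -[leLHS]powRr1 ?exprn_ge0// ler_powR// exprn_ege1// ler1n.
Qed.

(** A bounded perturbation costs a factor only; it is applied to the difference of
    a function and its means. *)
Lemma maximal_perturb p h b (G s : R) x : 1 <= p -> 0 <= s -> 0 <= G ->
  cmeasurable setT h -> cmeasurable setT b ->
  (forall y, normc (b y) <= normc (h y) + G) ->
  (maximal p%:E h x <= s%:E)%E -> (maximal p%:E b x <= (4 * (s + G))%:E)%E.
Proof.
move=> p1 s0 G0 mh mb bh hs; have p0 : 0 < p by rewrite (lt_le_trans ltr01).
have sG : 0 <= s + G by rewrite addr_ge0.
apply: ge_ereal_sup => _ [Q Qx <-]; rewrite avg_normP ?mulr_ge0//.
have : (avg_norm p%:E Q h <= s%:E)%E by apply: le_trans hs; exact: maximal_ge.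
rewrite avg_normP// => hQ; have mQ := measurable_cset Q.
have mhQ : cmeasurable (cset Q) h by apply: cmeasurableS mh.
have mbQ : cmeasurable (cset Q) b by apply: cmeasurableS mb.
apply: (@le_trans _ _ (\int[mu]_(y in cset Q) ((2 `^ p)%:E * ((normc (h y) `^ p)%:E + (G `^ p)%:E)))%E).
  apply: ge0_le_integral => //.
  - by move=> y _; rewrite lee_fin powR_ge0.
  - exact: measurable_pow_normc.
  - apply: emeasurable_funM => //; apply: emeasurable_funD => //; exact: measurable_pow_normc.
  - move=> y _; rewrite -EFinD -EFinM lee_fin (le_trans _ (powRD_le _ _ _)) ?normc_ge0//.
    by apply: powR_le; [exact: ltW|exact: normc_ge0|].
rewrite ge0_integralZl//; last 2 first.
- by apply: emeasurable_funD => //; exact: measurable_pow_normc.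
- by move=> y _; rewrite -EFinD lee_fin addr_ge0 ?powR_ge0.
rewrite ge0_integralD//; last 3 first.
- by move=> y _; rewrite lee_fin powR_ge0.
- exact: measurable_pow_normc.
- by move=> y _; rewrite lee_fin powR_ge0.
rewrite integral_cst_cset.
apply: (@le_trans _ _ ((2 `^ p)%:E * ((s `^ p * vol Q)%:E + (G `^ p * vol Q)%:E))%E).
  by rewrite lee_wpmul2l ?lee_fin ?powR_ge0// leeD2r.
rewrite -EFinD -EFinM lee_fin -mulrDl mulrA ler_wpM2r ?(ltW (vol_gt0 _))//.
rewrite (_ : 4 * (s + G) = 2 * (2 * (s + G))); last by ring.
rewrite powRM ?mulr_ge0// ler_wpM2l ?powR_ge0// powRM//.
apply: (@le_trans _ _ (2 * (s + G) `^ p)).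
  rewrite mulr2n mulrDl !mul1r; apply: lerD; apply: powR_le => //; rewrite ?(ltW p0)//; lra.
by rewrite ler_wpM2r ?powR_ge0// -[leLHS]powRr1// ler_powR// ler1n.
Qed.

Lemma cintegrable_cst_cset Q (c : R[i]) : cintegrable mu (cset Q) (fun=> c).
Proof.
apply: cintegrableP; [exact: measurable_cset|exact: cmeasurable_cst|].
by rewrite integral_cst_cset ltry.
Qed.

Lemma cintegral_cst_cset Q (c : R[i]) : cintegral mu (cset Q) (fun=> c) = (vol Q)%:C * c.
Proof.
have mQ := measurable_cset Q; rewrite /cintegral !Rintegral_cst//.
by case: c => u v; rewrite /= -[LHS]/(_ +i* _); congr (_ +i* _); rewrite /vol; ring.
Qed.

(** The bad part is h minus its mean on each cube of the collection. The means are
    bounded by [Ynorm_powint], so that the good part is bounded, and for the same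
    reason the maximal function of the bad part is not much larger than that of h. *)
Lemma cz_decomposition p Q Qs h lam : 1 <= p -> 0 <= lam -> Qs `<=` grid ->
  trivIset Qs (@cset R d) -> (forall L, Qs L -> cset L `<=` dilate 3 Q) ->
  inLp mu p%:E h -> vanishes_off h (dilate 3 Q) -> (Ynorm p%:E Qs h <= lam%:E)%E ->
  exists b g, [/\ forall x, h x = b x + g x, X0space p%:E Q Qs b,
    (Ynorm p%:E Qs b <= (20 * 32 ^+ d * lam)%:E)%E &
    [/\ cmeasurable setT g, {ae mu, forall x, normc (g x) <= 4 * 32 ^+ d * lam} &
    vanishes_off g (dilate 3 Q)]].
Proof.
move=> p1 l0 Qg tQ QQ hLp hv hY; have p0 : 0 < p by rewrite (lt_le_trans ltr01).
have [mh hoo] := (inLpP h p0).1 hLp.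
have [hae hinf] := (Ynorm_le p Qs h l0).1 hY.
pose b := czbad Qs h; pose g x := h x - b x.
pose G := 4 * 32 ^+ d * lam.
have e1 : 1 <= 32 ^+ d :> R by rewrite exprn_ege1// ler1n.
have G0 : 0 <= G by rewrite !mulr_ge0// (le_trans ler01).
have mhL L : cmeasurable (cset L) h by apply: cmeasurableS mh.
have aG L : Qs L -> normc (cavg h L) <= G.
  move=> QL; rewrite /G -mulrA; apply: (normc_cavg_le p1 _ (mhL L)).
    by rewrite mulr_ge0// (le_trans ler01).
  exact: (Ynorm_powint p1 l0 mh hY).
have mS : measurable (shadow Qs) by exact: measurable_shadow.
have bL L x : Qs L -> cset L x -> b x = h x - cavg h L by move=> QL Lx; exact: czbadE.
have bO x : ~ shadow Qs x -> b x = 0 by exact: czbad_off.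
have bh x : normc (b x) <= normc (h x) + G.
  case: (pselect (shadow Qs x)) => [[L QL Lx]|nx].
    rewrite (bL L)//; rewrite (le_trans (le_normcD _ _))// normcN lerD2l; exact: aG.
  by rewrite bO// normc0 addr_ge0// normc_ge0.
have eqm (D : set (RR R d)) (f1 f2 : RR R d -> R[i]) : {in D, f1 =1 f2} -> cmeasurable D f2 -> cmeasurable D f1.
  move=> e [m1 m2]; split.
    by apply: eq_measurable_fun m1 => x xD; rewrite e.
  by apply: eq_measurable_fun m2 => x xD; rewrite e.
have mb : cmeasurable setT b.
  apply: (@cmeasurable_pieces Qs) => // [L QL|].
    apply: (eqm _ _ (fun x => h x + - cavg h L)).
      by move=> x; rewrite in_setE => Lx; exact: bL.
    by apply: cmeasurableD => //; exact: cmeasurable_cst.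
  apply: (eqm _ _ (fun=> 0)); last exact: cmeasurable_cst.
  by move=> x; rewrite in_setE => nx; exact: bO.
have bv : vanishes_off b (dilate 3 Q).
  by move=> x nx; apply: bO => -[L QL Lx]; apply: nx; exact: QQ Lx.
have bY : (Ynorm p%:E Qs b <= (20 * 32 ^+ d * lam)%:E)%E.
  apply/Ynorm_le; first by rewrite !mulr_ge0// (le_trans ler01).
  split.
    apply: aeW => x; rewrite indicE; case: (boolP (x \in _)) => [|_].
      by rewrite in_setE => nx; rewrite bO// mul0r normc0 !mulr_ge0// (le_trans ler01).
    by rewrite mulr0 normc0 !mulr_ge0// (le_trans ler01).
  move=> L QL; apply/lee_addgt0Pr => e e0.
  have [x [Lx hx]] : exists x, dilate (2 ^+ 5) L x /\ (maximal p%:E h x <= (lam + e / 4)%:E)%E.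
    have /ereal_inf_lt[_ [x Lx <-] hx] : (ereal_inf [set maximal p%:E h x | x in dilate (2 ^+ 5) L] < (lam + e / 4)%:E)%E.
      by rewrite (le_lt_trans (hinf L QL))// lte_fin ltrDl divr_gt0.
    by exists x; split => //; exact: ltW.
  apply: (@le_trans _ _ (maximal p%:E b x)); first by apply: ereal_inf_lbound; exists x.
  apply: le_trans (maximal_perturb p1 _ G0 mh mb bh hx) _.
    by rewrite addr_ge0// divr_ge0// ltW.
  rewrite -EFinD lee_fin /G; have : lam <= 32 ^+ d * lam by rewrite ler_peMl.
  lra.
have c30 : 0 < 3 :> R by [].
have v3 f : vanishes_off f (dilate 3 Q) -> vanishes_off f (cset (dil c30 Q)).
  by rewrite cset_dil.
have mg : cmeasurable setT g.
  rewrite /g; under eq_fun do rewrite -[b _]opprK opprK -mulN1r.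
  by apply: cmeasurableD => //; apply: cmeasurableM => //; exact: cmeasurable_cst.
have gG : {ae mu, forall x, normc (g x) <= G}.
  apply: filterS hae => x; case: (pselect (shadow Qs x)) => [[L QL Lx] _|nx].
    by rewrite /g (bL L)// subKr; exact: aG.
  rewrite indicE mem_set// mulr1 /g bO// subr0 => /le_trans; apply.
  by rewrite /G ler_peMl//; lra.
have gv : vanishes_off g (dilate 3 Q) by move=> x nx; rewrite /g hv// bv// subr0.
exists b, g; split => //; first by move=> x; rewrite /g addrC subrK.
have bLp : inLp mu p%:E b.
  apply: (inLpP b p0).2; split; first exact: mb.
  rewrite (powint_support p0 (v3 _ bv)).
  pose ng (x : RR R d) : R[i] := -1 * g x.
  have mng : cmeasurable setT ng by apply: cmeasurableM => //; exact: cmeasurable_cst.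
  have nG : {ae mu, forall x, normc (ng x) <= G}.
    by apply: filterS gG => x; rewrite /ng mulN1r normcN.
  have nv : vanishes_off ng (cset (dil c30 Q)).
    by rewrite cset_dil => x nx; rewrite /ng gv// mulr0.
  have goo : (powint p ng setT < +oo)%E.
    exact: le_lt_trans (powint_bounded p0 G0 mng nG nv) (ltry _).
  have bE : b = fun x => h x + ng x.
    by apply/funext => x; rewrite /ng /g mulN1r opprB addrC subrK.
  apply: (@le_lt_trans _ _ (powint p b setT)).
    by apply: powintS => //; exact: measurable_cset.
  rewrite bE; apply: le_lt_trans (powintD p0 measurableT mh mng) _.
  apply: lte_mul_pinfty; [by rewrite lee_fin powR_ge0|by []|exact: lte_add_pinfty].
split; first by split => //; rewrite (le_lt_trans bY)// ltry.
exists (fun L x => (h x - cavg h L) * \1_(cset L) x); split => //.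
- by move=> L QL x nx; rewrite indicE memNset// mulr0.
- move=> L QL; have mL := measurable_cset L.
  have -> : cintegral mu (cset L) (fun x => (h x - cavg h L) * \1_(cset L) x) =
      cintegral mu (cset L) (fun x => h x + - cavg h L).
    by apply: eq_cintegral => x Lx; rewrite indicE Lx mulr1.
  have ih : cintegrable mu (cset L) h.
    by apply: (cintegrable_Lp p1 (mhL L)); apply: le_lt_trans hoo; apply: powintS.
  rewrite cintegralD//; last exact: cintegrable_cst_cset.
  rewrite cintegral_cst_cset /cavg mulrN mulrA -rmorphM /= mulfV ?gt_eqF ?vol_gt0//.
  by rewrite mul1r subrr.
Qed.

End calderon_zygmund.

(** * Functions of bounded support *)

Section supports.
Context (R : realType) (d : nat).
Implicit Types (Q L : cube R d) (h : RR R d -> R[i]) (p : R).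
Local Notation mu := (lebesgue R d).

(** Equivalent to compactness of [supp h], in a form that needs no topology. *)
Definition bounded_support h := exists Q, vanishes_off h (cset Q).

Lemma compact_supp h : bounded_support h -> compact (supp h).
Proof.
move=> [Q hQ]; pose B := [set v : 'rV[R]_d | forall i,
  `[tnth (corner Q) i, tnth (corner Q) i + side Q]%classic (v ord0 i)].
have cB : compact B := @rV_compact R d _ (fun i => @segment_compact R _ _).
have clB : closed B by apply: compact_closed cB; exact: norm_hausdorff.
apply: subclosed_compact cB _; first exact: closed_closure.
rewrite (closure_id B).1//; apply: closureS => _ [x /= hx <-] i /=.
rewrite mxE in_itv /=; have Qx : cset Q x.
  by apply: contrapT => nx; move: hx; rewrite hQ// eqxx.
by have /andP[-> /ltW] := Qx i.
Qed.

Lemma compact_supp_bound h : compact (supp h) ->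
  exists2 M : R, 0 <= M & forall x i, h x != 0 -> `|tnth x i| <= M.
Proof.
move=> /compact_coord_bound[M M0 HM]; exists M => // x i hx.
have := HM (rowv x) i; rewrite mxE; apply.
by apply: subset_closure; exists x.
Qed.

Definition centered_cube (M : R) (M0 : 0 < M) : cube R d :=
  @Cube R d [tuple - M | i < d] (2 * M) (mulr_gt0 (ltr0n R 2) M0).

Lemma centered_cubeP M (M0 : 0 < M) x : (forall i, `|tnth x i| < M) ->
  cset (centered_cube M0) x.
Proof.
move=> h i; rewrite tnth_mktuple /=; have := h i; rewrite ltr_norml => /andP[h1 h2].
by apply/andP; split; lra.
Qed.

Lemma bounded_support_compact h : compact (supp h) -> bounded_support h.
Proof.
move=> /compact_supp_bound[M M0 HM]; have M1 : 0 < M + 1 by rewrite ltr_wpDl.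
exists (centered_cube M1) => x nx; apply/eqP; apply: contrapT => /negP hx.
apply: nx; apply: centered_cubeP => i; rewrite (le_lt_trans (HM x i hx))//.
by rewrite ltrDl.
Qed.

Lemma bounded_supportD (f g : RR R d -> R[i]) : bounded_support f -> bounded_support g ->
  bounded_support (fun x => f x + g x).
Proof.
move=> /compact_supp/compact_supp_bound[M M0 hM] /compact_supp/compact_supp_bound[N N0 hN].
have MN : 0 < M + N + 1 by rewrite ltr_wpDl// addr_ge0.
exists (centered_cube MN) => x nx; apply/eqP; apply: contrapT => /negP hx.
apply: nx; apply: centered_cubeP => i.
have [f0|f0] := eqVneq (f x) 0; last by rewrite (le_lt_trans (hM x i f0))//; lra.
have g0 : g x != 0 by move: hx; rewrite f0 add0r.
by rewrite (le_lt_trans (hN x i g0))//; lra.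
Qed.

Lemma bounded_supportMl (f g : RR R d -> R[i]) : bounded_support g ->
  bounded_support (fun x => f x * g x).
Proof. by move=> [Q hQ]; exists Q => x nx; rewrite hQ// mulr0. Qed.

Lemma bounded_supportMr (f g : RR R d -> R[i]) : bounded_support f ->
  bounded_support (fun x => f x * g x).
Proof. by move=> [Q hQ]; exists Q => x nx; rewrite hQ// mul0r. Qed.

Lemma bounded_support_dilate (c : R) Q h : 0 < c -> vanishes_off h (dilate c Q) ->
  bounded_support h.
Proof. by move=> c0; rewrite -(cset_dil c0) => ?; exists (dil c0 Q). Qed.

(** The functions on which the truncated forms are defined by absolutely convergent
    integrals, and therefore additive. *)
Definition admissible p h := inLp mu p%:E h /\ bounded_support h.

Lemma inLpD p (f g : RR R d -> R[i]) : 0 < p -> inLp mu p%:E f -> inLp mu p%:E g ->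
  inLp mu p%:E (fun x => f x + g x).
Proof.
move=> p0 /(inLpP _ p0)[mf foo] /(inLpP _ p0)[mg goo]; apply: (inLpP _ p0).2.
split; first exact: cmeasurableD.
apply: le_lt_trans (powintD p0 measurableT mf mg) _.
apply: lte_mul_pinfty; [by rewrite lee_fin powR_ge0|by []|exact: lte_add_pinfty].
Qed.

Lemma inLp_dominated p (f g : RR R d -> R[i]) (c : R) : 0 < p -> 0 <= c -> inLp mu p%:E f ->
  cmeasurable setT g -> (forall x, normc (g x) <= c * normc (f x)) -> inLp mu p%:E g.
Proof.
move=> p0 c0 /(inLpP _ p0)[mf foo] mg gf; apply: (inLpP _ p0).2; split; first exact: mg.
have mfp := @measurable_pow_normc _ _ _ _ _ p mf.
apply: (@le_lt_trans _ _ ((c `^ p)%:E * powint p f setT)%E); last first.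
  by apply: lte_mul_pinfty; rewrite // lee_fin powR_ge0.
rewrite -ge0_integralZl//; last 2 first.
- by move=> x _; rewrite lee_fin powR_ge0.
- by rewrite lee_fin powR_ge0.
apply: ge0_le_integral => //.
- by move=> x _; rewrite lee_fin powR_ge0.
- exact: measurable_pow_normc.
- exact: emeasurable_funM.
- move=> x _; rewrite -EFinM lee_fin -powRM ?normc_ge0//.
  by apply: powR_le; [exact: ltW|exact: normc_ge0|exact: gf].
Qed.

Lemma inLp_indic p (A : set (RR R d)) h : 0 < p -> measurable A -> inLp mu p%:E h ->
  inLp mu p%:E (fun x => h x * \1_A x).
Proof.
move=> p0 mA hp; apply: (inLp_dominated p0 ler01 hp).
  by apply: cmeasurableM; [have [] := hp|exact: cmeasurable_indic].
move=> x; rewrite mul1r normcM normc_indic indicE.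
by case: (x \in A); rewrite ?mulr1 ?mulr0 ?normc_ge0.
Qed.

Lemma inLpZ p (c : R[i]) h : 0 < p -> inLp mu p%:E h -> inLp mu p%:E (fun x => c * h x).
Proof.
move=> p0 hp; apply: (inLp_dominated p0 (normc_ge0 c) hp).
  by apply: cmeasurableM; [exact: cmeasurable_cst|have [] := hp].
by move=> x; rewrite normcM.
Qed.

Lemma inLp0 p : 0 < p -> inLp mu p%:E (fun=> 0).
Proof.
move=> p0; apply: (inLpP _ p0).2; split; first exact: cmeasurable_cst.
by rewrite /powint; under eq_integral do rewrite normc0 powR0 ?gt_eqF//; rewrite integral0.
Qed.

Lemma cnorm0 p : 0 < p -> cnorm mu p%:E (fun=> 0) = 0%E.
Proof.
move=> p0; apply/eqP; rewrite eq_le /cnorm Lnorm_ge0 andbT.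
rewrite -[leLHS]/(cnorm mu p%:E (fun=> 0)) cnormP// powR0 ?gt_eqF//.
by rewrite /powint; under eq_integral do rewrite normc0 powR0 ?gt_eqF//; rewrite integral0.
Qed.

Lemma admissibleD p (f g : RR R d -> R[i]) : 0 < p -> admissible p f -> admissible p g ->
  admissible p (fun x => f x + g x).
Proof. by move=> p0 [f1 f2] [g1 g2]; split; [exact: inLpD|exact: bounded_supportD]. Qed.

Lemma admissible_indic p (A : set (RR R d)) h : 0 < p -> measurable A -> admissible p h ->
  admissible p (fun x => h x * \1_A x).
Proof. by move=> p0 mA [f1 f2]; split; [exact: inLp_indic|exact: bounded_supportMr]. Qed.

Lemma admissibleZ p (c : R[i]) h : 0 < p -> admissible p h -> admissible p (fun x => c * h x).
Proof. by move=> p0 [f1 f2]; split; [exact: inLpZ|exact: bounded_supportMl]. Qed.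

Lemma admissible_sum p (I : Type) (s : seq I) (F : I -> RR R d -> R[i]) : 0 < p ->
  (forall i, admissible p (F i)) -> admissible p (fun x => \sum_(i <- s) F i x).
Proof.
move=> p0 hF; elim: s => [|a s IH].
  under eq_fun do rewrite big_nil; split; first exact: inLp0.
  by exists (centered_cube ltr01).
by under eq_fun do rewrite big_cons; exact: admissibleD.
Qed.

Lemma admissible_bounded p h G c Q : 0 < p -> 0 < c -> 0 <= G -> cmeasurable setT h ->
  {ae mu, forall x, normc (h x) <= G} -> vanishes_off h (dilate c Q) -> admissible p h.
Proof.
move=> p0 c0 G0 mh hG hv; split; last exact: bounded_support_dilate hv.
apply: (inLpP _ p0).2; split => //; rewrite -(cset_dil c0) in hv.
exact: le_lt_trans (powint_bounded p0 G0 mh hG hv) (ltry _).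
Qed.

End supports.

(** * The scalar estimate for stopping forms *)

Section truncated_forms.
Context (R : realType) (d : nat).
Implicit Types (Q L : cube R d) (f g h : RR R d -> R[i]) (m n : int).
Local Notation mu := (lebesgue R d).
Local Notation mu2 := (mu \x mu)%E.
Local Notation grid := (@grid R d).

Lemma edistC (x y : RR R d) : edist x y = edist y x.
Proof. by rewrite /edist; congr Num.sqrt; apply: eq_bigr => i _; rewrite -sqrrN opprB. Qed.

Context (Ks : int -> RR R d -> RR R d -> R[i]).

Definition kern m n x y : R[i] := \sum_(s \in [set s : int | m < s <= n]) Ks s x y.

Lemma kern_empty m n x y : (n <= m)%R -> kern m n x y = 0.
Proof. by move=> nm; apply: fsbig1 => s /= /andP[h1 h2]; lia. Qed.

Lemma trunc_integrandE m n f g z :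
  trunc_integrand Ks m n f g z = kern m n z.1 z.2 * f z.2 * (g z.1)^*.
Proof. by []. Qed.

Lemma trunc_empty m n f g : (n <= m)%R -> trunc Ks m n f g = 0.
Proof.
move=> nm; rewrite /trunc (_ : trunc_integrand _ _ _ _ _ = fun=> 0) ?cintegral0//.
by apply/funext => z; rewrite trunc_integrandE kern_empty// !mul0r.
Qed.

Lemma eq_trunc m n m' n' f g f' g' :
  (forall x y, kern m n x y * f y * (g x)^* = kern m' n' x y * f' y * (g' x)^*) ->
  trunc Ks m n f g = trunc Ks m' n' f' g'.
Proof. by move=> e; rewrite /trunc; congr cintegral; apply/funext => z; exact: e. Qed.

Lemma local_form_empty Q m n f g : (scale Q <= m)%R -> local_form Ks Q m n f g = 0.
Proof. by move=> h; apply: trunc_empty; rewrite ge_min h. Qed.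

(** The cubes whose local forms, truncated at scale m, need not vanish. *)
Definition big_children Q (Qs : set (cube R d)) m : set (cube R d) :=
  [set L | [/\ Qs L, cset L `<=` cset Q & (m < scale L)%R]].

Lemma finite_big_children Q Qs m : Qs `<=` grid -> trivIset Qs (@cset R d) ->
  finite_set (big_children Q Qs m).
Proof.
move=> Qg tQ; apply: (@finite_large_cubes R d _ Q ((2 ^ m) ^+ d)).
- by rewrite exprn_gt0// pow2_gt0.
- by apply: sub_trivIset tQ => L [].
- by move=> L [].
- move=> L [/Qg[k [x ->]] _]; rewrite scale_dyad => mk; rewrite vol_dyad.
  by rewrite lerXn2r// ?nnegrE ?(ltW (pow2_gt0 _ _))// pow2_le// ltW.
Qed.

Lemma stopping_formE Q Qs m n f g : stopping_form Ks Q Qs m n f g =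
  local_form Ks Q m n f g - \sum_(L \in big_children Q Qs m) local_form Ks L m n f g.
Proof.
congr (_ - _); apply/esym/fsbig_widen => [L []//|L [[/= QL LQ] nL] /=].
apply: local_form_empty; rewrite leNgt; apply/negP => h; apply: nL; split => //.
Qed.

Context (Ksupp : kernel_support Ks).

Lemma kern_near m n x y : kern m n x y != 0 -> edist x y < 2 ^ n.
Proof.
move=> k0; rewrite ltNge; apply: contra k0 => h; apply/eqP; apply: fsbig1 => s /= /andP[_ sn].
apply/eqP; apply: contrapT => /negP /Ksupp/andP[_]; rewrite ltNge (le_trans _ h)//.
exact: pow2_le.
Qed.

(** The scales above n see only distances greater than 2^(n - 1). *)
Lemma kern_far m n n' x y : (n <= n')%R -> edist x y <= 2 ^ (n - 1) ->
  kern m n x y = kern m n' x y.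
Proof.
move=> nn h; apply: fsbig_widen => [s /= /andP[-> sn]/=|s [/= /andP[h1 h2] /= h3]].
  exact: le_trans nn.
apply/eqP; apply: contrapT => /negP /Ksupp/andP[]; rewrite ltNge (le_trans h)//.
rewrite pow2_le//; have : (n < s)%R.
  by rewrite ltNge; apply/negP => sn; apply: h3; rewrite h1.
by lia.
Qed.

Lemma local_formE Q m n f g : grid Q -> local_form Ks Q m n f g =
  trunc Ks m (Num.min (scale Q) n) (fun y => f y * \1_(cset Q) y)
    (fun x => g x * \1_(dilate 3 Q) x).
Proof.
move=> [k [x0 eQ]]; apply: eq_trunc => x y.
have [->|k0] := eqVneq (kern m (Num.min (scale Q) n) x y) 0; first by rewrite !mul0r.
have [Qy|nQy] := boolP (y \in cset Q); last by rewrite indicE (negbTE nQy) mulr0 !mulr0 !mul0r.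
have : dilate 3 Q x.
  apply: (@edist_triple _ _ Q y x); first by rewrite in_setE in Qy.
  rewrite edistC (lt_le_trans (kern_near k0))// eQ scale_dyad /= pow2_le//.
  by rewrite ge_min lexx.
by move=> Qx; rewrite [\1_(dilate 3 Q) x]indicE mem_set// mulr1.
Qed.

Context (r p1 p2 : R) (r1 : 1 < r) (p1_ge1 : 1 <= p1) (p2_ge1 : 1 <= p2).
Context (Kdef : trunc_defined r%:E p1%:E p2%:E Ks) (CT_fin : (C_T r%:E Ks < +oo)%E).

Let p1_gt0 : 0 < p1. Proof. exact: lt_le_trans p1_ge1. Qed.

Let p2_gt0 : 0 < p2. Proof. exact: lt_le_trans p2_ge1. Qed.

Lemma integrable_admissible m n f g : admissible p1 f -> admissible p2 g ->
  cintegrable mu2 setT (trunc_integrand Ks m n f g).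
Proof.
move=> [f1 f2] [g1 g2]; have [nm|mn] := leP n m.
  rewrite (_ : trunc_integrand _ _ _ _ _ = fun=> 0); first exact: cintegrable0.
  by apply/funext => z; rewrite trunc_integrandE kern_empty// !mul0r.
by apply: Kdef => //; right; split => //; exact: compact_supp.
Qed.

Lemma truncDl m n f f' g : admissible p1 f -> admissible p1 f' -> admissible p2 g ->
  trunc Ks m n (fun x => f x + f' x) g = trunc Ks m n f g + trunc Ks m n f' g.
Proof.
move=> af af' ag; rewrite /trunc -cintegralD//; [|exact: integrable_admissible..].
by congr cintegral; apply/funext => z; rewrite !trunc_integrandE mulrDr mulrDl.
Qed.

Lemma truncDr m n f g g' : admissible p1 f -> admissible p2 g -> admissible p2 g' ->
  trunc Ks m n f (fun x => g x + g' x) = trunc Ks m n f g + trunc Ks m n f g'.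
Proof.
move=> af ag ag'; rewrite /trunc -cintegralD//; [|exact: integrable_admissible..].
by congr cintegral; apply/funext => z; rewrite !trunc_integrandE rmorphD mulrDr.
Qed.

Lemma hoelder_conjugate_real : hoelder_conjugate r%:E = (r / (r - 1))%:E.
Proof.
rewrite /hoelder_conjugate/= gt_eqF ?lte_fin ?(lt_trans ltr01)//.
by rewrite inver subr_eq0 gt_eqF.
Qed.

Let r' : R := r / (r - 1).

Let r_gt0 : 0 < r. Proof. exact: lt_trans r1. Qed.

Let r'_gt0 : 0 < r'. Proof. by rewrite /r' divr_gt0// subr_gt0. Qed.

Let rr' : r^-1 + r'^-1 = 1.
Proof.
by rewrite /r' invf_div -{1}[r^-1]mul1r -mulrDl addrC subrK mulfV// gt_eqF.
Qed.

Definition CT : R := fine (C_T r%:E Ks).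

Lemma trunc_le_CT m n f g : inLp mu r%:E f -> inLp mu r'%:E g ->
  (cnorm mu r%:E f <= 1)%E -> (cnorm mu r'%:E g <= 1)%E -> (m < n)%R ->
  ((normc (trunc Ks m n f g))%:E <= C_T r%:E Ks)%E.
Proof.
move=> f1 g1 f2 g2 mn; apply: (@le_trans _ _ (trunc_norm r%:E Ks m n)).
  apply: ereal_sup_ubound; exists f, g; rewrite hoelder_conjugate_real; split => //.
by apply: ereal_sup_ubound; exists (m, n).
Qed.

Lemma CT_ge0E : (0 <= C_T r%:E Ks)%E.
Proof.
have := @trunc_le_CT 0 1 (fun=> 0) (fun=> 0) (inLp0 _ r_gt0) (inLp0 _ r'_gt0).
rewrite !cnorm0// => /(_ lee01 lee01 isT); apply: le_trans.
by rewrite lee_fin normc_ge0.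
Qed.

Lemma CT_E : C_T r%:E Ks = CT%:E.
Proof. by rewrite /CT fineK// ge0_fin_numE// CT_ge0E. Qed.

Lemma CT_ge0 : 0 <= CT.
Proof. by rewrite -lee_fin -CT_E CT_ge0E. Qed.

(** Normalize f and g in the spaces in which C_T bounds the form. *)
Lemma trunc_bounded_gt0 m n f g (A B : cube R d) (F G : R) : 0 < F -> 0 < G ->
  cmeasurable setT f -> cmeasurable setT g ->
  {ae mu, forall x, normc (f x) <= F} -> {ae mu, forall x, normc (g x) <= G} ->
  vanishes_off f (cset A) -> vanishes_off g (cset B) ->
  normc (trunc Ks m n f g) <= CT * (F * vol A `^ r^-1) * (G * vol B `^ r'^-1).
Proof.
move=> F0 G0 mf mg fF gG fA gB.
have [nm|mn] := leP n m.
  by rewrite trunc_empty// normc0 !mulr_ge0 ?CT_ge0 ?powR_ge0// ltW.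
have scaled p c h Q : 0 < p -> 0 < c -> cmeasurable setT h ->
    {ae mu, forall x, normc (h x) <= c} -> vanishes_off h (cset Q) ->
    let a := (c * vol Q `^ p^-1)^-1 in
    inLp mu p%:E (fun x => a%:C * h x) /\ (cnorm mu p%:E (fun x => (a%:C * h x)%R) <= 1)%E.
  move=> p0 c0 mh hc hQ a; have v0 := vol_gt0 Q.
  have a0 : 0 < a by rewrite invr_gt0 mulr_gt0// powR_gt0.
  have mah : cmeasurable setT (fun x => a%:C * h x).
    by apply: cmeasurableM => //; exact: cmeasurable_cst.
  have hac : {ae mu, forall x, normc (a%:C * h x) <= a * c}.
    by apply: filterS hc => x hx; rewrite normcM normc_real gtr0_norm// ler_pM2l.
  have haQ : vanishes_off (fun x => a%:C * h x) (cset Q) by move=> x nx; rewrite hQ// mulr0.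
  have ac0 : 0 <= a * c by rewrite mulr_ge0 ?ltW.
  have := powint_bounded p0 ac0 mah hac haQ.
  have -> : (a * c) `^ p * vol Q = 1.
    have -> : a * c = (vol Q `^ p^-1)^-1.
      by rewrite /a invfM mulrAC mulVf ?gt_eqF// mul1r.
    rewrite -powRN -powRrM mulNr mulVf ?gt_eqF// powRN powRr1 ?(ltW v0)//.
    by rewrite mulVf// gt_eqF.
  move=> hp; split; last by rewrite cnormP// powR1.
  by apply: (inLpP _ p0).2; split => //; exact: le_lt_trans hp (ltry _).
have [af nf] := scaled _ _ _ _ r_gt0 F0 mf fF fA.
have [ag ng] := scaled _ _ _ _ r'_gt0 G0 mg gG gB.
move: af nf ag ng.
set a := (F * _)^-1; set b := (G * _)^-1 => af nf ag ng.
have a0 : 0 < F * vol A `^ r^-1 by rewrite mulr_gt0// powR_gt0// vol_gt0.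
have b0 : 0 < G * vol B `^ r'^-1 by rewrite mulr_gt0// powR_gt0// vol_gt0.
have fr : inLp mu r%:E f.
  apply: (inLpP _ r_gt0).2; split => //.
  exact: le_lt_trans (powint_bounded r_gt0 (ltW F0) mf fF fA) (ltry _).
have gr : inLp mu r'%:E g.
  apply: (inLpP _ r'_gt0).2; split => //.
  exact: le_lt_trans (powint_bounded r'_gt0 (ltW G0) mg gG gB) (ltry _).
have ifg : cintegrable mu2 setT (trunc_integrand Ks m n f g).
  by apply: Kdef => //; left; rewrite hoelder_conjugate_real.
have := trunc_le_CT af ag nf ng mn; rewrite CT_E lee_fin.
have -> : trunc Ks m n (fun x => a%:C * f x) (fun x => b%:C * g x) =
    (a * b)%:C * trunc Ks m n f g.
  rewrite /trunc -cintegralZ//; congr cintegral; apply/funext => z.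
  have ab : (a * b)%:C = a%:C * b%:C :> R[i] by exact: rmorphM.
  have key (k u v : R[i]) : k * (a%:C * u) * conjc (b%:C * v) = (a * b)%:C * (k * u * conjc v).
    have -> : conjc (b%:C * v) = conjc (b%:C : R[i]) * conjc v by exact: rmorphM.
    by rewrite conjc_real ab; ring.
  exact: key.
rewrite normcM normc_real gtr0_norm ?mulr_gt0 ?invr_gt0// /a /b -invfM.
rewrite ler_pdivrMl; last exact: mulr_gt0.
move=> h; rewrite (le_trans h)// le_eqVlt; apply/orP; left; apply/eqP; ring.
Qed.

(** The powers 1/r and 1/r' of the volumes multiply to the volume. Zero bounds are
    approached by positive ones. *)
Lemma trunc_bounded m n f g (L : cube R d) (F G : R) : 0 <= F -> 0 <= G ->
  cmeasurable setT f -> cmeasurable setT g ->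
  {ae mu, forall x, normc (f x) <= F} -> {ae mu, forall x, normc (g x) <= G} ->
  vanishes_off f (cset L) -> vanishes_off g (dilate 3 L) ->
  normc (trunc Ks m n f g) <= CT * 3 ^+ d * vol L * F * G.
Proof.
move=> F0 G0 mf mg fF gG fL gL; have c30 : 0 < 3 :> R by [].
have gL' : vanishes_off g (cset (dil c30 L)) by rewrite cset_dil.
have v0 := vol_gt0 L; have e1 : 1 <= 3 ^+ d :> R by rewrite exprn_ege1// ler1n.
have main e : 0 < e -> normc (trunc Ks m n f g) <= CT * 3 ^+ d * vol L * (F + e) * (G + e).
  move=> e0; have Fe : 0 < F + e by rewrite ltr_wpDl.
  have Ge : 0 < G + e by rewrite ltr_wpDl.
  apply: (le_trans (@trunc_bounded_gt0 m n f g L (dil c30 L) (F + e) (G + e) Fe Ge mf mg _ _ fL gL')).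
  - by apply: filterS fF => x /le_trans; apply; rewrite lerDl ltW.
  - by apply: filterS gG => x /le_trans; apply; rewrite lerDl ltW.
  rewrite vol_dil powRM ?exprn_ge0 ?(ltW v0)//.
  rewrite (_ : CT * 3 ^+ d * vol L * (F + e) * (G + e) =
     CT * (F + e) * (G + e) * (3 ^+ d * vol L)); last by ring.
  rewrite (_ : CT * _ * _ = CT * (F + e) * (G + e) *
     ((3 ^+ d) `^ r'^-1 * (vol L `^ r^-1 * vol L `^ r'^-1))); last by ring.
  rewrite ler_wpM2l ?mulr_ge0 ?CT_ge0 ?(ltW Fe) ?(ltW Ge)//.
  rewrite -powRD ?rr' ?oner_eq0// powRr1 ?(ltW v0)// ler_wpM2r ?(ltW v0)//.
  rewrite -[leRHS]powRr1 ?exprn_ge0// ler_powR//.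
  by rewrite -rr' lerDr invr_ge0 ltW.
apply/ler_addgt0Pr => e e0; set C := CT * 3 ^+ d * vol L.
have C0 : 0 <= C by rewrite !mulr_ge0 ?CT_ge0 ?exprn_ge0 ?(ltW v0).
pose t := e / ((C + 1) * (F + G + 1) + e).
have D0 : 0 < (C + 1) * (F + G + 1) + e by rewrite ltr_wpDl// mulr_ge0//; lra.
have t0 : 0 < t by rewrite divr_gt0.
have t1 : t <= 1.
  rewrite ler_pdivrMr// mul1r lerDr mulr_ge0//; lra.
apply: (le_trans (main t t0)); rewrite -/C.
have : t * ((C + 1) * (F + G + 1)) <= e.
  rewrite /t mulrAC ler_pdivrMr// ler_wpM2l ?(ltW e0)// lerDl ltW//.
have h1 : 0 <= C * t by rewrite mulr_ge0// ltW.
have : C * t * t <= C * t by rewrite ler_piMr.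
have h2 : 0 <= t * (F + G + 1) by rewrite mulr_ge0 ?(ltW t0)//; lra.
nra.
Qed.

Lemma local_form_bounded Q m n f g (F G : R) : grid Q -> 0 <= F -> 0 <= G ->
  cmeasurable setT f -> cmeasurable setT g ->
  {ae mu, forall x, normc (f x) <= F} -> {ae mu, forall x, normc (g x) <= G} ->
  normc (local_form Ks Q m n f g) <= CT * 3 ^+ d * vol Q * F * G.
Proof.
move=> gQ F0 G0 mf mg fF gG; rewrite local_formE//.
have ind (A : set (RR R d)) h x c : normc (h x) <= c -> normc (h x * \1_A x) <= c.
  move=> hc; rewrite normcM normc_indic indicE.
  by case: (_ \in _); rewrite ?mulr1 ?mulr0// (le_trans (normc_ge0 _) hc).
apply: trunc_bounded => //.
- by apply: cmeasurableM => //; apply: cmeasurable_indic; exact: measurable_cset.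
- by apply: cmeasurableM => //; apply: cmeasurable_indic; exact: measurable_dilate.
- by apply: filterS fF => x; exact: ind.
- by apply: filterS gG => x; exact: ind.
- by move=> x nx; rewrite indicE memNset// mulr0.
- by move=> x nx; rewrite indicE memNset// mulr0.
Qed.

Lemma local_formDl Q m n f f' g : admissible p1 f -> admissible p1 f' -> admissible p2 g ->
  local_form Ks Q m n (fun x => f x + f' x) g =
  local_form Ks Q m n f g + local_form Ks Q m n f' g.
Proof.
move=> af af' ag; have mQ := measurable_cset Q; rewrite /local_form -truncDl//; last 2 first.
- exact: admissible_indic.
- exact: admissible_indic.
by apply: eq_trunc => x y; rewrite mulrDl.
Qed.

Lemma local_formDr Q m n f g g' : admissible p1 f -> admissible p2 g -> admissible p2 g' ->
  local_form Ks Q m n f (fun x => g x + g' x) =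
  local_form Ks Q m n f g + local_form Ks Q m n f g'.
Proof.
move=> af ag ag'; have mQ := measurable_cset Q; rewrite /local_form -truncDr//.
exact: admissible_indic.
Qed.

(** Each local form is bounded by the volume of its cube, and the volumes of the
    children of Q add up to at most that of Q. *)
Lemma stopping_form_bounded Q Qs m n f g (F G : R) : grid Q -> Qs `<=` grid ->
  trivIset Qs (@cset R d) -> 0 <= F -> 0 <= G ->
  cmeasurable setT f -> cmeasurable setT g ->
  {ae mu, forall x, normc (f x) <= F} -> {ae mu, forall x, normc (g x) <= G} ->
  normc (stopping_form Ks Q Qs m n f g) <= 2 * (CT * 3 ^+ d * vol Q * F * G).
Proof.
move=> gQ Qg tQ F0 G0 mf mg fF gG; rewrite stopping_formE.
have fX := finite_big_children Q m Qg tQ; set X := big_children _ _ _ in fX *.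
rewrite (le_trans (le_normcD _ _))// normcN mulr2n mulrDl !mul1r lerD//.
  exact: local_form_bounded.
rewrite fsbig_finite//= (le_trans (normc_sum _ _))//.
apply: (@le_trans _ _ (\sum_(L <- fset_set X) CT * 3 ^+ d * F * G * vol L)).
  rewrite !big_seq; apply: ler_sum => L; rewrite in_fset_set// in_setE => -[QL _ _].
  rewrite (le_trans (local_form_bounded m n (Qg _ QL) F0 G0 mf mg fF gG))//.
  by rewrite le_eqVlt; apply/orP; left; apply/eqP; ring.
rewrite -mulr_sumr (_ : CT * 3 ^+ d * vol Q * F * G = CT * 3 ^+ d * F * G * vol Q); last by ring.
rewrite ler_wpM2l ?mulr_ge0 ?CT_ge0 ?exprn_ge0//.
rewrite -[leLHS](fsbig_finite _ _ fX); apply: sum_vol_le => //; last by move=> L [].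
by apply: sub_trivIset tQ => L [].
Qed.

Lemma stopping_formD Q Qs m n f g f1 g1 f2 g2 : Qs `<=` grid -> trivIset Qs (@cset R d) ->
  (forall L, local_form Ks L m n f g = local_form Ks L m n f1 g1 + local_form Ks L m n f2 g2) ->
  stopping_form Ks Q Qs m n f g =
  stopping_form Ks Q Qs m n f1 g1 + stopping_form Ks Q Qs m n f2 g2.
Proof.
move=> Qg tQ e; have fX := finite_big_children Q m Qg tQ.
rewrite !stopping_formE !fsbig_finite//= e; under eq_bigr do rewrite e.
by rewrite big_split /= opprD addrACA.
Qed.

(** Write h1 = b1 + g1 and h2 = b2 + g2 with mean-zero parts b1, b2 and bounded
    parts g1, g2. The first local bound controls the pair (b1, h2), the second one
    (g1, b2), and the truncation bound (g1, g2). *)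
Lemma stopping_estimate (d0 : (0 < d)%N) (C : R) m n k x0 Qs h1 h2 (l1 l2 : R) :
  local_bound1 p1%:E p2%:E C Ks -> local_bound2 p2%:E C Ks -> 0 <= C ->
  stopping_collection grid (dyad k x0) Qs -> 0 <= l1 -> 0 <= l2 ->
  inLp mu p1%:E h1 -> vanishes_off h1 (dilate 3 (dyad k x0)) ->
  (Ynorm p1%:E Qs h1 <= l1%:E)%E ->
  inLp mu p2%:E h2 -> vanishes_off h2 (dilate 3 (dyad k x0)) ->
  (Ynorm p2%:E Qs h2 <= l2%:E)%E ->
  normc (stopping_form Ks (dyad k x0) Qs m n h1 h2) <=
    2 ^+ (20 * d) * (CT + C) * vol (dyad k x0) * l1 * l2.
Proof.
move=> B1 B2 C0 stQ l10 l20 h1p h1v Y1 h2p h2v Y2; set Q := dyad k x0 in stQ h1v h2v *.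
have gQ : grid Q by exists k, x0.
have [[Qg tQ] QQ _ _] := stQ.
have [b1 [g1 [e1 X1 Yb1 [mg1 bg1 vg1]]]] := cz_decomposition p1_ge1 l10 Qg tQ QQ h1p h1v Y1.
have [b2 [g2 [e2 X2 Yb2 [mg2 bg2 vg2]]]] := cz_decomposition p2_ge1 l20 Qg tQ QQ h2p h2v Y2.
have v0 := vol_gt0 Q; set E := 32 ^+ d in Yb1 Yb2 bg1 bg2.
have E1 : 1 <= E by rewrite exprn_ege1// ler1n.
have E0 : 0 <= E by rewrite (le_trans ler01).
have G10 : 0 <= 4 * E * l1 by rewrite !mulr_ge0.
have G20 : 0 <= 4 * E * l2 by rewrite !mulr_ge0.
have ab1 : admissible p1 b1.
  have [[bp bv _] _] := X1; split; first exact: bp.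
  exact: bounded_support_dilate (ltr0n R 3) bv.
have ab2 : admissible p2 b2.
  have [[bp bv _] _] := X2; split; first exact: bp.
  exact: bounded_support_dilate (ltr0n R 3) bv.
have ag1 : admissible p1 g1 by exact: (admissible_bounded p1_gt0 (ltr0n R 3) G10 mg1 bg1 vg1).
have ag2 : admissible p2 g2 by exact: (admissible_bounded p2_gt0 (ltr0n R 3) G20 mg2 bg2 vg2).
have -> : h1 = fun x => b1 x + g1 x by apply/funext.
have h2E : h2 = fun x => b2 x + g2 x by apply/funext.
have ah2 : admissible p2 h2 by rewrite h2E; exact: admissibleD.
rewrite (@stopping_formD _ _ _ _ _ h2 b1 h2 g1 h2)//; last by move=> L; exact: local_formDl.
rewrite [in X in normc (_ + X)]h2E (@stopping_formD _ _ _ _ g1 _ g1 b2 g1 g2)//; last first.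
  by move=> L; exact: local_formDr.
have T1 : normc (stopping_form Ks Q Qs m n b1 h2) <= C * vol Q * (20 * E * l1) * l2.
  have Yh2 : Yspace p2%:E Q Qs h2 by split => //; exact: le_lt_trans Y2 (ltry _).
  have := B1 m n grid Q Qs b1 h2 (@dyadic_lattice_grid R d) gQ stQ X1 Yh2.
  rewrite -lee_fin => /le_trans; apply; rewrite lebesgue_vol -EFinM !EFinM.
  by apply: lee_pmul; rewrite ?Ynorm_ge0 ?mule_ge0 ?lee_fin ?(ltW v0)//;
     rewrite ?Ynorm_ge0//; apply: lee_pmul; rewrite ?Ynorm_ge0 ?mule_ge0 ?lee_fin ?(ltW v0).
have T2 : normc (stopping_form Ks Q Qs m n g1 b2) <= C * vol Q * (4 * E * l1) * (20 * E * l2).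
  have Yg1 : (Ynorm +oo%E Qs g1 <= (4 * E * l1)%:E)%E.
    by rewrite /Ynorm eqxx; apply/cnormyP.
  have Yh1 : Yspace +oo%E Q Qs g1.
    split => //; last exact: le_lt_trans Yg1 (ltry _).
    by split => //; apply: le_lt_trans (ltry (4 * E * l1)); apply/cnormyP.
  have := B2 m n grid Q Qs g1 b2 (@dyadic_lattice_grid R d) gQ stQ Yh1 X2.
  rewrite -lee_fin => /le_trans; apply; rewrite lebesgue_vol -EFinM !EFinM.
  by apply: lee_pmul; rewrite ?Ynorm_ge0 ?mule_ge0 ?lee_fin ?(ltW v0)//;
     rewrite ?Ynorm_ge0//; apply: lee_pmul; rewrite ?Ynorm_ge0 ?mule_ge0 ?lee_fin ?(ltW v0).
have T3 := stopping_form_bounded m n gQ Qg tQ G10 G20 mg1 mg2 bg1 bg2.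
rewrite (le_trans (le_normcD _ _))// (le_trans (lerD (lexx _) (le_normcD _ _)))//.
apply: (le_trans (lerD T1 (lerD T2 T3))).
have T0 : 0 <= 3 ^+ d :> R by rewrite exprn_ge0.
have T01 : 1 <= 3 ^+ d :> R by rewrite exprn_ege1// ler1n.
(* 132 = 20 + 80 + 32 adds the numerical factors of the three terms. *)
have num : 132 * (E * E * 3 ^+ d) <= 2 ^+ (20 * d) :> R.
  rewrite /E -!exprMn exprM; apply: (@le_trans _ _ (132 ^+ d * (32 * 32 * 3) ^+ d)).
    by rewrite ler_wpM2r ?exprn_ge0// ler_eXnr// ler1n.
  rewrite -exprMn lerXn2r ?nnegrE ?exprn_ge0//; last by rewrite !exprS expr0; lra.
have V0 : 0 <= (CT + C) * vol Q * l1 * l2 by rewrite !mulr_ge0 ?addr_ge0 ?CT_ge0 ?(ltW v0).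
rewrite (_ : 2 ^+ (20 * d) * _ * _ * _ * _ = 2 ^+ (20 * d) * ((CT + C) * vol Q * l1 * l2)); last by ring.
apply: le_trans (ler_wpM2r V0 num).
have U : 0 <= vol Q * l1 * l2 by rewrite !mulr_ge0 ?(ltW v0).
have UC : 0 <= C * (vol Q * l1 * l2) by rewrite mulr_ge0.
have UT : 0 <= CT * (vol Q * l1 * l2) by rewrite mulr_ge0 ?CT_ge0.
set W := vol Q * l1 * l2 in U UC UT.
have EE : E <= E * E by rewrite ler_peMr.
have EE3 : E * E <= E * E * 3 ^+ d by rewrite ler_peMr// mulr_ge0.
have H1 : C * W * E <= C * W * (E * E * 3 ^+ d) by rewrite ler_wpM2l// (le_trans EE).
have H2 : C * W * (E * E) <= C * W * (E * E * 3 ^+ d) by rewrite ler_wpM2l.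
have H3 : 0 <= CT * W * (E * E * 3 ^+ d) by rewrite !mulr_ge0 ?CT_ge0// ltW.
have H4 : 0 <= C * W * (E * E * 3 ^+ d) by rewrite !mulr_ge0// ltW.
rewrite (_ : C * vol Q * (20 * E * l1) * l2 + _ = 20 * (C * W * E) + 80 * (C * W * (E * E)) +
  32 * (CT * W * (E * E * 3 ^+ d))); last by rewrite /W; ring.
rewrite (_ : 132 * _ * _ = 132 * (C * W * (E * E * 3 ^+ d)) + 132 * (CT * W * (E * E * 3 ^+ d)));
  last by rewrite /W; ring.
lra.
Qed.

End truncated_forms.

(** * Exceptional sets *)

Section exceptional_sets.
Context (R : realType) (d : nat) (d0 : (0 < d)%N).
Implicit Types (Q L : cube R d) (h : RR R d -> R[i]) (p : R).
Local Notation mu := (lebesgue R d).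
Local Notation grid := (@grid R d).

(** The threshold is lowered by the factor 4^d of [large_average_bad]. *)
Definition exceptional p h (lam : R) : set (RR R d) :=
  bad_set (fun x => (normc (h x) `^ p)%:E) (lam `^ p / 4 ^+ d).

Lemma measurable_exceptional p h lam : measurable (exceptional p h lam).
Proof. exact: measurable_bad_set. Qed.

Lemma dyadically_open_exceptional p h lam : dyadically_open (exceptional p h lam).
Proof. exact: dyadically_open_bad_set. Qed.

Lemma maximal_off_exceptional p h lam z : 1 <= p -> 0 <= lam -> cmeasurable setT h ->
  ~ exceptional p h lam z -> (maximal p%:E h z <= lam%:E)%E.
Proof.
move=> p1 l0 mh nE; have p0 : 0 < p by rewrite (lt_le_trans ltr01).
apply: ge_ereal_sup => _ [Q Qz <-]; rewrite avg_normP// leNgt; apply/negP => H.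
apply: nE; apply: (@large_average_bad R d _ (lam `^ p) Q z) => //.
- by move=> x; rewrite lee_fin powR_ge0.
- exact: measurable_pow_normc.
- exact: powR_ge0.
Qed.

Lemma ae_le_off_exceptional p h lam : 1 <= p -> 0 <= lam -> cmeasurable setT h ->
  {ae mu, forall x, ~ exceptional p h lam x -> normc (h x) <= lam}.
Proof.
move=> p1 l0 mh; have p0 : 0 < p by rewrite (lt_le_trans ltr01).
have t0 : 0 <= lam `^ p / 4 ^+ d by rewrite divr_ge0 ?powR_ge0 ?exprn_ge0.
have := @ae_le_off_bad_set R d (fun x => normc (h x) `^ p) _ (fun x => powR_ge0 _ _) _ t0.
move=> H; have {H} := H (measurableT_comp (measurable_powR p) (measurable_normc mh)).
apply: filterS => x H /H hx.
have : normc (h x) `^ p <= lam `^ p.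
  rewrite (le_trans hx)// ler_pdivrMr ?exprn_gt0// ler_peMr ?powR_ge0//.
  by rewrite exprn_ege1// ler1n.
by rewrite -powR_inv_le ?powR_ge0// -powRrM mulfV ?gt_eqF// powRr1 ?normc_ge0.
Qed.

(** By the weak-type inequality for |h|^p. The factor N^(1/p) in the threshold makes
    room for N such sets in a set of given measure. *)
Lemma exceptional_small p h (a V A N : R) : 1 <= p -> 0 <= a -> 0 <= V -> 1 <= A -> 0 < N ->
  cmeasurable setT h -> (powint p h setT <= (a `^ p * V)%:E)%E ->
  (mu (exceptional p h (A * N `^ p^-1 * a)) <= (20 ^+ d * V / (A * N))%:E)%E.
Proof.
move=> p1 a0 V0 A1 N0 mh hp; have p0 : 0 < p by rewrite (lt_le_trans ltr01).
have A0 : 0 < A by rewrite (lt_le_trans ltr01).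
have B0 : 0 <= 20 ^+ d * V / (A * N).
  by rewrite divr_ge0 ?mulr_ge0 ?exprn_ge0 ?(ltW A0) ?(ltW N0).
have mp : measurable_fun setT (fun x => (normc (h x) `^ p)%:E) by exact: measurable_pow_normc.
have [a00|an0] := eqVneq a 0.
  rewrite (_ : exceptional _ _ _ = set0) ?measure0//.
  apply/seteqP; split => // x [P [_ bP] _]; move: bP.
  rewrite a00 mulr0 powR0 ?gt_eqF// !mul0r ltNge => /negP; apply.
  apply: (@le_trans _ _ (powint p h setT)).
    apply: ge0_subset_integral => //; first exact: measurable_cset.
    by move=> y _; rewrite lee_fin powR_ge0.
  by apply: le_trans hp _; rewrite a00 powR0 ?gt_eqF// mul0r.
have a_gt0 : 0 < a by rewrite lt_neqAle eq_sym an0.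
have l0 : 0 < A * N `^ p^-1 * a by rewrite !mulr_gt0// powR_gt0.
have lp0 := powR_gt0 p l0.
have F0 (x : RR R d) : (0 <= (normc (h x) `^ p)%:E)%E by rewrite lee_fin powR_ge0.
have Foo : (\int[mu]_x (normc (h x) `^ p)%:E < +oo)%E by exact: le_lt_trans hp (ltry _).
have t0 : 0 < (A * N `^ p^-1 * a) `^ p / 4 ^+ d by rewrite divr_gt0// exprn_gt0.
apply: (le_trans (weak_type d0 t0 F0 mp Foo)).
apply: (@le_trans _ _ ((5 ^+ d / ((A * N `^ p^-1 * a) `^ p / 4 ^+ d))%:E * (a `^ p * V)%:E)%E).
  by rewrite lee_wpmul2l// lee_fin divr_ge0 ?exprn_ge0 ?(ltW t0).
rewrite -EFinM lee_fin invf_div.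
have -> : (A * N `^ p^-1 * a) `^ p = A `^ p * N * a `^ p.
  rewrite !powRM ?mulr_ge0 ?powR_ge0 ?(ltW A0) ?(ltW a_gt0)//.
  by rewrite -powRrM mulVf ?gt_eqF// powRr1 ?(ltW N0).
have ap0 := powR_gt0 p a_gt0; have Ap0 := powR_gt0 p A0.
have -> : 5 ^+ d * (4 ^+ d / (A `^ p * N * a `^ p)) * (a `^ p * V) =
    20 ^+ d * V / (A `^ p * N).
  rewrite (_ : 20 = 5 * 4); last by ring.
  by rewrite exprMn; field; rewrite !gt_eqF.
rewrite ler_wpM2l ?mulr_ge0 ?exprn_ge0// lef_pV2 ?posrE ?mulr_gt0// ler_pM2r//.
by rewrite -[leLHS]powRr1 ?(ltW A0)// ler_powR.
Qed.

(** A point of 3Q off the Whitney cubes is off E, where h is at most lam; and near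
    every Whitney cube there is a point off E, where the maximal function is at most
    lam. E may be larger than the exceptional set of h, which allows one collection
    to serve several functions. *)
Lemma Ynorm_whitney p k x0 (E : set (RR R d)) h lam : 1 <= p -> 0 <= lam ->
  dyadically_open E -> measurable E -> (mu E <= (2^-1 ^+ d * vol (dyad k x0))%:E)%E ->
  cmeasurable setT h -> vanishes_off h (dilate 3 (dyad k x0)) ->
  exceptional p h lam `<=` E ->
  (Ynorm p%:E (whitney (dyad k x0) E) h <= lam%:E)%E.
Proof.
move=> p1 l0 oE mE sE mh hv hE; apply/Ynorm_le => //; split.
  apply: filterS (ae_le_off_exceptional p1 l0 mh) => x hx.
  rewrite normcM normc_indic indicE; case: (boolP (x \in _)) => [|_]; last by rewrite mulr0.
  rewrite in_setE mulr1 => nx.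
  case: (pselect (dilate 3 (dyad k x0) x)) => [Qx|nQ]; last by rewrite hv// normc0.
  by apply: hx => /hE Ex; apply: nx; exact: (whitney_cover d0 oE mE sE).
move=> L WL; have [z Lz nz] := whitney_exit WL.
apply: (@le_trans _ _ (maximal p%:E h z)); first by apply: ereal_inf_lbound; exists z.
by apply: maximal_off_exceptional => // /hE.
Qed.

(** The constant is tested on a function with positive finite norms: the difference
    of the indicators of two children of a Whitney cube. *)
Lemma constant_ge0 p1 p2 C Ks : 1 <= p1 -> 1 <= p2 ->
  @local_bound1 R d p1%:E p2%:E C Ks -> 0 <= C.
Proof.
move=> p1_ge1 p2_ge1 B1; pose o : RR R d := [tuple 0 | i < d].
pose Q := dyad 0 o; pose E := halo (dyad (- 4) o).
have vQ : vol Q = 1 by rewrite volE /= expr0z expr1n.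
have oE : dyadically_open E by move=> x; exact: halo_open.
have mE : measurable E by exact: measurable_open_box.
(* E is in a cube of side 5/16 < 1/2. *)
have sE : (mu E <= (2^-1 ^+ d * vol Q)%:E)%E.
  apply: (@le_trans _ _ (mu (dilate 5 (dyad (- 4) o)))).
    by apply: le_measure; rewrite ?in_setE//; [exact: measurable_dilate|exact: halo_dilate].
  rewrite lebesgue_dilate// lee_fin vQ mulr1 volE -exprMn lerXn2r ?nnegrE//.
    by rewrite mulr_ge0// ltW// side_gt0.
  by rewrite /= -invr_expz pow2_nat !exprS expr0; lra.
have Eo : E o by apply: cset_halo; exact: mem_dyad.
have Qo : dilate 3 Q o.
  have /(@dilateS _ _ 1 3) : 0 < 1 :> R by [].
  by apply; [rewrite ler1n|rewrite dilate1; exact: mem_dyad].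
have [L WL _] := whitney_cover d0 oE mE sE Eo Qo.
have stQ := stopping_whitney d0 oE mE sE; set W := whitney Q E in WL stQ.
have [[Wg tW] W3 _ _] := stQ.
have [k [x [eL _ _ _]]] := WL.
pose y : RR R d := [tuple tnth (corner L) i + 3 / 4 * side L | i < d].
pose c1 := dyad (k - 1) (corner L); pose c2 := dyad (k - 1) y.
have kk : (k - 1 <= k)%R by lia.
have Ly : cset L y.
  by move=> i; rewrite tnth_mktuple; have s0 := side_gt0 L; apply/andP; split; lra.
have c1L : cset c1 `<=` cset L.
  rewrite (_ : L = dyad k (corner L)); first exact: dyadS.
  by rewrite {1}eL; apply/esym/dyad_eq; rewrite -eL; exact: corner_cset.
have c2L : cset c2 `<=` cset L.
  rewrite (_ : L = dyad k y); first exact: dyadS.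
  by rewrite {1}eL; apply/esym/dyad_eq; rewrite -eL.
have c12 z : cset c1 z -> cset c2 z -> False.
  move=> z1 z2; have i : 'I_d := Ordinal d0.
  have e : c1 = c2 by rewrite /c1 /c2 -(dyad_eq z1) (dyad_eq z2).
  have /andP[_ h1] : tnth (corner c1) i <= tnth y i < tnth (corner c1) i + side c1.
    by rewrite e; exact: mem_dyad.
  have /andP[h2 _] : tnth (corner c1) i <= tnth (corner L) i < tnth (corner c1) i + side c1.
    exact: mem_dyad.
  have sL : side L = 2 * side c1 by rewrite eL /= -[in LHS](subrK 1 k) pow2S mulrC.
  by move: h1; rewrite tnth_mktuple sL; have := side_gt0 c1; lra.
have vc : vol c1 = vol c2 by rewrite !volE.
have mc1 := measurable_cset c1; have mc2 := measurable_cset c2; have mL := measurable_cset L.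
pose b z : R[i] := \1_(cset c1) z + (-1) * \1_(cset c2) z.
have mb : cmeasurable setT b.
  apply: cmeasurableD; first exact: cmeasurable_indic.
  by apply: cmeasurableM; [exact: cmeasurable_cst|exact: cmeasurable_indic].
have b1 z : normc (b z) <= 1.
  rewrite /b !indicE; case: (boolP (z \in cset c1)) => [z1|_]; case: (boolP (z \in cset c2)) => [z2|_].
  - by rewrite !in_setE in z1 z2; case: (c12 z z1 z2).
  - by rewrite mulr0 addr0 normc1.
  - by rewrite mulr1 add0r normcN normc1.
  - by rewrite mulr0 addr0 normc0.
have bc1 z : cset c1 z -> b z = 1.
  move=> z1; rewrite /b !indicE mem_set// memNset ?mulr0 ?addr0// => z2; exact: c12 z1 z2.
have bv : vanishes_off b (cset L).
  move=> z nz; rewrite /b !indicE !memNset ?mulr0 ?addr0// => hz; apply: nz; [exact: c2L|exact: c1L].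
have bv3 : vanishes_off b (dilate 3 Q) by move=> z nz; apply: bv => /(W3 L WL).
have bint : cintegral mu (cset L) b = 0.
  have ind (c : cube R d) : cset c `<=` cset L ->
      cintegrable mu (cset L) (fun z => \1_(cset c) z : R[i]) /\
      cintegral mu (cset L) (fun z => \1_(cset c) z) = (vol c)%:C.
    move=> cL; have mc := measurable_cset c; split.
      apply: cintegrableP => //; first exact: cmeasurable_indic.
      under eq_integral do rewrite normc_indic.
      rewrite integral_indic// (@le_lt_trans _ _ (mu (cset L)))//; first exact: measureIr.
      by rewrite lebesgue_vol ltry.
    rewrite /cintegral; congr (_ +i* _).
      under eq_Rintegral do rewrite Re_indic.
      by rewrite /Rintegral integral_indic// setIidl.
    under eq_Rintegral do rewrite Im_indic.
    by rewrite /Rintegral integral0.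
  have [i1 e1] := ind _ c1L; have [i2 e2] := ind _ c2L.
  rewrite /b cintegralD//; last exact: cintegrableZ.
  by rewrite cintegralZ// e1 e2 vc mulN1r subrr.
have Xb p : 1 <= p -> [/\ X0space p%:E Q W b, (0 < Ynorm p%:E W b)%E & (Ynorm p%:E W b < +oo)%E].
  move=> pge1; have p0 : 0 < p by rewrite (lt_le_trans ltr01).
  have Yb : (Ynorm p%:E W b <= 1%:E)%E.
    apply/Ynorm_le => //; split.
      apply: aeW => z; rewrite normcM normc_indic indicE.
      by case: (_ \in _); rewrite ?mulr1 ?mulr0.
    move=> L' _; apply: (@le_trans _ _ (maximal p%:E b (corner L'))).
      apply: ereal_inf_lbound; exists (corner L') => //.
      have /(@dilateS _ _ 1 (2 ^+ 5)) : 0 < 1 :> R by [].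
      by apply; [rewrite -natrX ler1n|rewrite dilate1; exact: corner_cset].
    apply: ge_ereal_sup => _ [P _ <-]; rewrite avg_normP// powR1 mul1r -lebesgue_vol.
    rewrite -[X in (_ <= X)%E]mul1e -(integral_cst mu (measurable_cset P)).
    apply: ge0_le_integral => //.
    - exact: measurable_cset.
    - by move=> z _; rewrite lee_fin powR_ge0.
    - by apply: measurable_pow_normc; apply: cmeasurableS mb.
    - move=> z _; rewrite lee_fin (_ : 1 = 1 `^ p); last by rewrite powR1.
      by apply: powR_le; rewrite ?(ltW p0) ?normc_ge0.
  have Yoo : (Ynorm p%:E W b < +oo)%E by exact: le_lt_trans Yb (ltry _).
  pose D := dil (dil5_gt0 R) L; have vD := vol_gt0 D; have v1 := vol_gt0 c1.
  pose del := (vol c1 / (2 * vol D)) `^ p^-1.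
  have del0 : 0 < del by rewrite powR_gt0// divr_gt0// mulr_gt0.
  split => //; last first.
    apply: (@lt_le_trans _ _ del%:E); first by rewrite lte_fin.
    rewrite /Ynorm /= le_max; apply/orP; right.
    apply: (@le_trans _ _ (ereal_inf [set maximal p%:E b z | z in dilate (2 ^+ 5) L])); last first.
      by apply: ereal_sup_ubound; exists L.
    apply: le_ereal_inf_tmp => _ [z Lz <-]; apply: (@le_trans _ _ (avg_norm p%:E D b)); last first.
      by apply: maximal_ge; rewrite cset_dil.
    rewrite leNgt; apply/negP => /ltW; rewrite avg_normP ?(ltW del0)//.
    have -> : del `^ p * vol D = vol c1 / 2.
      rewrite /del -powRrM mulVf ?gt_eqF// powRr1 ?divr_ge0 ?mulr_ge0 ?(ltW vD) ?(ltW v1)//.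
      by field; rewrite gt_eqF.
    apply/negP; rewrite -ltNge (@lt_le_trans _ _ (vol c1)%:E)//; first by rewrite lte_fin; lra.
    rewrite -lebesgue_vol -[X in (X <= _)%E]mul1e -(integral_cst mu mc1).
    apply: (@le_trans _ _ (powint p b (cset c1))).
      apply: ge0_le_integral => //.
      - by apply: measurable_pow_normc; apply: cmeasurableS mb.
      - by move=> u u1; rewrite bc1// normc1 powR1.
    apply: powintS => //; first exact: measurable_cset.
      move=> u /c1L; rewrite cset_dil -(dilate1 L); apply: dilateS => //.
      by rewrite -natrX ler1n.
    exact: cmeasurableS mb.
  split.
    split => //.
    have hL : {ae mu, forall z, normc (b z) <= 1} by exact: aeW.
    apply: (inLpP _ p0).2; split; first exact: mb.
    exact: le_lt_trans (powint_bounded p0 ler01 mb hL bv) (ltry _).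
  exists (fun L' => if L' == L then b else fun=> 0); split.
  - by move=> L' _; case: eqP => [->//|_ z _].
  - move=> z; rewrite -(@fsbig_widen _ _ _ _ [set L]).
    + by rewrite fsbig_set1 eqxx.
    + by move=> _ ->.
    + by move=> L' [_ /= /eqP/negbTE ->].
  - by move=> L' _; case: eqP => [->//|_]; rewrite cintegral0.
have gQ : grid Q by exists 0, o.
have [X1 Y1 Y1oo] := Xb p1 p1_ge1; have [[X2 _] Y2 Y2oo] := Xb p2 p2_ge1.
have := B1 0 0 grid Q W b b (@dyadic_lattice_grid R d) gQ stQ X1 X2.
rewrite lebesgue_vol vQ mule1 => H; rewrite leNgt; apply/negP => C0.
have : (0 <= C%:E * Ynorm p1%:E W b * Ynorm p2%:E W b)%E.
  by apply: le_trans H; rewrite lee_fin normc_ge0.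
rewrite leNgt => /negP; apply; rewrite -muleA nmule_rlt0 ?lte_fin//.
exact: mule_gt0.
Qed.

End exceptional_sets.

(** * Auerbach bases *)

Section auerbach.
Context (R : realType) (n : nat).
Local Notation C := R[i].
Implicit Types (U V : 'M[C]_n) (u v k : 'rV[C]_n).

Definition coordinate U k (i : 'I_n) : C := (k *m invmx U) 0 i.

Definition replace_row U (i : 'I_n) k : 'M[C]_n :=
  \matrix_(a, b) if a == i then k 0 b else U a b.

Lemma replace_row_eq U i k : row i (replace_row U i k) = k.
Proof. by apply/rowP => b; rewrite !mxE eqxx. Qed.

Lemma replace_row_neq U i k j : j != i -> row j (replace_row U i k) = row j U.
Proof. by move=> ji; apply/rowP => b; rewrite !mxE (negbTE ji). Qed.

(** Cramer's rule. *)
Lemma det_replace_row U i k : U \in unitmx ->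
  \det (replace_row U i k) = coordinate U k i * \det U.
Proof.
move=> uU; rewrite (expand_det_row _ i) /coordinate /invmx uU -scalemxAr mxE mulrC mulrA.
rewrite mulfV ?mul1r; last by rewrite unitmxE unitfE in uU.
rewrite mxE; apply: eq_bigr => j _; congr (_ * _); first by rewrite mxE eqxx.
rewrite [RHS]mxE /cofactor; congr (_ * \det _); apply/matrixP => a b.
by rewrite !mxE eq_sym (negbTE (neq_lift _ _)).
Qed.

Lemma unitmx_replace_row U i k : U \in unitmx -> coordinate U k i != 0 ->
  replace_row U i k \in unitmx.
Proof.
by move=> uU c0; rewrite unitmxE det_replace_row// unitrM -unitmxE uU andbT unitfE.
Qed.

Lemma normc_prod (I : Type) (s : seq I) (F : I -> C) :
  normc (\prod_(i <- s) F i) = \prod_(i <- s) normc (F i).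
Proof.
elim: s => [|a s IH]; first by rewrite !big_nil normc1.
by rewrite !big_cons normcM IH.
Qed.

Lemma normc_det_le U (M : R) : 0 <= M -> (forall i j, normc (U i j) <= M) ->
  normc (\det U) <= (n`!)%:R * M ^+ n.
Proof.
move=> M0 UM; rewrite /determinant (le_trans (normc_sum _ _))//.
rewrite -perm.card_Sn mulr_natl -sumr_const.
apply: ler_sum => s _; rewrite normcM.
have -> : normc ((-1) ^+ perm.odd_perm s : C) = 1.
  by case: perm.odd_perm; rewrite ?expr1 ?normcN ?expr0 normc1.
rewrite mul1r normc_prod -[X in _ <= M ^+ X](card_ord n) -prodr_const.
by apply: ler_prod => i _; rewrite normc_ge0 UM.
Qed.

(** Auerbach's lemma up to the factor 2, for a bounded set K that may lie in a
    proper subspace. Put as many rows of an invertible matrix into K as possible, and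
    choose such rows so that the determinant is at least half of its supremum.
    Replacing the i-th row by k multiplies the determinant by the i-th coordinate of k,
    which therefore is at most 2. A coordinate whose row is not in K vanishes on K,
    since otherwise one more row could be placed in K. *)
Lemma auerbach (K : set 'rV[C]_n) (M : R) :
  (forall k, K k -> forall i, normc (k 0 i) <= M) ->
  exists2 U : 'M[C]_n, U \in unitmx & forall i,
    (K (row i U) /\ forall k, K k -> normc (coordinate U k i) <= 2) \/
    (forall k, K k -> coordinate U k i = 0).
Proof.
move=> KM.
pose p m := `[< exists U (I : {set 'I_n}), [/\ U \in unitmx, #|I| = m &
  forall i, i \in I -> K (row i U)] >].
have ex : exists m, p m.
  exists 0%N; apply/asboolP; exists 1%:M, finset.set0; split; rewrite ?unitmx1 ?cards0//.
  by move=> i; rewrite finset.in_set0.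
have ub m : p m -> (m <= n)%N.
  by move=> /asboolP[U [I [_ <- _]]]; rewrite -[X in (_ <= X)%N]card_ord max_card.
case: (ex_maxnP ex ub) => m /asboolP[U0 [I [uU0 cI KU0]]] maxm.
pose Z := [set V | [/\ V \in unitmx, (forall i, i \in I -> K (row i V)) &
  forall i, i \notin I -> row i V = row i U0]].
pose M0 := `|M| + \sum_i \sum_j normc (U0 i j).
have S0 : 0 <= \sum_i \sum_j normc (U0 i j).
  by apply: sumr_ge0 => i _; apply: sumr_ge0 => j _; exact: normc_ge0.
have M00 : 0 <= M0 by rewrite addr_ge0.
have ZM V : Z V -> normc (\det V) <= (n`!)%:R * M0 ^+ n.
  move=> [uV KV VU]; apply: normc_det_le => // i j.
  case: (boolP (i \in I)) => iI.
    have := KM _ (KV i iI) j; rewrite mxE => /le_trans; apply.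
    by rewrite (le_trans (ler_norm M))// lerDl.
  have -> : V i j = U0 i j by have /rowP/(_ j) := VU i iI; rewrite !mxE.
  rewrite /M0 (bigD1 i)//= (bigD1 j)//= addrCA -addrA lerDl addr_ge0//.
    by apply: sumr_ge0 => *; exact: normc_ge0.
  by rewrite addr_ge0// sumr_ge0// => *; rewrite sumr_ge0// => *; exact: normc_ge0.
have ZU0 : Z U0 by [].
pose D := [set normc (\det V) | V in Z].
have supD : has_sup D.
  split; first by exists (normc (\det U0)), U0.
  by exists ((n`!)%:R * M0 ^+ n) => _ [V ZV <-]; exact: ZM.
have unit_pos V : V \in unitmx -> 0 < normc (\det V).
  rewrite unitmxE unitfE => /eqP nz; rewrite lt_neqAle normc_ge0 andbT eq_sym.
  by apply/eqP => /eq0_normc.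
have sup0 : 0 < sup D.
  by rewrite (lt_le_trans (unit_pos _ uU0))//; apply: sup_upper_bound => //; exists U0.
have [_ [V ZV <-] hV] := @sup_adherent _ D (sup D / 2) (divr_gt0 sup0 (ltr0n _ 2)) supD.
have [uV KV VU] := ZV; exists V => // i.
case: (boolP (i \in I)) => iI; [left|right].
  split; first exact: KV.
  move=> k Kk; have [->|c0] := eqVneq (coordinate V k i) 0; first by rewrite normc0.
  have ZW : Z (replace_row V i k).
    split.
    - exact: unitmx_replace_row.
    - move=> j jI; have [->|ji] := eqVneq j i; first by rewrite replace_row_eq.
      by rewrite replace_row_neq//; exact: KV.
    - move=> j jI; rewrite replace_row_neq; first exact: VU.
      by apply: contraNneq jI => ->.
  have : normc (\det (replace_row V i k)) <= sup D.
    by apply: sup_upper_bound => //; exists (replace_row V i k).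
  rewrite det_replace_row// normcM => h.
  have v0 := unit_pos _ uV; rewrite -(ler_pM2r v0) (le_trans h)//.
  by move: hV; lra.
move=> k Kk; apply/eqP; apply: contrapT => /negP c0.
have : p m.+1.
  apply/asboolP; exists (replace_row V i k), (i |: I); split.
  - exact: unitmx_replace_row.
  - by rewrite cardsU1 iI cI.
  - move=> j; rewrite in_setU1; have [->|ji] := eqVneq j i; first by rewrite replace_row_eq.
    by move=> /= jI; rewrite replace_row_neq//; exact: KV.
by move/maxm; rewrite ltnn.
Qed.

End auerbach.

(** * Convex bodies and duality of averages *)

Section duality.
Context (R : realType) (d : nat).
Implicit Types (Q L : cube R d) (f h phi : RR R d -> R[i]) (p : R).
Local Notation mu := (lebesgue R d).

Definition pairing Q f phi : R[i] :=
  (vol Q)^-1%:C * cintegral mu (cset Q) (fun x => f x * (phi x)^*).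

(** [convex_body p Q f] is the set of all vectors of pairings of the f i with one
    member of this ball. *)
Definition dual_ball p Q : set (RR R d -> R[i]) :=
  [set phi | cmeasurable (cset Q) phi /\ (avg_norm (hoelder_conjugate p%:E) Q phi <= 1)%E].

Lemma hoelder_conjugate_gt1 p : 1 < p -> hoelder_conjugate p%:E = (p / (p - 1))%:E.
Proof. exact: hoelder_conjugate_real. Qed.

Lemma dual_ball1P Q phi : dual_ball 1 Q phi <-> cmeasurable (cset Q) phi /\
  {ae mu, forall x, normc (phi x * \1_(cset Q) x) <= 1}.
Proof.
rewrite /dual_ball /= hoelder_conjugate1 /avg_norm.
by split=> -[m1 h]; split => //; apply/cnormyP.
Qed.

Lemma dual_ballP p Q phi : 1 < p -> dual_ball p Q phi <-> cmeasurable (cset Q) phi /\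
  (powint (p / (p - 1)) phi (cset Q) <= (vol Q)%:E)%E.
Proof.
move=> p1; rewrite /dual_ball /= hoelder_conjugate_gt1//.
have p0 : 0 < p / (p - 1) by rewrite divr_gt0 ?subr_gt0// (lt_trans ltr01).
by split=> -[m1]; rewrite (avg_normP _ _ p0 ler01) powR1 mul1r.
Qed.

(** By the pointwise bound |f phi| <= |f|^p + |phi|^p'; for p = 1 the factor phi is
    bounded. The estimate is used only to see that pairings converge and are bounded. *)
Lemma integral_pairing_le p Q f phi : 1 <= p -> cmeasurable (cset Q) f -> dual_ball p Q phi ->
  (\int[mu]_(x in cset Q) (normc (f x * (phi x)^*))%:E <=
   \int[mu]_(x in cset Q) (normc (f x))%:E + powint p f (cset Q) + (vol Q)%:E)%E.
Proof.
move=> p1 mf; have mQ := measurable_cset Q.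
have nf0 : (0 <= \int[mu]_(x in cset Q) (normc (f x))%:E)%E.
  by apply: integral_ge0 => x _; rewrite lee_fin normc_ge0.
have mnf : measurable_fun (cset Q) (fun x => (normc (f x))%:E).
  by apply/measurable_EFinP; exact: measurable_normc.
have mfp : measurable_fun (cset Q) (fun x => (normc (f x) `^ p)%:E) by exact: measurable_pow_normc.
have v0 := vol_gt0 Q.
have [p_eq1|pn1] := eqVneq p 1.
  rewrite p_eq1 => /dual_ball1P[mphi hphi].
  apply: (@le_trans _ _ (\int[mu]_(x in cset Q) (normc (f x))%:E)%E).
    apply: ae_ge0_le_integral => //.
    - by move=> x _; rewrite lee_fin normc_ge0.
    - apply/measurable_EFinP; apply: measurable_normc; apply: cmeasurableM => //.
      exact: cmeasurableJ.
    - by move=> x _; rewrite lee_fin normc_ge0.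
    apply: filterS hphi => x hx Qx; move: hx.
    rewrite indicE mem_set// mulr1 => hx.
    by rewrite lee_fin normcM normc_conj ler_piMr// normc_ge0.
  by rewrite -addeA leeDl// adde_ge0 ?powint_ge0// lee_fin ltW.
have p_gt1 : 1 < p by rewrite lt_neqAle eq_sym pn1.
move=> /(dual_ballP _ _ p_gt1)[mphi hphi].
have mq : measurable_fun (cset Q) (fun x => (normc (phi x) `^ (p / (p - 1)))%:E).
  exact: measurable_pow_normc.
apply: (@le_trans _ _ (powint p f (cset Q) + powint (p / (p - 1)) phi (cset Q))%E).
  rewrite -ge0_integralD//; last 2 first.
  - by move=> x _; rewrite lee_fin powR_ge0.
  - by move=> x _; rewrite lee_fin powR_ge0.
  apply: ge0_le_integral => //.
  - by move=> x _; rewrite lee_fin normc_ge0.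
  - apply/measurable_EFinP; apply: measurable_normc; apply: cmeasurableM => //.
    exact: cmeasurableJ.
  - exact: emeasurable_funD.
  - move=> x _; rewrite -EFinD lee_fin normcM normc_conj.
    by apply: young_le; rewrite ?normc_ge0.
by rewrite -[X in (X <= _)%E]add0e -addeA leeD// leeD2l.
Qed.

Lemma integrable_pairing p Q f phi : 1 <= p -> cmeasurable (cset Q) f ->
  (powint p f (cset Q) < +oo)%E -> dual_ball p Q phi ->
  cintegrable mu (cset Q) (fun x => f x * (phi x)^*).
Proof.
move=> p1 mf foo bphi; have p0 : 0 < p by rewrite (lt_le_trans ltr01).
have [t t0 ht] := powint_bound p0 foo.
have mphi : cmeasurable (cset Q) phi by case: bphi.
apply: cintegrableP; first exact: measurable_cset.
  by apply: cmeasurableM => //; exact: cmeasurableJ.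
apply: (le_lt_trans (integral_pairing_le p1 mf bphi)).
apply: lte_add_pinfty; last exact: ltry.
apply: lte_add_pinfty => //.
exact: le_lt_trans (integral_normc_le p1 t0 mf ht) (ltry _).
Qed.

Lemma pairing_bounded p Q f : 1 <= p -> cmeasurable (cset Q) f ->
  (powint p f (cset Q) < +oo)%E ->
  exists2 M, 0 <= M & forall phi, dual_ball p Q phi -> normc (pairing Q f phi) <= M.
Proof.
move=> p1 mf foo; have p0 : 0 < p by rewrite (lt_le_trans ltr01).
have [t t0 ht] := powint_bound p0 foo; have v0 := vol_gt0 Q.
pose S := 2 * t * vol Q + t `^ p * vol Q + vol Q.
have S0 : 0 <= S by rewrite !addr_ge0 ?mulr_ge0 ?powR_ge0 ?(ltW v0).
exists ((vol Q)^-1 * (2 * S)); first by rewrite !mulr_ge0 ?invr_ge0 ?(ltW v0).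
move=> phi bphi; have mphi : cmeasurable (cset Q) phi by case: bphi.
rewrite /pairing normcM normc_real gtr0_norm ?invr_gt0// ler_pM2l ?invr_gt0//.
apply: normc_cintegral_le; first exact: measurable_cset.
  by apply: cmeasurableM => //; exact: cmeasurableJ.
apply: (le_trans (integral_pairing_le p1 mf bphi)).
rewrite /S !EFinD; apply: leeD => //; apply: leeD => //.
exact: integral_normc_le p1 t0 mf ht.
Qed.

Lemma pairing_sum p Q (n : nat) (c : 'I_n -> R[i]) (F : 'I_n -> RR R d -> R[i]) phi :
  1 <= p -> (forall i, cmeasurable (cset Q) (F i)) ->
  (forall i, powint p (F i) (cset Q) < +oo)%E -> dual_ball p Q phi ->
  pairing Q (fun x => \sum_i c i * F i x) phi = \sum_i c i * pairing Q (F i) phi.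
Proof.
move=> p1 mF Foo bphi; have mQ := measurable_cset Q.
have iF i : cintegrable mu (cset Q) (fun x => F i x * (phi x)^*).
  exact: integrable_pairing (mF i) (Foo i) bphi.
rewrite /pairing; under eq_bigr do rewrite mulrCA.
rewrite -mulr_sumr; congr (_ * _).
under eq_bigr do rewrite -cintegralZ//.
rewrite -cintegral_sum//; last by move=> i; exact: cintegrableZ.
apply: eq_cintegral => x _; rewrite mulr_suml; apply: eq_bigr => i _; exact/esym/mulrA.
Qed.

Lemma dual_ball0 p Q : 1 <= p -> dual_ball p Q (fun=> 0).
Proof.
move=> p1; have p0 : 0 < p by rewrite (lt_le_trans ltr01).
split; first exact: cmeasurable_cst.
have [->|pn1] := eqVneq p 1.
  by rewrite hoelder_conjugate1; apply/cnormyP => //; apply: aeW => x; rewrite mul0r normc0.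
rewrite hoelder_conjugate_gt1 ?lt_neqAle 1?eq_sym ?pn1//.
have q0 : 0 < p / (p - 1) by rewrite divr_gt0// subr_gt0 lt_neqAle eq_sym pn1.
rewrite avg_normP//; rewrite (@le_trans _ _ 0%E)//; last first.
  by rewrite lee_fin mulr_ge0 ?powR_ge0// ltW// vol_gt0.
by rewrite /powint; under eq_integral do rewrite normc0 powR0 ?gt_eqF//; rewrite integral0.
Qed.

(** The norm of f is attained in duality by the multiple f |f|^(p-2) a^(1-p). *)
Lemma pairing_extremal p Q f (a : R) : 1 <= p -> 0 <= a -> cmeasurable (cset Q) f ->
  powint p f (cset Q) = (a `^ p * vol Q)%:E ->
  exists2 phi, dual_ball p Q phi & normc (pairing Q f phi) = a.
Proof.
move=> p1; rewrite le_eqVlt => /predU1P[<-|a0] mf ef; have p0 : 0 < p by rewrite (lt_le_trans ltr01).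
  exists (fun=> 0); first exact: dual_ball0.
  rewrite /pairing; rewrite [X in _ * X](_ : _ = 0) ?mulr0 ?normc0//.
  by rewrite -[RHS](cintegral0 mu (cset Q)); apply: eq_cintegral => x _; rewrite rmorph0 mulr0.
(* The value of k at the zeros of f does not matter, since k multiplies f. *)
pose k x := normc (f x) `^ (p - 2) * a `^ (1 - p).
have mQ := measurable_cset Q.
have mk : cmeasurable (cset Q) (fun x => (k x)%:C).
  split; last exact: measurable_cst.
  apply: measurable_funM; last exact: measurable_cst.
  by apply/measurable_EFinP; exact: measurable_pow_normc.
pose phi x : R[i] := f x * (k x)%:C.
have mphi : cmeasurable (cset Q) phi by exact: cmeasurableM.
have nphi x : f x != 0 -> normc (phi x) = normc (f x) `^ (p - 1) * a `^ (1 - p).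
  move=> fx; have n0 : 0 < normc (f x).
    by rewrite lt_neqAle normc_ge0 andbT eq_sym; apply: contraNneq fx => /eq0_normc ->.
  rewrite /phi normcM normc_real ger0_norm; last by rewrite mulr_ge0 ?powR_ge0.
  rewrite /k mulrA -[X in X * _ `^ (p - 2)]powRr1 ?(ltW n0)// -powRD; last by rewrite (gt_eqF n0) implybT.
  by congr (_ `^ _ * _); lra.
have fphi x : f x * (phi x)^* = (a `^ (1 - p) * normc (f x) `^ p)%:C.
  have [f0|fx] := eqVneq (f x) 0.
    by rewrite f0 mul0r normc0 powR0 ?gt_eqF// mulr0.
  have n0 : 0 < normc (f x).
    by rewrite lt_neqAle normc_ge0 andbT eq_sym; apply: contraNneq fx => /eq0_normc ->.
  transitivity (f x * ((f x)^* * (k x)%:C)).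
    by congr (_ * _); rewrite -[in RHS](conjc_real (k x)) /phi; exact: rmorphM.
  rewrite mulrA.
  have -> : f x * (f x)^* = (normc (f x) `^ 2)%:C.
    rewrite powR_mulrn ?ltW//; case: (f x) => u v /=.
    rewrite sqr_sqrtr ?addr_ge0 ?sqr_ge0//; apply/eqP; rewrite eq_complex /=.
    by apply/andP; split; apply/eqP; ring.
  rewrite -(rmorphM (real_complex R)) /k mulrA -powRD; last by rewrite (gt_eqF n0) implybT.
  by congr (_%:C); rewrite mulrC; congr (_ * _ `^ _); lra.
exists phi.
  have [p_eq1|pn1] := eqVneq p 1.
    rewrite p_eq1; apply/dual_ball1P; split => //; apply: aeW => x.
    have [f0|fx] := eqVneq (f x) 0; first by rewrite /phi f0 !mul0r normc0.
    rewrite normcM nphi// p_eq1 subrr !powRr0 !mul1r normc_indic indicE.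
    by case: (_ \in _).
  have p_gt1 : 1 < p by rewrite lt_neqAle eq_sym pn1.
  apply/dual_ballP => //; split => //.
  have -> : powint (p / (p - 1)) phi (cset Q) = ((a `^ p)^-1%:E * powint p f (cset Q))%E.
    rewrite /powint -ge0_integralZl//.
    - apply: eq_integral => x _; rewrite -EFinM; congr EFin.
      have q0 : 0 < p / (p - 1) by rewrite divr_gt0 ?subr_gt0.
      have [f0|fx] := eqVneq (f x) 0.
        by rewrite /phi f0 mul0r normc0 !powR0 ?gt_eqF// mulr0.
      rewrite nphi// powRM ?powR_ge0// -!powRrM mulrC -powRN; congr (_ `^ _ * _ `^ _).
        by field; rewrite subr_eq0.
      by field; rewrite subr_eq0.
    - exact: measurable_pow_normc.
    - by move=> x _; rewrite lee_fin powR_ge0.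
    - by rewrite lee_fin invr_ge0 powR_ge0.
  by rewrite ef -EFinM mulrA mulVf ?mul1r// gt_eqF// powR_gt0.
have v0 := vol_gt0 Q.
have -> : pairing Q f phi = a%:C; last by rewrite normc_real gtr0_norm.
rewrite /pairing; under eq_cintegral do rewrite fphi.
rewrite /cintegral /=.
have -> : (\int[mu]_(x in cset Q) (0 : R) = 0)%R by rewrite /Rintegral integral0.
have -> : (\int[mu]_(x in cset Q) (a `^ (1 - p) * normc (f x) `^ p))%R = a * vol Q.
  rewrite /Rintegral; under eq_integral do rewrite EFinM.
  rewrite ge0_integralZl//; last 3 first.
  - exact: measurable_pow_normc.
  - by move=> x _; rewrite lee_fin powR_ge0.
  - by rewrite lee_fin powR_ge0.
  rewrite -/(powint p f (cset Q)) ef -EFinM /= mulrA -powRD; last by rewrite (gt_eqF a0) implybT.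
  by rewrite subrK powRr1 ?ltW.
rewrite -[_ +i* 0]/((a * vol Q)%:C) -rmorphM /=; congr (_%:C); field.
by rewrite gt_eqF.
Qed.

End duality.

(* From here on [^*] is [Num.conj] wherever it stands. *)
Local Open Scope ring_scope.

(** * Coordinates adapted to a convex body *)

Section conjugation.
Context (R : realType).
Implicit Types (z w : R[i]).

Lemma conjM z w : (z * w)^* = z^* * w^*.
Proof. exact: rmorphM. Qed.

Lemma conj_sum (I : Type) (s : seq I) (F : I -> R[i]) :
  (\sum_(i <- s) F i)^* = \sum_(i <- s) (F i)^*.
Proof. exact: rmorph_sum. Qed.

Lemma conjK z : (z^*)^* = z.
Proof. exact: Num.Theory.conjCK. Qed.

Lemma normc_conjC z : normc z^* = normc z.
Proof. exact: normc_conj. Qed.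

End conjugation.

Section change_of_basis.
Context (R : realType) (d n : nat).
Implicit Types (Q L : cube R d) (f g : 'I_n -> RR R d -> R[i]) (p : R).
Local Notation mu := (lebesgue R d).

Definition combine (A : 'M[R[i]]_n) f (i : 'I_n) x : R[i] := \sum_j A i j * f j x.

(** The adjoint of the matrix applied to b is the inverse of the one applied to a. *)
Lemma cdot_change_of_basis (U : 'M[R[i]]_n) (a b : 'I_n -> R[i]) : U \in unitmx ->
  \sum_i (\sum_j (invmx U)^T i j * a j) * (\sum_j (U i j)^* * b j)^* =
  \sum_i a i * (b i)^*.
Proof.
move=> uU.
have delta j k : \sum_i U i k * invmx U j i = (j == k)%:R.
  transitivity ((invmx U *m U) j k); last by rewrite mulVmx// mxE.
  by rewrite mxE; apply: eq_bigr => i _; exact: mulrC.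
under eq_bigr => i _.
  rewrite mulr_suml; under eq_bigr => j _.
    rewrite conj_sum mulr_sumr.
    under eq_bigr => k _ do rewrite conjM conjK mxE mulrACA (mulrC (invmx U j i)).
  over.
over.
rewrite exchange_big /=; apply: eq_bigr => j _.
rewrite exchange_big /= (bigD1 j)//= [X in _ + X]big1 ?addr0.
  by rewrite -mulr_suml delta eqxx mul1r.
by move=> k kj; rewrite -mulr_suml delta eq_sym (negbTE kj) mul0r.
Qed.

Lemma admissible_combine p A f : 0 < p -> (forall i, admissible p (f i)) ->
  forall i, admissible p (combine A f i).
Proof.
by move=> p0 af i; apply: admissible_sum => // j; exact: admissibleZ.
Qed.

Lemma admissible_powint p Q (h : RR R d -> R[i]) : 0 < p -> admissible p h ->
  cmeasurable (cset Q) h /\ (powint p h (cset Q) < +oo)%E.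
Proof.
move=> p0 [/(inLpP _ p0)[mh hoo] _]; split; first exact: cmeasurableS mh.
by apply: le_lt_trans hoo; apply: powintS => //; exact: measurable_cset.
Qed.

Lemma pairing_combine p Q A f phi : 1 <= p -> (forall i, admissible p (f i)) ->
  dual_ball p Q phi -> forall i,
  pairing Q (combine A f i) phi = \sum_j A i j * pairing Q (f j) phi.
Proof.
move=> p1 af bphi i; have p0 : 0 < p by rewrite (lt_le_trans ltr01).
by apply: (pairing_sum _ p1) => // j; have [] := admissible_powint Q p0 (af j).
Qed.

Context (p1 p2 : R) (Q : cube R d) (f g : 'I_n -> RR R d -> R[i]).
Context (p1_ge1 : 1 <= p1) (p2_ge1 : 1 <= p2).
Context (af : forall i, admissible p1 (f i)) (ag : forall i, admissible p2 (g i)).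
Let p1_gt0 : 0 < p1. Proof. exact: lt_le_trans p1_ge1. Qed.
Let p2_gt0 : 0 < p2. Proof. exact: lt_le_trans p2_ge1. Qed.

Definition body_radius : \bar R :=
  Defs.radius (body_prod (convex_body p1%:E Q f) (convex_body p2%:E Q g)).

Lemma cdot_le_body_radius phi psi : dual_ball p1 Q phi -> dual_ball p2 Q psi ->
  ((normc (cdot (fun i => pairing Q (f i) phi) (fun i => pairing Q (g i) psi)))%:E <=
   body_radius)%E.
Proof.
move=> bphi bpsi; apply: ereal_sup_ubound; eexists; last reflexivity.
exists (fun i => pairing Q (f i) phi); first by exists phi.
by exists (fun i => pairing Q (g i) psi) => //; exists psi.
Qed.

Lemma body_radius_ge0 : (0 <= body_radius)%E.
Proof.
apply: (le_trans _ (cdot_le_body_radius (dual_ball0 Q p1_ge1) (dual_ball0 Q p2_ge1))).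
by rewrite lee_fin normc_ge0.
Qed.

Lemma body_radius_fin : body_radius = (fine body_radius)%:E.
Proof.
rewrite fineK// ge0_fin_numE ?body_radius_ge0//.
have bnd p h : 1 <= p -> (forall i : 'I_n, admissible p (h i)) -> exists M : 'I_n -> R, forall i,
    0 <= M i /\ forall phi, dual_ball p Q phi -> normc (pairing Q (h i) phi) <= M i.
  move=> pge1 ah; have p0 : 0 < p by rewrite (lt_le_trans ltr01).
  have /choice[M hM] : forall i, exists M, 0 <= M /\
      forall phi, dual_ball p Q phi -> normc (pairing Q (h i) phi) <= M.
    move=> i; have [mh hoo] := admissible_powint Q p0 (ah i).
    by have [M] := pairing_bounded pge1 mh hoo; exists M.
  by exists M.
have [M hM] := bnd _ _ p1_ge1 af; have [N hN] := bnd _ _ p2_ge1 ag.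
apply: (@le_lt_trans _ _ (\sum_i M i * N i)%:E); last exact: ltry.
apply: ge_ereal_sup => _ [_ [_ [phi bphi <-] [_ [psi bpsi <-] <-]] <-].
rewrite lee_fin (le_trans (normc_sum _ _))//; apply: ler_sum => i _.
have [M0 MB] := hM i; have [N0 NB] := hN i.
rewrite normcM normc_conjC; apply: ler_pM; rewrite ?normc_ge0//; [exact: MB|exact: NB].
Qed.

(** Take the rows u_i of U from the convex body of f, as in [auerbach], and use the
    coordinates of f in this basis. By duality each has norm at most 2, since the
    coordinates of the points of the body are at most 2. The i-th coordinate of g
    becomes the pairing with u_i; its norm is the supremum of |u_i . b| over the body
    of g, at most the radius because u_i is in the body of f. For the remaining u_i
    the coordinate of f vanishes, and so does the product. *)
Lemma normalized_coordinates : exists (U V : 'M[R[i]]_n) (a b : 'I_n -> R), [/\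
  forall x y, \sum_i combine U f i y * (combine V g i x)^* = \sum_i f i y * (g i x)^*,
  forall i, 0 <= a i /\ powint p1 (combine U f i) (cset Q) = (a i `^ p1 * vol Q)%:E,
  forall i, 0 <= b i /\ powint p2 (combine V g i) (cset Q) = (b i `^ p2 * vol Q)%:E &
  forall i, a i * b i <= 2 * fine body_radius].
Proof.
pose K : set 'rV[R[i]]_n := [set \row_i pairing Q (f i) phi | phi in dual_ball p1 Q].
have [M KM] : exists M : R, forall k, K k -> forall i, normc (k 0 i) <= M.
  have /choice[M hM] : forall i, exists M, 0 <= M /\
      forall phi, dual_ball p1 Q phi -> normc (pairing Q (f i) phi) <= M.
    move=> i; have [mh hoo] := admissible_powint Q p1_gt0 (af i).
    by have [M] := pairing_bounded p1_ge1 mh hoo; exists M.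
  exists (\sum_i M i) => _ [phi bphi <-] i; rewrite mxE (bigD1 i)//= -[leLHS]addr0.
  apply: lerD; first by have [_] := hM i; exact.
  by apply: sumr_ge0 => j _; have [] := hM j.
have [U uU hU] := auerbach KM.
pose V : 'M[R[i]]_n := \matrix_(i, j) (U i j)^*.
have /choice[a ha] : forall i, exists a, 0 <= a /\
    powint p1 (combine (invmx U)^T f i) (cset Q) = (a `^ p1 * vol Q)%:E.
  move=> i; have [_ foo] := admissible_powint Q p1_gt0 (admissible_combine (invmx U)^T p1_gt0 af i).
  by have [a] := powint_root p1_gt0 foo; exists a.
have /choice[b hb] : forall i, exists b, 0 <= b /\
    powint p2 (combine V g i) (cset Q) = (b `^ p2 * vol Q)%:E.
  move=> i; have [_ foo] := admissible_powint Q p2_gt0 (admissible_combine V p2_gt0 ag i).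
  by have [b] := powint_root p2_gt0 foo; exists b.
exists (invmx U)^T, V, a, b; split => //.
  move=> x y; rewrite -(cdot_change_of_basis (fun i => f i y) (fun i => g i x) uU).
  apply: eq_bigr => i _; congr (_ * (_)^*).
  by apply: eq_bigr => j _; rewrite mxE.
move=> i; have [a0 ea] := ha i; have [b0 eb] := hb i.
have [mf' _] := admissible_powint Q p1_gt0 (admissible_combine (invmx U)^T p1_gt0 af i).
have [mg' _] := admissible_powint Q p2_gt0 (admissible_combine V p2_gt0 ag i).
have [phi bphi ephi] := pairing_extremal p1_ge1 a0 mf' ea.
have [psi bpsi epsi] := pairing_extremal p2_ge1 b0 mg' eb.
pose k : 'rV[R[i]]_n := \row_j pairing Q (f j) phi.
have ec : a i = normc (coordinate U k i).
  rewrite -ephi (pairing_combine (invmx U)^T p1_ge1 af bphi) /coordinate mxE; congr normc.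
  by apply: eq_bigr => j _; rewrite !mxE mulrC.
have Kk : K k by exists phi.
case: (hU i) => [[[chi bchi echi] h2]|h0]; last first.
  by rewrite ec h0// normc0 mul0r mulr_ge0// fine_ge0// body_radius_ge0.
apply: ler_pM => //; first by rewrite ec; exact: h2.
rewrite -lee_fin -body_radius_fin; apply: le_trans (cdot_le_body_radius bchi bpsi).
rewrite lee_fin -epsi (pairing_combine V p2_ge1 ag bpsi) -normc_conjC conj_sum /cdot.
rewrite le_eqVlt; apply/orP; left; apply/eqP; congr normc; apply: eq_bigr => j _.
rewrite conjM mxE conjK; congr (_ * _).
by have /rowP/(_ j) := echi; rewrite !mxE.
Qed.

End change_of_basis.

(** * The vector estimate on one cube *)

Section cube_nesting.
Context (R : realType) (d : nat).
Implicit Types (Q L : cube R d).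
Local Notation grid := (@grid R d).

Lemma grid_triple_mono L Q : grid L -> grid Q -> cset L `<=` cset Q ->
  (scale L <= scale Q)%R -> dilate 3 L `<=` dilate 3 Q.
Proof.
move=> [l [x ->]] [k [y ->]] LQ; rewrite !scale_dyad => lk.
rewrite -(dyad_eq (LQ _ (mem_dyad l x))) => z /dilateP h; apply/dilateP => i.
have [] := h i; have s2 := pow2_le R lk.
by have [] := dyad_nested x i lk => /= h1 h2 h3 h4; split; lra.
Qed.

Lemma gt0_3 : 0 < 3 :> R. Proof. by []. Qed.

Lemma dil_inj (c : R) (c0 : 0 < c) : injective (@dil R d c c0).
Proof.
move=> Q L e; have es : side Q = side L.
  by have /(congr1 (@side R d)) /= := e; apply: mulfI; rewrite gt_eqF.
apply: cube_eq => // i; have /(congr1 (fun P => tnth (corner P) i)) := e.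
by rewrite !tnth_mktuple es => h; lra.
Qed.

End cube_nesting.

Section vector_forms.
Context (R : realType) (d n : nat).
Implicit Types (Q L : cube R d) (f g : 'I_n -> RR R d -> R[i]) (Qs : set (cube R d)) (m nu : int).
Local Notation mu := (lebesgue R d).
Local Notation mu2 := (mu \x mu)%E.
Local Notation grid := (@grid R d).
Context (Ks : int -> RR R d -> RR R d -> R[i]).
Context (Ksupp : kernel_support Ks).

(** The local form of L sees its arguments only on L and on 3L. *)
Lemma local_form_restrict (D : set (RR R d)) L m nu (f g : RR R d -> R[i]) :
  grid L -> dilate 3 L `<=` D ->
  local_form Ks L m nu f g =
  local_form Ks L m nu (fun x => f x * \1_D x) (fun x => g x * \1_D x).
Proof.
move=> gL LD; rewrite !local_formE//; congr trunc; apply/funext => x.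
  rewrite !indicE; case: (boolP (x \in cset L)) => [|_]; last by rewrite !mulr0.
  rewrite in_setE => Lx; rewrite [x \in D]mem_set ?mulr1//; apply: LD.
  by rewrite -dilate1 in Lx; apply: dilateS Lx => //; rewrite ler1n.
rewrite !indicE; case: (boolP (x \in dilate 3 L)) => [|_]; last by rewrite !mulr0.
by rewrite in_setE => Lx; rewrite [x \in D]mem_set ?mulr1//; exact: LD.
Qed.

Lemma stopping_form_restrict (D : set (RR R d)) Q Qs m nu (f g : RR R d -> R[i]) :
  grid Q -> Qs `<=` grid -> dilate 3 Q `<=` D ->
  (forall L, Qs L -> cset L `<=` cset Q -> dilate 3 L `<=` dilate 3 Q) ->
  stopping_form Ks Q Qs m nu f g =
  stopping_form Ks Q Qs m nu (fun x => f x * \1_D x) (fun x => g x * \1_D x).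
Proof.
move=> gQ gQs QD LQ; rewrite !stopping_formE -local_form_restrict//; congr (_ - _).
apply: eq_fsbigr => L; rewrite in_setE => -[QL sL _].
by apply: local_form_restrict; [exact: gQs|exact: subset_trans (LQ _ QL sL) QD].
Qed.

Context (r p1 p2 : R) (r1 : 1 < r) (p1_ge1 : 1 <= p1) (p2_ge1 : 1 <= p2).
Context (Kdef : trunc_defined r%:E p1%:E p2%:E Ks) (CT_fin : (C_T r%:E Ks < +oo)%E).
Let p1_gt0 : 0 < p1. Proof. exact: lt_le_trans p1_ge1. Qed.
Let p2_gt0 : 0 < p2. Proof. exact: lt_le_trans p2_ge1. Qed.

(** The vector form depends on f and g only through the sum over i of
    f_i(y) conj(g_i(x)). *)
Lemma eq_sum_trunc m nu f g f' g' :
  (forall i, admissible p1 (f i)) -> (forall i, admissible p2 (g i)) ->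
  (forall i, admissible p1 (f' i)) -> (forall i, admissible p2 (g' i)) ->
  (forall x y, \sum_i f i y * (g i x)^* = \sum_i f' i y * (g' i x)^*) ->
  \sum_i trunc Ks m nu (f i) (g i) = \sum_i trunc Ks m nu (f' i) (g' i).
Proof.
move=> af ag af' ag' e.
have s h k : (forall i, admissible p1 (h i)) -> (forall i, admissible p2 (k i)) ->
    \sum_i trunc Ks m nu (h i) (k i) = cintegral mu2 setT
      (fun z => kern Ks m nu z.1 z.2 * \sum_(i < n) h i z.2 * (k i z.1)^*).
  move=> ah ak; rewrite -cintegral_sum//; last first.
    by move=> i; exact: (integrable_admissible Kdef).
  apply: eq_cintegral => z _; rewrite mulr_sumr; apply: eq_bigr => i _.
  by rewrite trunc_integrandE mulrA.
by rewrite !s//; apply: eq_cintegral => z _; rewrite e.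
Qed.

Lemma eq_sum_local_form Q m nu f g f' g' :
  (forall i, admissible p1 (f i)) -> (forall i, admissible p2 (g i)) ->
  (forall i, admissible p1 (f' i)) -> (forall i, admissible p2 (g' i)) ->
  (forall x y, \sum_i f i y * (g i x)^* = \sum_i f' i y * (g' i x)^*) ->
  \sum_i local_form Ks Q m nu (f i) (g i) = \sum_i local_form Ks Q m nu (f' i) (g' i).
Proof.
move=> af ag af' ag' e; have mQ := measurable_cset Q.
apply: (@eq_sum_trunc _ _ (fun i y => f i y * \1_(cset Q) y) g
  (fun i y => f' i y * \1_(cset Q) y) g') => //.
- by move=> i; exact: admissible_indic.
- by move=> i; exact: admissible_indic.
- move=> x y; under eq_bigr do rewrite mulrAC.
  by under [RHS]eq_bigr do rewrite mulrAC; rewrite -!mulr_suml e.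
Qed.

Lemma sum_stopping_formE Q Qs m nu f g : Qs `<=` grid -> trivIset Qs (@cset R d) ->
  \sum_i stopping_form Ks Q Qs m nu (f i) (g i) =
  \sum_i local_form Ks Q m nu (f i) (g i) -
  \sum_(L \in big_children Q Qs m) \sum_i local_form Ks L m nu (f i) (g i).
Proof.
move=> gQs tQs; under eq_bigr do rewrite stopping_formE.
rewrite sumrB; congr (_ - _); have fin := @finite_big_children R d Q Qs m gQs tQs.
rewrite fsbig_finite//= exchange_big /=; apply: eq_bigr => i _.
by rewrite fsbig_finite.
Qed.

Lemma eq_sum_stopping_form Q Qs m nu f g f' g' : Qs `<=` grid -> trivIset Qs (@cset R d) ->
  (forall i, admissible p1 (f i)) -> (forall i, admissible p2 (g i)) ->
  (forall i, admissible p1 (f' i)) -> (forall i, admissible p2 (g' i)) ->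
  (forall x y, \sum_i f i y * (g i x)^* = \sum_i f' i y * (g' i x)^*) ->
  \sum_i stopping_form Ks Q Qs m nu (f i) (g i) =
  \sum_i stopping_form Ks Q Qs m nu (f' i) (g' i).
Proof.
move=> gQs tQs af ag af' ag' e; rewrite !sum_stopping_formE//.
congr (_ - _); first exact: eq_sum_local_form.
by apply: eq_fsbigr => L _; exact: eq_sum_local_form.
Qed.

Lemma lebesgue_bigsetU_le (I : Type) (s : seq I) (A : I -> set (RR R d)) :
  (forall i, measurable (A i)) ->
  (mu (\big[setU/set0]_(i <- s) A i) <= \sum_(i <- s) mu (A i))%E.
Proof.
move=> mA; elim: s => [|i s IH]; first by rewrite !big_nil measure0.
rewrite !big_cons; apply: (@le_trans _ _ (mu (A i) + mu (\big[setU/set0]_(i <- s) A i)))%E.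
  by apply: measureU2 => //; exact: bigsetU_measurable.
by rewrite leeD2l.
Qed.

Context (d0 : (0 < d)%N) (n0 : (0 < n)%N) (C : R).
Context (B1 : local_bound1 p1%:E p2%:E C Ks) (B2 : local_bound2 p2%:E C Ks).

Definition sparse_constant : R :=
  2 ^+ (37 * d) * (CT Ks r + C) * n%:R `^ (3 / 2 + p1^-1 + p2^-1).

Lemma sparse_constant_ge0 : 0 <= sparse_constant.
Proof.
rewrite !mulr_ge0 ?exprn_ge0 ?powR_ge0// addr_ge0//; first exact: (CT_ge0 r1).
exact: constant_ge0 d0 _ _ _ _ p1_ge1 p2_ge1 B1.
Qed.

(** 240^2 < 2^16; the remaining factors are 2 <= 2^d and n <= n^(3/2). *)
Lemma stopping_constant_le :
  2 ^+ (20 * d) * (240 ^+ d * 240 ^+ d) * 2 * (n%:R * (n%:R `^ p1^-1 * n%:R `^ p2^-1))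
  <= 2 ^+ (37 * d) * n%:R `^ (3 / 2 + p1^-1 + p2^-1) :> R.
Proof.
have n1 : 1 <= n%:R :> R by rewrite ler1n.
have nn0 : 0 < n%:R :> R by rewrite ltr0n.
have A0 : 0 <= 240 ^+ d :> R by rewrite exprn_ge0.
have A2 : 240 ^+ d <= 2 ^+ (8 * d) :> R.
  by rewrite exprM lerXn2r ?nnegrE ?exprn_ge0// !exprS expr0; lra.
have -> : (37 * d = 20 * d + (8 * d + 8 * d) + d)%N by lia.
apply: ler_pM.
- by rewrite !mulr_ge0// exprn_ge0.
- by rewrite !mulr_ge0 ?powR_ge0.
- rewrite (exprD _ (20 * d + (8 * d + 8 * d))) (exprD _ (20 * d)) (exprD _ (8 * d)); apply: ler_pM; rewrite ?mulr_ge0// ?exprn_ge0//.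
    by rewrite ler_pM2l ?exprn_gt0//; apply: ler_pM.
  by rewrite -[leLHS]expr1 ler_weXn2l// ler1n.
- rewrite -[X in X * _]powRr1 ?(ltW nn0)// -!powRD ?(gt_eqF nn0) ?implybT//.
  by apply: ler_powR => //; lra.
Qed.

(** In normalized coordinates F_i, G_i, let E be the union of the exceptional sets of
    all F_i and G_i on 3Q and W the Whitney cubes of E. The scalar estimate applies to
    each pair with the same W, and W depends neither on the truncation nor on i. *)
Lemma vector_stopping_estimate Q f g : grid Q ->
  (forall i, admissible p1 (f i)) -> (forall i, admissible p2 (g i)) ->
  exists W, [/\ stopping_collection grid Q W, forall L, W L -> (scale L + 5 <= scale Q)%R,
    (mu (shadow W) <= (2^-1 * vol Q)%:E)%E &
    forall m nu, normc (\sum_i stopping_form Ks Q W m nu (f i) (g i)) <=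
      sparse_constant * (vol (dil (gt0_3 R) Q) *
        fine (body_radius p1 p2 (dil (gt0_3 R) Q) f g))].
Proof.
move=> [k [x0 ->]] af ag; set Q0 := dyad k x0; set Q3 := dil _ _.
have [U [V [a [b [e ha hb hab]]]]] := normalized_coordinates Q3 p1_ge1 p2_ge1 af ag.
set rho := fine _ in hab *.
have mQ3 : measurable (dilate 3 Q0) by exact: measurable_dilate.
pose F i x := combine U f i x * \1_(dilate 3 Q0) x.
pose G i x := combine V g i x * \1_(dilate 3 Q0) x.
have aUf := admissible_combine U p1_gt0 af; have aVg := admissible_combine V p2_gt0 ag.
have aF i : admissible p1 (F i) by exact: admissible_indic.
have aG i : admissible p2 (G i) by exact: admissible_indic.
have v3 (h : RR R d -> R[i]) : vanishes_off (fun x => h x * \1_(dilate 3 Q0) x) (dilate 3 Q0).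
  by move=> x nx; rewrite indicE memNset ?mulr0.
have pint p (h : RR R d -> R[i]) : 0 < p ->
    powint p (fun x => h x * \1_(dilate 3 Q0) x) setT = powint p h (cset Q3).
  move=> p0; have := @powint_support _ _ p (fun x => h x * \1_(dilate 3 Q0) x) Q3 p0.
  rewrite {1}cset_dil => /(_ (v3 h)) ->.
  by apply: eq_integral => x; rewrite cset_dil => x3; rewrite indicE x3 mulr1.
(* 240 = 4 * 3 * 20: with 20^d from the weak-type inequality and 3^d from the
   volume of 3Q, each of the 2n exceptional sets has measure at most |Q| / (4^d n). *)
pose A : R := 240 ^+ d; have A1 : 1 <= A by rewrite exprn_ege1// ler1n.
have A0 : 0 < A by rewrite (lt_le_trans _ A1).
have nn0 : 0 < n%:R :> R by rewrite ltr0n.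
pose l1 i := A * n%:R `^ p1^-1 * a i; pose l2 i := A * n%:R `^ p2^-1 * b i.
have l10 i : 0 <= l1 i by rewrite !mulr_ge0 ?(ltW A0) ?powR_ge0//; have [] := ha i.
have l20 i : 0 <= l2 i by rewrite !mulr_ge0 ?(ltW A0) ?powR_ge0//; have [] := hb i.
have mF i : cmeasurable setT (F i) by have [/(inLpP _ p1_gt0)[]] := aF i.
have mG i : cmeasurable setT (G i) by have [/(inLpP _ p2_gt0)[]] := aG i.
pose X i := exceptional p1 (F i) (l1 i) `|` exceptional p2 (G i) (l2 i).
have mX i : measurable (X i) by apply: measurableU; exact: measurable_exceptional.
pose E := \big[setU/set0]_(i < n) X i.
have mE : measurable E by exact: bigsetU_measurable.
have oE : dyadically_open E.
  rewrite /E; apply: big_ind => //; first exact: dyadically_openU.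
  by move=> i _; apply: dyadically_openU; exact: dyadically_open_exceptional.
have XE i : X i `<=` E by rewrite /E (bigD1 i)//=; exact: subsetUl.
have v0 : 0 < vol Q0 := vol_gt0 Q0.
have small : 20 ^+ d * vol Q3 / (A * n%:R) = 4^-1 ^+ d * vol Q0 / n%:R.
  rewrite /A vol_dil invfM (mulrA _ (_ ^-1)) mulrA -exprMn; congr (_ / _).
  rewrite mulrAC -exprVn -exprMn; congr (_ ^+ _ * _).
  by lra.
have sE : (mu E <= (2^-1 ^+ d * vol Q0)%:E)%E.
  apply: (le_trans (lebesgue_bigsetU_le _ mX)).
  apply: (@le_trans _ _ (\sum_(i < n) (2 * (4^-1 ^+ d * vol Q0 / n%:R))%:E)%E).
    apply: lee_sum => i _; rewrite mulr2n mulrDl mul1r EFinD.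
    apply: (@le_trans _ _ (mu (exceptional p1 (F i) (l1 i)) + mu (exceptional p2 (G i) (l2 i)))%E).
      by apply: measureU2; exact: measurable_exceptional.
    have [a0 ea] := ha i; have [b0 eb] := hb i.
    rewrite -small; apply: leeD.
      by apply: exceptional_small => //; rewrite ?(ltW (vol_gt0 _))// pint// ea.
    by apply: exceptional_small => //; rewrite ?(ltW (vol_gt0 _))// pint// eb.
  rewrite sumEFin lee_fin sumr_const card_ord.
  have -> : (2 * (4^-1 ^+ d * vol Q0 / n%:R)) *+ n = 2 * 4^-1 ^+ d * vol Q0.
    by rewrite -[LHS]mulr_natl; field; rewrite gt_eqF.
  rewrite ler_pM2r// (_ : 4^-1 = 2^-1 * 2^-1 :> R); last by lra.
  rewrite exprMn mulrA -[leRHS]mul1r ler_pM2r ?exprn_gt0 ?invr_gt0//.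
  by rewrite exprVn ler_pdivrMr ?exprn_gt0// mul1r -[leLHS]expr1 ler_weXn2l// ler1n.
exists (whitney Q0 E); have st := stopping_whitney d0 oE mE sE.
have [[gW tW] _ _ _] := st; have sW := whitney_scale d0 mE sE; split => //.
- by move=> L WL; rewrite scale_dyad; exact: sW.
- apply: (@le_trans _ _ (mu E)).
    apply: le_measure; rewrite ?in_setE//; last exact: whitney_sub.
    exact: measurable_shadow.
  apply: (le_trans sE); rewrite lee_fin ler_pM2r// -[leRHS]expr1.
  by apply: ler_wiXn2l => //; lra.
move=> m nu; rewrite (@eq_sum_stopping_form _ _ _ _ f g (combine U f) (combine V g))//.
have gQ : grid Q0 by exists k, x0.
have res i : stopping_form Ks Q0 (whitney Q0 E) m nu (combine U f i) (combine V g i) =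
    stopping_form Ks Q0 (whitney Q0 E) m nu (F i) (G i).
  apply: stopping_form_restrict => // L WL LQ; apply: grid_triple_mono => //; first exact: gW.
  by rewrite scale_dyad (le_trans _ (sW L WL))// lerDl.
under eq_bigr do rewrite res.
have C0 : 0 <= C by exact: constant_ge0 d0 _ _ _ _ p1_ge1 p2_ge1 B1.
have CT0 := CT_ge0 r1 CT_fin.
have rho0 : 0 <= rho by rewrite fine_ge0// body_radius_ge0.
apply: (le_trans (normc_sum _ _)).
pose B : R := 2 ^+ (20 * d) * (CT Ks r + C) * vol Q0.
have B0 : 0 <= B by rewrite !mulr_ge0 ?exprn_ge0 ?addr_ge0// ltW.
pose D : R := B * (A * A * (n%:R `^ p1^-1 * n%:R `^ p2^-1) * (2 * rho)).
apply: (@le_trans _ _ (\sum_(i < n) D)).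
  apply: ler_sum => i _; apply: (@le_trans _ _ (B * l1 i * l2 i)).
    have yF : (Ynorm p1%:E (whitney Q0 E) (F i) <= (l1 i)%:E)%E.
      apply: Ynorm_whitney => //; first exact: v3.
      by apply: subset_trans (XE i); exact: subsetUl.
    have yG : (Ynorm p2%:E (whitney Q0 E) (G i) <= (l2 i)%:E)%E.
      apply: Ynorm_whitney => //; first exact: v3.
      by apply: subset_trans (XE i); exact: subsetUr.
    have [iF _] := aF i; have [iG _] := aG i.
    by apply: (stopping_estimate Ksupp r1 p1_ge1 p2_ge1 Kdef CT_fin d0) => //; exact: v3.
  rewrite -mulrA ler_wpM2l// /l1 /l2.
  have -> : A * n%:R `^ p1^-1 * a i * (A * n%:R `^ p2^-1 * b i) =
      A * A * (n%:R `^ p1^-1 * n%:R `^ p2^-1) * (a i * b i) by ring.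
  by rewrite ler_wpM2l// !mulr_ge0 ?powR_ge0 ?(ltW A0).
rewrite sumr_const card_ord -[leLHS]mulr_natl.
have -> : n%:R * D = 2 ^+ (20 * d) * (A * A) * 2 * (n%:R * (n%:R `^ p1^-1 * n%:R `^ p2^-1)) *
    ((CT Ks r + C) * vol Q0 * rho) by rewrite /D /B; ring.
apply: (@le_trans _ _ (2 ^+ (37 * d) * n%:R `^ (3 / 2 + p1^-1 + p2^-1) *
    ((CT Ks r + C) * vol Q0 * rho))).
  by rewrite ler_wpM2r ?stopping_constant_le// !mulr_ge0 ?addr_ge0// ltW.
have -> : 2 ^+ (37 * d) * n%:R `^ (3 / 2 + p1^-1 + p2^-1) * ((CT Ks r + C) * vol Q0 * rho) =
    sparse_constant * (vol Q0 * rho) by rewrite /sparse_constant; ring.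
rewrite ler_wpM2l ?sparse_constant_ge0// ler_wpM2r// vol_dil ler_peMl ?(ltW v0)//.
by rewrite exprn_ege1// ler1n.
Qed.

End vector_forms.

(** * Summation over the tree of cubes *)

Lemma esum_bigcup_trivIset (R : realType) (T T' : choiceType) (K : set T') (J : T' -> set T)
    (a : T -> \bar R) : trivIset setT J -> (forall x, (0 <= a x)%E) ->
  (\esum_(i in \bigcup_(k in K) J k) a i = \esum_(k in K) \esum_(j in J k) a j)%E.
Proof.
move=> tJ a0; rewrite esum_esum//; apply: reindex_esum => //; split.
- by move=> [/= i j] [Ki Jij]; exists i.
- move=> [/= i1 j1] [/= i2 j2]; rewrite !in_setE /= => -[K1 J1] [K2 J2] j12.
  by congr (_, _) => //; apply: (@tJ i1 i2) => //; exists j1; split=> //; rewrite j12.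
- by move=> j [i Ki Jij]/=; exists (i, j).
Qed.

Section descendants.
Context (R : realType) (d : nat).
Implicit Types (Q L P : cube R d).
Local Notation mu := (lebesgue R d).
Local Notation grid := (@grid R d).

Inductive descendant (ch : cube R d -> set (cube R d)) Q : set (cube R d) :=
| descendant_refl : descendant ch Q Q
| descendant_child L P : ch Q L -> descendant ch L P -> descendant ch Q P.

Definition remainder (ch : cube R d -> set (cube R d)) Q := cset Q `\` shadow (ch Q).

Context (ch : cube R d -> set (cube R d)).
Context (chS : forall Q, grid Q -> forall L, ch Q L ->
  [/\ grid L, cset L `<=` cset Q & (scale L + 1 <= scale Q)%R]).
Context (tch : forall Q, grid Q -> trivIset (ch Q) (@cset R d)).

Lemma descendantS Q P : descendant ch Q P -> grid Q -> grid P /\ cset P `<=` cset Q.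
Proof.
elim=> [Q' gQ|Q' L P' QL _ IH gQ]; first by split.
have [gL LQ _] := chS gQ QL; have [gP PL] := IH gL.
by split => //; exact: subset_trans PL LQ.
Qed.

Lemma descendant_scale Q P : descendant ch Q P -> grid Q -> (scale P <= scale Q)%R.
Proof.
elim=> [Q' gQ|Q' L P' QL _ IH gQ] //; have [gL _ s] := chS gQ QL.
by rewrite (le_trans (IH gL))// (le_trans _ s)// lerDl.
Qed.

(** The cubes below Q are Q itself, whose remainder avoids its children, and the
    cubes below one of the disjoint children. *)
Lemma remainder_disjoint Q P P' : descendant ch Q P -> grid Q -> descendant ch Q P' ->
  remainder ch P `&` remainder ch P' !=set0 -> P = P'.
Proof.
have off Q' L P0 : grid Q' -> ch Q' L -> descendant ch L P0 ->
    ~ (remainder ch Q' `&` remainder ch P0 !=set0).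
  move=> gQ QL LP [z [[_ nz] [zP _]]]; apply: nz; exists L => //.
  by have [gL _ _] := chS gQ QL; have [_] := descendantS LP gL; exact.
move=> QP; elim: QP P' => [Q' P' gQ|Q' L P0 QL LP IH P' gQ].
  case=> // L P0 QL LP PP; case: (off _ _ _ gQ QL LP PP).
case=> [|L' P1 QL' LP1 PP]; first by rewrite setIC => /(off _ _ _ gQ QL LP).
have [gL _ _] := chS gQ QL; have [gL' _ _] := chS gQ QL'.
have LL : L = L'.
  apply: (tch gQ) => //; have [z [[zP _] [zP1 _]]] := PP; exists z.
  by split; [have [_] := descendantS LP gL; exact|have [_] := descendantS LP1 gL'; exact].
by apply: IH => //; rewrite LL.
Qed.

Context (sch : forall Q, grid Q -> (mu (shadow (ch Q)) <= (2^-1 * vol Q)%:E)%E).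

Lemma measurable_remainder Q : grid Q -> measurable (remainder ch Q).
Proof.
move=> gQ; apply: measurableD; first exact: measurable_cset.
by apply: measurable_shadow => L QL; have [] := chS gQ QL.
Qed.

Lemma remainder_large Q : grid Q -> ((2^-1 * vol Q)%:E <= mu (remainder ch Q))%E.
Proof.
move=> gQ; have mr := measurable_remainder gQ.
have ms : measurable (shadow (ch Q)).
  by apply: measurable_shadow => L QL; have [] := chS gQ QL.
rewrite leNgt; apply/negP => lt.
have : (mu (cset Q) <= mu (remainder ch Q) + mu (shadow (ch Q)))%E.
  apply: le_trans (measureU2 _ mr ms); apply: le_measure; rewrite ?in_setE//.
  - exact: measurable_cset.
  - exact: measurableU.
  - by move=> x Qx; case: (pselect (shadow (ch Q) x)) => sx; [right|left].
rewrite lebesgue_vol leNgt => /negP; apply.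
have -> : (vol Q)%:E = ((2^-1 * vol Q)%:E + (2^-1 * vol Q)%:E)%E.
  by rewrite -EFinD; congr EFin; lra.
apply: lte_leD => //; last exact: sch.
by rewrite ge0_fin_numE// (le_lt_trans (sch gQ)) ?ltry.
Qed.

(** The remainder of P is at least half of P, that is 3^-d / 2 of 3P. *)
Lemma sparse_descendants Q : grid Q ->
  sparse (3^-1 ^+ d / 2) (dil (gt0_3 R) @` descendant ch Q).
Proof.
move=> gQ; pose E C := [set x | exists2 P, descendant ch Q P /\ dil (gt0_3 R) P = C &
  remainder ch P x].
have EP P : descendant ch Q P -> E (dil (gt0_3 R) P) = remainder ch P.
  move=> QP; apply/seteqP; split => [x [P' [QP' /dil_inj ->]]//|x Px].
  by exists P.
exists E.
  move=> _ _ [P QP <-] [P' QP' <-]; rewrite !EP// => PP.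
  by rewrite (remainder_disjoint QP gQ QP' PP).
move=> _ [P QP <-]; rewrite EP//; have [gP _] := descendantS QP gQ.
split; first exact: measurable_remainder.
  move=> x [Px _]; rewrite cset_dil; rewrite -dilate1 in Px.
  by apply: dilateS Px => //; rewrite ler1n.
apply: le_trans (remainder_large gP).
rewrite lebesgue_vol vol_dil -EFinM lee_fin.
rewrite (_ : 3^-1 ^+ d / 2 * (3 ^+ d * vol P) = (3^-1 * 3) ^+ d * (2^-1 * vol P)); last first.
  by rewrite exprMn; ring.
by rewrite mulVf// expr1n mul1r.
Qed.

Lemma esum_subset (A B : set (cube R d)) (T : cube R d -> \bar R) : A `<=` B ->
  (\esum_(P in A) T P <= \esum_(P in B) T P)%E.
Proof.
move=> AB; apply: ge_ereal_sup => _ [X [finX XA] <-]; apply: esum_ge; exists X => //.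
by split => //; exact: subset_trans AB.
Qed.

(** By induction on the scale of Q above m. The trees below different children are
    disjoint and do not contain Q, so that no term of the sum is used twice. *)
Lemma sum_le_descendants m (lam : cube R d -> R[i]) (T : cube R d -> \bar R) :
  (forall Q, (0 <= T Q)%E) ->
  (forall Q, finite_set [set L | ch Q L /\ (m < scale L)%R]) ->
  (forall Q, (scale Q <= m)%R -> lam Q = 0) ->
  (forall Q, grid Q -> ((normc (lam Q -
     \sum_(L \in [set L | ch Q L /\ (m < scale L)%R]) lam L))%:E <= T Q)%E) ->
  forall Q, grid Q -> ((normc (lam Q))%:E <= \esum_(P in descendant ch Q) T P)%E.
Proof.
move=> T0 fin lam0 step.
suff ind (N : nat) Q : (scale Q <= m + N%:Z)%R -> grid Q ->
    ((normc (lam Q))%:E <= \esum_(P in descendant ch Q) T P)%E.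
  move=> Q gQ; apply: (ind `|scale Q - m|%N) => //.
  by rewrite -lerBlDl abszE ler_norm.
elim: N Q => [|N IH] Q sQ gQ.
  by rewrite lam0 ?normc0 ?esum_ge0//; move: sQ; rewrite addr0.
set B := [set L | ch Q L /\ (m < scale L)%R] in step fin *.
pose J L := [set P | ch Q L /\ descendant ch L P].
have tJ : trivIset setT J.
  move=> L L' _ _ [P [[QL LP] [QL' LP']]]; apply: (tch gQ) => //.
  have [gL _ _] := chS gQ QL; have [gL' _ _] := chS gQ QL'.
  exists (corner P); split.
    by have [_] := descendantS LP gL; apply; exact: corner_cset.
  by have [_] := descendantS LP' gL'; apply; exact: corner_cset.
have -> : lam Q = (lam Q - \sum_(L \in B) lam L) + \sum_(L \in B) lam L by rewrite subrK.
apply: (@le_trans _ _ (T Q + \esum_(P in \bigcup_(L in B) J L) T P)%E).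
  apply: (@le_trans _ _ ((normc (lam Q - \sum_(L \in B) lam L))%:E +
      (normc (\sum_(L \in B) lam L))%:E)%E).
    by rewrite -EFinD lee_fin le_normcD.
  apply: leeD; first exact: step.
  rewrite esum_bigcup_trivIset// esum_fset//; last 2 first.
  - exact: fin.
  - by move=> L _; exact: esum_ge0.
  apply: (@le_trans _ _ (\sum_(L \in B) (normc (lam L))%:E)%E).
    rewrite !fsbig_finite//=; try exact: fin.
    by rewrite sumEFin lee_fin normc_sum.
  apply: lee_fsum; first exact: fin.
  move=> L [QL mL]; have [gL _ s] := chS gQ QL.
  rewrite (_ : J L = descendant ch L); last by apply/seteqP; split => [P []|P].
  by apply: IH => //; move: sQ s; lia.
rewrite [X in (_ <= X)%E](esumID [set Q])//; apply: leeD.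
  rewrite (_ : _ `&` _ = [set Q]) ?esum_set1//.
  by apply/seteqP; split => [P []//|P ->]; split => //; exact: descendant_refl.
apply: esum_subset => P [L [QL _] [_ LP]]; split; first exact: descendant_child QL LP.
move=> PQ; have [gL _ s] := chS gQ QL; have := descendant_scale LP gL.
by rewrite PQ; move: s; lia.
Qed.

End descendants.

(** * Reduction to one large cube *)

Section top_cube.
Context (R : realType) (d n : nat).
Implicit Types (Q : cube R d) (f g : 'I_n -> RR R d -> R[i]).
Local Notation grid := (@grid R d).

Lemma common_support_bound f : (forall i, compact (supp (f i))) ->
  exists2 M : R, 0 <= M & forall i x j, f i x != 0 -> `|tnth x j| <= M.
Proof.
move=> cf; have /choice[M hM] : forall i, exists M : R, 0 <= M /\
    forall x j, f i x != 0 -> `|tnth x j| <= M.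
  by move=> i; have [M M0 hM] := compact_supp_bound (cf i); exists M.
exists (\sum_i M i); first by apply: sumr_ge0 => i _; have [] := hM i.
move=> i x j fx; have [_ /(_ x j fx)] := hM i => /le_trans; apply.
by rewrite (bigD1 i)//= lerDl sumr_ge0// => k _; have [] := hM k.
Qed.

(** A cube Q of side 2^K that contains the supports and has twice their extent: the
    scales above K do not see them, and restricting f to Q changes nothing. *)
Lemma trunc_top_cube (Ks : int -> RR R d -> RR R d -> R[i]) f g : kernel_support Ks ->
  (forall i, compact (supp (f i))) -> (forall i, compact (supp (g i))) ->
  exists2 Q, grid Q & forall m nu i,
    trunc Ks m nu (f i) (g i) = local_form Ks Q m nu (f i) (g i).
Proof.
move=> Ksupp cf cg; have [M1 M10 hM1] := common_support_bound cf.
have [M2 M20 hM2] := common_support_bound cg.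
pose M := M1 + M2; have M0 : 0 <= M by rewrite addr_ge0.
have [K _ hK] := exists_pow2_gt (3 * M + 4 * M * d%:R) 0.
have dM0 : 0 <= M * d%:R by rewrite mulr_ge0.
pose o : RR R d := [tuple 0 | i < d]; pose Q := dyad K o.
exists Q; first by exists K, o.
move=> m nu i; apply: eq_trunc => x y.
have [->|fy] := eqVneq (f i y) 0; first by rewrite mul0r !mulr0 !mul0r.
have [->|gx] := eqVneq (g i x) 0; first by rewrite (rmorph0 Num.conj) !mulr0.
have yM j : `|tnth y j| <= M by rewrite (le_trans (hM1 i y j fy))// lerDl.
have xM j : `|tnth x j| <= M by rewrite (le_trans (hM2 i x j gx))// lerDr.
have Qy : cset Q y.
  apply/dyadP; apply: (@gindex_center R d M) => //; first by lra.
  by move=> j; rewrite tnth_mktuple normr0.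
rewrite indicE mem_set// mulr1 scale_dyad; congr (_ * _ * _).
case: (leP K nu) => Knu //; apply/esym/kern_far => //.
apply: (le_trans (edist_le_sum _ _)).
apply: (@le_trans _ _ (\sum_(j < d) (M + M))).
  by apply: ler_sum => j _; rewrite (le_trans (ler_normB _ _))// lerD.
rewrite sumr_const card_ord -[leLHS]mulr_natr.
have := hK; rewrite -[in X in X -> _](subrK 1 K) pow2S; lra.
Qed.

Lemma esumZ_le (T : choiceType) (A : set T) (c : R) (a : T -> \bar R) : 0 <= c ->
  (forall x, (0 <= a x)%E) ->
  (\esum_(x in A) (c%:E * a x) <= c%:E * \esum_(x in A) a x)%E.
Proof.
move=> c0 a0; apply: ge_ereal_sup => _ [X [finX XA] <-].
rewrite -ge0_mule_fsumr//; apply: lee_wpmul2l; first by rewrite lee_fin.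
by apply: esum_ge; exists X.
Qed.

End top_cube.

Theorem theorem4p3 (R : realType) :
  exists2 Theta : R, 0 < Theta &
  exists2 eta : nat -> nat -> R,
    (forall d n, (0 < d)%N -> (0 < n)%N -> 0 < eta d n < 1) &
  forall (d n : nat) (r p1 p2 : R)
    (Lam : (RR R d -> R[i]) -> (RR R d -> R[i]) -> R[i])
    (K : RR R d -> RR R d -> R[i]) (Ks : int -> RR R d -> RR R d -> R[i])
    (C_L : R),
  (0 < d)%N -> (0 < n)%N -> 1 < r -> 1 <= p1 -> 1 <= p2 ->
  bounded_sesquilinear r%:E Lam ->
  kernel_off_diagonal r%:E Lam K ->
  kernel_decomposition K Ks ->
  kernel_support Ks ->
  trunc_defined r%:E p1%:E p2%:E Ks ->
  (C_T r%:E Ks < +oo)%E ->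
  local_bound1 p1%:E p2%:E C_L Ks ->
  local_bound2 p2%:E C_L Ks ->
  forall f g : 'I_n -> RR R d -> R[i],
  (forall i, inLp (lebesgue R d) p1%:E (f i) /\ compact (supp (f i))) ->
  (forall i, inLp (lebesgue R d) p2%:E (g i) /\ compact (supp (g i))) ->
  exists2 S : set (cube R d), sparse (eta d n) S &
    (ereal_sup [set (normc (vector_trunc Ks z.1 z.2 f g))%:E
               | z in [set z : int * int | (z.1 < z.2)%R]] <=
     (2 `^ (Theta * d%:R))%:E * (C_T r%:E Ks + C_L%:E) *
     (n%:R `^ (3 / 2 + p1^-1 + p2^-1))%:E *
     sparse_form p1%:E p2%:E S f g)%E.
Proof.
(* 37 = 20 + 16 + 1, from [stopping_estimate] and [stopping_constant_le]. *)
exists 37 => //; exists (fun d _ => 3^-1 ^+ d / 2).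
  move=> d n d0 _; have h0 : 0 < 3^-1 ^+ d :> R by rewrite exprn_gt0 ?invr_gt0.
  have h1 : 3^-1 ^+ d <= 1 :> R by rewrite exprn_ile1//; lra.
  by apply/andP; split; lra.
move=> d n r p1 p2 Lam K Ks C d0 n0 r1 p1_ge1 p2_ge1 _ _ _ Ksupp Kdef CT_fin B1 B2 f g hf hg.
have af i : admissible p1 (f i).
  by have [fp cf] := hf i; split => //; exact: bounded_support_compact.
have ag i : admissible p2 (g i).
  by have [gp cg] := hg i; split => //; exact: bounded_support_compact.
have [Q0 gQ0 top] := trunc_top_cube Ksupp (fun i => (hf i).2) (fun i => (hg i).2).
(* The collection W Q is chosen before the truncation, so that one tree serves all
   of them. *)
have /choice[W hW] : forall Q, exists W, grid Q ->
    [/\ stopping_collection (@grid R d) Q W, forall L, W L -> (scale L + 5 <= scale Q)%R,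
      (lebesgue R d (shadow W) <= (2^-1 * vol Q)%:E)%E &
      forall m nu, normc (\sum_i stopping_form Ks Q W m nu (f i) (g i)) <=
        sparse_constant n Ks r p1 p2 C * (vol (dil (gt0_3 R) Q) *
          fine (body_radius p1 p2 (dil (gt0_3 R) Q) f g))].
  move=> Q; have [gQ|nQ] := pselect (grid Q); last by exists set0.
  by have [W hW] := vector_stopping_estimate Ksupp r1 p1_ge1 p2_ge1 Kdef CT_fin d0 n0 B1 B2 gQ af ag; exists W.
pose ch Q : set (cube R d) := [set L | [/\ grid Q, W Q L & cset L `<=` cset Q]].
have chS Q : grid Q -> forall L, ch Q L ->
    [/\ grid L, cset L `<=` cset Q & (scale L + 1 <= scale Q)%R].
  move=> gQ L [_ WL LQ]; have [[[gW _] _ _ _] sW _ _] := hW Q gQ.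
  by split => //; [exact: gW|rewrite (le_trans _ (sW L WL))// lerD2l].
have tch Q : grid Q -> trivIset (ch Q) (@cset R d).
  move=> gQ; have [[[_ tW] _ _ _] _ _ _] := hW Q gQ.
  by apply: sub_trivIset tW => L [].
have sch Q : grid Q -> (lebesgue R d (shadow (ch Q)) <= (2^-1 * vol Q)%:E)%E.
  move=> gQ; have [[[gW _] _ _ _] _ sW _] := hW Q gQ; apply: le_trans sW.
  apply: le_measure; rewrite ?in_setE.
  - by apply: measurable_shadow => L /(chS _ gQ)[].
  - exact: measurable_shadow.
  - by move=> x [L [_ WL _] Lx]; exists L.
exists (dil (gt0_3 R) @` descendant ch Q0).
  exact: sparse_descendants chS tch sch _ gQ0.
have cst0 := sparse_constant_ge0 n r1 p1_ge1 p2_ge1 CT_fin d0 B1.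
pose t (P : cube R d) : \bar R := (lebesgue R d (cset P) * body_radius p1 p2 P f g)%E.
have t0 P : (0 <= t P)%E by rewrite mule_ge0 ?body_radius_ge0.
have cE : ((2 `^ (37 * d%:R))%:E * (C_T r%:E Ks + C%:E) *
    (n%:R `^ (3 / 2 + p1^-1 + p2^-1))%:E = (sparse_constant n Ks r p1 p2 C)%:E)%E.
  rewrite (CT_E r1 CT_fin) -EFinD -!EFinM /sparse_constant; congr (_ * _ * _)%:E.
  by rewrite -natrM powR_mulrn.
rewrite cE; apply: ge_ereal_sup => _ [[m nu] /= _ <-].
apply: le_trans (esumZ_le _ cst0 t0).
rewrite esum_image; last by move=> P P' _ _; exact: dil_inj.
rewrite /vector_trunc; under eq_bigr do rewrite top.
have fin Q : finite_set [set L | ch Q L /\ (m < scale L)%R].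
  have [gQ|nQ] := pselect (grid Q); last first.
    by rewrite (_ : mkset _ = set0)//; apply/seteqP; split => // L [[]].
  have [[[gW tW] _ _ _] _ _ _] := hW Q gQ.
  apply: sub_finite_set (@finite_big_children R d Q (W Q) m gW tW).
  by move=> L [[_ WL LQ] mL]; split.
apply: (@sum_le_descendants R d ch chS tch m
  (fun Q => \sum_i local_form Ks Q m nu (f i) (g i))
  (fun P => (sparse_constant n Ks r p1 p2 C)%:E * t (dil (gt0_3 R) P))%E) => //.
- by move=> Q; rewrite mule_ge0// lee_fin.
- by move=> Q sQ; apply: big1 => i _; exact: local_form_empty.
move=> Q gQ; have [[[gW tW] _ _ _] _ _ est] := hW Q gQ.
have -> : [set L | ch Q L /\ (m < scale L)%R] = big_children Q (W Q) m.
  by apply/seteqP; split => [L [[_ WL LQ] mL]|L [WL LQ mL]]; split.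
rewrite -sum_stopping_formE//.
rewrite /t lebesgue_vol (body_radius_fin (dil (gt0_3 R) Q) p1_ge1 p2_ge1 af ag).
by rewrite -!EFinM lee_fin; exact: est.
Qed.
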